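(* Let $\alpha:\Gamma^{+}\to\operatorname{Aut}(A)$ be an action by automorphisms on a $C^*$-algebra $A$ of the positive cone $\Gamma^{+}$ of a totally ordered abelian group $\Gamma$. Let $\gamma_\infty=\tau\otimes\alpha^{-1}$ be the associated action of $\Gamma$ by automorphisms of $B_\Gamma\otimes A$, let $p:=\overline{j}_{B_{\Gamma}\otimes A}(1_{0}\otimes 1_{M(A)})\in M((B_{\Gamma}\otimes A)\times_{\gamma_\infty}\Gamma)$, and let $\phi:A\times_{\alpha}^{\mathrm{piso}}\Gamma^{+}\to A\times_{\alpha}^{\mathrm{iso}}\Gamma^{+}$ be the natural surjection. Then there is an isomorphism of $A\times_{\alpha}^{\mathrm{piso}}\Gamma^{+}$ onto the full corner $p\,[(B_{\Gamma}\otimes A)\times_{\gamma_{\infty}}\Gamma]\,p$ of the crossed product $(B_{\Gamma}\otimes A)\times_{\gamma_{\infty}}\Gamma$, such that the ideal $\ker\phi$ of $A\times_{\alpha}^{\mathrm{piso}}\Gamma^{+}$ is carried isomorphically onto the ideal $p\,[(B_{\Gamma,\infty}\otimes A)\times_{\gamma_{\infty}}\Gamma]\,p$, where $B_{\Gamma,\infty}=\overline{\operatorname{span}}\{1_{s}-1_{t}:s<t\in\Gamma\}$.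
   Context: $\Gamma$ is regarded as discrete, $\Gamma^{+}=\{x\in\Gamma:x\ge 0\}$; actions of $\Gamma^+$ are semigroup homomorphisms with $0$ acting as the identity. $A$ need not be unital. The action $\alpha$ of $\Gamma^+$ by automorphisms extends to $\Gamma$ by $\alpha_{-x}=\alpha_x^{-1}$. $B_\Gamma:=\overline{\operatorname{span}}\{1_x:x\in\Gamma\}\subset\ell^\infty(\Gamma)$, where $1_x(y)=1$ if $y\ge x$ and $0$ if $y<x$; $\tau:\Gamma\to\operatorname{Aut}(B_\Gamma)$ is given by $\tau_s(1_x)=1_{x+s}$, and $(\gamma_\infty)_s=\tau_s\otimes\alpha_s^{-1}$ for $s\in\Gamma$. $(B_{\Gamma}\otimes A)\times_{\gamma_\infty}\Gamma$ is the usual group crossed product, $j_{B_\Gamma\otimes A}$ its canonical homomorphism of $B_\Gamma\otimes A$ and $\overline{j}_{B_\Gamma\otimes A}$ the extension to multiplier algebras. $B_{\Gamma,\infty}\otimes A$ is a $\gamma_\infty$-invariant ideal, so its crossed product is an ideal of $(B_{\Gamma}\otimes A)\times_{\gamma_\infty}\Gamma$. A corner $qCq$ of a $C^*$-algebra $C$ ($q\in M(C)$ a projection) is full if $\overline{\operatorname{span}}\,CqC=C$. A partial-isometric representation of $\Gamma^{+}$ is a map $V$ such that each $V_s$ is a partial isometry and $V_sV_t=V_{s+t}$. A covariant partial-isometric representation of $(A,\Gamma^{+},\alpha)$ on a Hilbert space $H$ (or in a $C^*$-algebra $B$, with $V$ taking values in $M(B)$) is a pair $(\pi,V)$ with $\pi$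 a non-degenerate representation of $A$ and $V$ a partial-isometric representation such that $\pi(\alpha_s(a))=V_s\pi(a)V_s^*$ and $V_s^*V_s\pi(a)=\pi(a)V_s^*V_s$. The partial-isometric crossed product $(A\times_\alpha^{\mathrm{piso}}\Gamma^+,i_A,i_{\Gamma^+})$ is the (unique up to isomorphism) $C^*$-algebra $B$ with a non-degenerate homomorphism $i_A:A\to B$ and partial-isometric representation $i_{\Gamma^+}:\Gamma^+\to M(B)$ such that $(i_A,i_{\Gamma^+})$ is covariant, every covariant partial-isometric representation $(\pi,V)$ on a Hilbert space yields a non-degenerate representation $\pi\times V$ of $B$ with $(\pi\times V)\circ i_A=\pi$ and $\overline{(\pi\times V)}\circ i_{\Gamma^+}=V$, and $B=\overline{\operatorname{span}}\{i_{\Gamma^+}(s)^*i_A(a)i_{\Gamma^+}(t)\}$. A covariant isometric representation is a pair $(\pi,V)$ with $\pi$ a non-degenerate representation of $A$, each $V_s$ an isometry, $V_sV_t=V_{s+t}$, and $\pi(\alpha_s(a))=V_s\pi(a)V_s^*$. The isometric crossed product $A\times_{\alpha}^{\mathrm{iso}}\Gamma^{+}$ is the $C^*$-algebra generated by a universal covariant isometric representation (for an automorphic action it is isomorphic to $A\times_\alpha\Gamma$). The natural surjection $\phi$ is induced by the universal covariant isometric representation, which is also a covariant partial-isometric representation; explicitly $\ker\phi=\overline{\operatorname{span}}\{i_{\Gamma^{+}}(x)^{*}i_{A}(a)(1-i_{\Gamma^{+}}(t)^{*}i_{\Gamma^{+}}(t))i_{\Gamma^{+}}(y):a\in A,\ x,y,t\in\Gamma^{+}\}$.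 *)

(* Defs.v *)
From HB Require Import structures.
From mathcomp Require Import all_boot all_order all_algebra.
From mathcomp Require Import all_classical all_reals all_analysis.
From mathcomp.real_closed Require Import complex.

Set Implicit Arguments.
Unset Strict Implicit.
Unset Printing Implicit Defensive.

Import Order.TTheory GRing.Theory Num.Theory.
Import numFieldNormedType.Exports.

Local Open Scope classical_set_scope.
Local Open Scope ring_scope.

HB.mixin Record isTotallyOrderedGroup G of Num.POrderedZmodule G := {
  le_totalG : total (<=%R : rel G);
  lerD_shift : forall z x y : G, x <= y -> z + x <= z + y
}.

#[short(type="ordGroupType")]
HB.structure Definition TotallyOrderedGroup :=
  {G of isTotallyOrderedGroup G & Num.POrderedZmodule G}.

Record pcone (G : ordGroupType) := PCone {
  pcone_val :> G;
  pcone_valP : 0 <= pcone_val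
}.
Arguments PCone {G}.

Section Pcone.
Variable G : ordGroupType.

HB.instance Definition _ := [isSub for @pcone_val G].
HB.instance Definition _ := [Choice of pcone G by <:].

Definition pcone0 : pcone G := PCone 0 (lexx 0).

Lemma pconeD_subproof (x y : pcone G) : 0 <= val x + val y.
Proof.
apply: (le_trans (pcone_valP x)).
by rewrite -{1}[pcone_val x]addr0; exact: lerD_shift (pcone_valP y).
Qed.

Definition pconeD (x y : pcone G) := PCone _ (pconeD_subproof x y).

Lemma pconeDA : associative pconeD.
Proof. by move=> x y z; apply: val_inj; rewrite /= addrA. Qed.
Lemma pconeDC : commutative pconeD.
Proof. by move=> x y; apply: val_inj; rewrite /= addrC. Qed.
Lemma pcone0D : left_id pcone0 pconeD.
Proof. by move=> x; apply: val_inj; rewrite /= add0r. Qed.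

HB.instance Definition _ :=
  GRing.isNmodule.Build (pcone G) pconeDA pconeDC pcone0D.
End Pcone.

HB.mixin Record isStarAlgebra (R : realType) A of GRing.Lmodule R[i] A := {
  amul : A -> A -> A;
  star : A -> A;
  amulA : associative amul;
  amulDl : left_distributive amul +%R;
  amulDr : right_distributive amul +%R;
  amulZl : forall (c : R[i]) x y, amul (c *: x) y = c *: amul x y;
  amulZr : forall (c : R[i]) x y, amul x (c *: y) = c *: amul x y;
  starD : {morph star : x y / x + y};
  starZ : forall (c : R[i]) x, star (c *: x) = c^* *: star x;
  starM : forall x y, star (amul x y) = amul (star y) (star x);
  starK : involutive star
}.

#[short(type="starAlgType")]
HB.structure Definition StarAlgebra (R : realType) :=
  {A of isStarAlgebra R A & GRing.Lmodule R[i] A}.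

Notation "x ** y" := (amul x y) (at level 40, left associativity) : ring_scope.

HB.mixin Record hasStarUnit (R : realType) A of StarAlgebra R A := {
  aone : A;
  amul1l : left_id aone amul;
  amul1r : right_id aone amul
}.

#[short(type="unitalStarAlgType")]
HB.structure Definition UnitalStarAlgebra (R : realType) :=
  {A of hasStarUnit R A & StarAlgebra R A}.

HB.mixin Record isCStarAlgebra (R : realType) A
    of StarAlgebra R A & CompleteNormedModule R[i] A := {
  norm_amul : forall x y : A, `|x ** y| <= `|x| * `|y|;
  cstar_norm : forall x : A, `|star x ** x| = `|x| ^+ 2
}.

#[short(type="cstarType")]
HB.structure Definition CStarAlgebra (R : realType) :=
  {A of isCStarAlgebra R A & StarAlgebra R A & CompleteNormedModule R[i] A}.

HB.mixin Record isHilbert (R : realType) H of CompleteNormedModule R[i] H := {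
  inner : H -> H -> R[i];
  innerDl : forall x y z, inner (x + y) z = inner x z + inner y z;
  innerZl : forall (c : R[i]) x z, inner (c *: x) z = c * inner x z;
  innerC : forall x y, inner y x = (inner x y)^*;
  inner_norm : forall x : H, inner x x = `|x| ^+ 2
}.

#[short(type="hilbertType")]
HB.structure Definition Hilbert (R : realType) :=
  {H of isHilbert R H & CompleteNormedModule R[i] H}.

Definition bounded_op (R : realType) (V W : normedModType R[i]) (f : V -> W) :=
  exists2 M : R[i], 0 <= M & forall x, `|f x| <= M * `|x|.

Section StarTheory.
Variables (R : realType) (A : starAlgType R).
Implicit Types x y : A.

Lemma star0 : star (0 : A) = 0.
Proof. by rewrite -[X in star X](scale0r (0 : A)) starZ rmorph0 scale0r. Qed.
Lemma starN x : star (- x) = - star x.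
Proof. by rewrite -scaleN1r starZ rmorphN rmorph1 scaleN1r. Qed.
Lemma amul0l x : 0 ** x = 0.
Proof. by rewrite -[X in X ** _](scale0r (0 : A)) amulZl scale0r. Qed.
Lemma amul0r x : x ** 0 = 0.
Proof. by rewrite -[X in _ ** X](scale0r (0 : A)) amulZr scale0r. Qed.
Lemma amulNl x y : (- x) ** y = - (x ** y).
Proof. by rewrite -scaleN1r amulZl scaleN1r. Qed.
Lemma amulNr x y : x ** (- y) = - (x ** y).
Proof. by rewrite -scaleN1r amulZr scaleN1r. Qed.
Lemma star_inj : injective (star : A -> A).
Proof. exact: inv_inj starK. Qed.
End StarTheory.

Section CStarTheory.
Variables (R : realType) (A : cstarType R).
Implicit Types x y : A.

Lemma norm_star_le x : `|x| <= `|star x|.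
Proof.
have [->|x0] := eqVneq x 0; first by rewrite normr0.
have nx : 0 < `|x| by rewrite normr_gt0.
by rewrite -(ler_pM2r nx) -expr2 -cstar_norm norm_amul.
Qed.

Lemma norm_star x : `|star x| = `|x|.
Proof.
by apply/eqP; rewrite eq_le norm_star_le -{2}[x]starK norm_star_le.
Qed.

Lemma closureP (S : set A) x :
  closure S x <-> forall e : R[i], 0 < e -> exists2 y, S y & `|x - y| < e.
Proof.
split=> [clS e e0|clS B /nbhs_ballP[e /= e0 xeB]].
  have [y [Sy]] := clS _ (nbhsx_ballx x e e0).
  by rewrite -ball_normE /= => ?; exists y.
have [y Sy ye] := clS e e0; exists y; split=> //.
by apply: xeB; rewrite -ball_normE.
Qed.
End CStarTheory.

Section LinearSpan.
Variables (R : realType) (V : normedModType R[i]).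

Definition lin_span (S : set V) : set V :=
  [set v | exists n (c : 'I_n -> R[i]) (x : 'I_n -> V),
     (forall i, S (x i)) /\ v = \sum_(i < n) c i *: x i].

Definition closed_span (S : set V) : set V := closure (lin_span S).
End LinearSpan.

(* A double centralizer of B, i.e. an element of M(B).  Only the *-algebra
   structure of M(B) is needed, so its norm is not introduced. *)
Record multiplier (R : realType) (B : cstarType R) := Multiplier {
  mleft : B -> B;
  mright : B -> B;
  mleft_linear : linear mleft;
  mright_linear : linear mright;
  mleft_bounded : bounded_op mleft;
  mright_bounded : bounded_op mright;
  mleftM : forall a b, mleft (a ** b) = mleft a ** b;
  mrightM : forall a b, mright (a ** b) = a ** mright b;
  mleft_right : forall a b, a ** mleft b = mright a ** b
}.


Section BoundedOp.
Variables (R : realType) (V W : normedModType R[i]).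
Implicit Types f g : V -> W.

Lemma bounded_op0 : bounded_op ((fun=> 0) : V -> W).
Proof. by exists 0 => // x; rewrite normr0 mul0r. Qed.

Lemma bounded_op_id : bounded_op (fun x : V => x).
Proof. by exists 1 => // x; rewrite mul1r. Qed.

Lemma bounded_opN f : bounded_op f -> bounded_op (fun x => - f x).
Proof. by case=> M M0 fM; exists M => // x; rewrite normrN. Qed.

Lemma bounded_opD f g :
  bounded_op f -> bounded_op g -> bounded_op (fun x => f x + g x).
Proof.
case=> M M0 fM [N N0 gN]; exists (M + N); first exact: addr_ge0.
by move=> x; rewrite mulrDl (le_trans (ler_normD _ _)) // lerD.
Qed.

Lemma bounded_opZ (c : R[i]) f :
  bounded_op f -> bounded_op (fun x => c *: f x).
Proof.
case=> M M0 fM; exists (`|c| * M); first exact: mulr_ge0.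
by move=> x; rewrite normrZ -mulrA ler_wpM2l.
Qed.
End BoundedOp.

Lemma bounded_op_comp (R : realType) (U V W : normedModType R[i])
    (f : V -> W) (g : U -> V) :
  bounded_op f -> bounded_op g -> bounded_op (f \o g).
Proof.
case=> M M0 fM [N N0 gN]; exists (M * N); first exact: mulr_ge0.
by move=> x; rewrite (le_trans (fM _)) // -mulrA ler_wpM2l.
Qed.

Section LinearMaps.
Variables (R : realType) (V W : lmodType R[i]).
Implicit Types f g : V -> W.

Lemma linear_fun0 : linear ((fun=> 0) : V -> W).
Proof. by move=> c x y; rewrite scaler0 addr0. Qed.

Lemma linear_funN f : linear f -> linear (fun x => - f x).
Proof. by move=> lf c x y; rewrite lf opprD scalerN. Qed.

Lemma linear_funD f g : linear f -> linear g -> linear (fun x => f x + g x).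
Proof. by move=> lf lg c x y; rewrite lf lg scalerDr addrACA. Qed.

Lemma linear_funZ (d : R[i]) f : linear f -> linear (fun x => d *: f x).
Proof.
by move=> lf c x y; rewrite lf scalerDr !scalerA (mulrC d).
Qed.
End LinearMaps.

Lemma linear_fun_comp (R : realType) (U V W : lmodType R[i])
    (f : V -> W) (g : U -> V) : linear f -> linear g -> linear (f \o g).
Proof. by move=> lf lg c x y /=; rewrite lg lf. Qed.

Lemma linear_funE (R : realType) (V W : lmodType R[i]) (f : V -> W) :
  linear f -> (forall x y, f (x + y) = f x + f y) *
              (forall c x, f (c *: x) = c *: f x).
Proof.
move=> lf; have f0 : f 0 = 0.
  by have := lf (-1) 0 0; rewrite scaler0 addr0 scaleN1r addNr.
split=> [x y|c x]; first by rewrite -[x in LHS]scale1r lf scale1r.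
by rewrite -[c *: x]addr0 lf f0 addr0.
Qed.

Section MultiplierAlgebra.
Variables (R : realType) (B : cstarType R).
Implicit Types m n : multiplier B.
#[local] Obligation Tactic := idtac.

Lemma multiplierP m n :
  (forall b, mleft m b = mleft n b) -> (forall b, mright m b = mright n b) ->
  m = n.
Proof.
case: m => l1 r1 ? ? ? ? ? ? ?; case: n => l2 r2 ? ? ? ? ? ? ? /= /funext el /funext er.
by subst; congr Multiplier; exact: Prop_irrelevance.
Qed.

HB.instance Definition _ := gen_eqMixin (multiplier B).
HB.instance Definition _ := gen_choiceMixin (multiplier B).

Program Definition multiplier0 : multiplier B :=
  @Multiplier R B (fun=> 0) (fun=> 0) _ _ _ _ _ _ _.
Next Obligation. exact: linear_fun0. Qed.
Next Obligation. exact: linear_fun0. Qed.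
Next Obligation. exact: bounded_op0. Qed.
Next Obligation. exact: bounded_op0. Qed.
Next Obligation. by move=> a b /=; rewrite amul0l. Qed.
Next Obligation. by move=> a b /=; rewrite amul0r. Qed.
Next Obligation. by move=> a b /=; rewrite amul0l amul0r. Qed.

Program Definition multiplier1 : multiplier B :=
  @Multiplier R B id id _ _ _ _ _ _ _.
Next Obligation. by []. Qed.
Next Obligation. by []. Qed.
Next Obligation. exact: bounded_op_id. Qed.
Next Obligation. exact: bounded_op_id. Qed.
Next Obligation. by []. Qed.
Next Obligation. by []. Qed.
Next Obligation. by []. Qed.

Program Definition multiplierN m : multiplier B :=
  @Multiplier R B (fun b => - mleft m b) (fun b => - mright m b) _ _ _ _ _ _ _.
Next Obligation. by move=> m; exact/linear_funN/mleft_linear. Qed.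
Next Obligation. by move=> m; exact/linear_funN/mright_linear. Qed.
Next Obligation. by move=> m; exact/bounded_opN/mleft_bounded. Qed.
Next Obligation. by move=> m; exact/bounded_opN/mright_bounded. Qed.
Next Obligation. by move=> m a b /=; rewrite mleftM amulNl. Qed.
Next Obligation. by move=> m a b /=; rewrite mrightM amulNr. Qed.
Next Obligation. by move=> m a b /=; rewrite amulNr mleft_right amulNl. Qed.

Program Definition multiplierD m n : multiplier B :=
  @Multiplier R B (fun b => mleft m b + mleft n b)
    (fun b => mright m b + mright n b) _ _ _ _ _ _ _.
Next Obligation. by move=> m n; apply: linear_funD; exact: mleft_linear. Qed.
Next Obligation. by move=> m n; apply: linear_funD; exact: mright_linear. Qed.
Next Obligation. by move=> m n; apply: bounded_opD; exact: mleft_bounded. Qed.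
Next Obligation. by move=> m n; apply: bounded_opD; exact: mright_bounded. Qed.
Next Obligation. by move=> m n a b /=; rewrite !mleftM amulDl. Qed.
Next Obligation. by move=> m n a b /=; rewrite !mrightM amulDr. Qed.
Next Obligation. by move=> m n a b /=; rewrite amulDr !mleft_right amulDl. Qed.

Program Definition multiplierZ (c : R[i]) m : multiplier B :=
  @Multiplier R B (fun b => c *: mleft m b) (fun b => c *: mright m b)
    _ _ _ _ _ _ _.
Next Obligation. by move=> c m; exact/linear_funZ/mleft_linear. Qed.
Next Obligation. by move=> c m; exact/linear_funZ/mright_linear. Qed.
Next Obligation. by move=> c m; exact/bounded_opZ/mleft_bounded. Qed.
Next Obligation. by move=> c m; exact/bounded_opZ/mright_bounded. Qed.
Next Obligation. by move=> c m a b /=; rewrite mleftM amulZl. Qed.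
Next Obligation. by move=> c m a b /=; rewrite mrightM amulZr. Qed.
Next Obligation. by move=> c m a b /=; rewrite amulZr mleft_right amulZl. Qed.

Program Definition multiplierM m n : multiplier B :=
  @Multiplier R B (mleft m \o mleft n) (mright n \o mright m) _ _ _ _ _ _ _.
Next Obligation. by move=> m n; apply: linear_fun_comp; exact: mleft_linear. Qed.
Next Obligation. by move=> m n; apply: linear_fun_comp; exact: mright_linear. Qed.
Next Obligation. by move=> m n; apply: bounded_op_comp; exact: mleft_bounded. Qed.
Next Obligation. by move=> m n; apply: bounded_op_comp; exact: mright_bounded. Qed.
Next Obligation. by move=> m n a b /=; rewrite !mleftM. Qed.
Next Obligation. by move=> m n a b /=; rewrite !mrightM. Qed.
Next Obligation. by move=> m n a b /=; rewrite !mleft_right. Qed.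

Lemma star_conj_linear (f : B -> B) :
  linear f -> linear (fun b => star (f (star b))).
Proof.
by move=> lf c x y; rewrite starD starZ lf starD starZ conjCK.
Qed.

Lemma star_conj_bounded (f : B -> B) :
  bounded_op f -> bounded_op (fun b => star (f (star b))).
Proof.
case=> M M0 fM; exists M => // x.
by rewrite norm_star -(norm_star x).
Qed.

Program Definition multiplier_star m : multiplier B :=
  @Multiplier R B (fun b => star (mright m (star b)))
    (fun b => star (mleft m (star b))) _ _ _ _ _ _ _.
Next Obligation. by move=> m; exact/star_conj_linear/mright_linear. Qed.
Next Obligation. by move=> m; exact/star_conj_linear/mleft_linear. Qed.
Next Obligation. by move=> m; exact/star_conj_bounded/mright_bounded. Qed.
Next Obligation. by move=> m; exact/star_conj_bounded/mleft_bounded. Qed.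
Next Obligation. by move=> m a b /=; rewrite starM mrightM starM starK. Qed.
Next Obligation. by move=> m a b /=; rewrite starM mleftM starM starK. Qed.
Next Obligation.
by move=> m a b /=; apply: star_inj; rewrite !starM !starK mleft_right.
Qed.

Fact multiplierDA : associative multiplierD.
Proof. by move=> x y z; apply: multiplierP => b /=; rewrite addrA. Qed.
Fact multiplierDC : commutative multiplierD.
Proof. by move=> x y; apply: multiplierP => b /=; rewrite addrC. Qed.
Fact multiplier0D : left_id multiplier0 multiplierD.
Proof. by move=> x; apply: multiplierP => b /=; rewrite add0r. Qed.
Fact multiplierND : left_inverse multiplier0 multiplierN multiplierD.
Proof. by move=> x; apply: multiplierP => b /=; rewrite addNr. Qed.
HB.instance Definition _ := GRing.isZmodule.Build (multiplier B)
  multiplierDA multiplierDC multiplier0D multiplierND.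

Fact multiplierZA a b m :
  multiplierZ a (multiplierZ b m) = multiplierZ (a * b) m.
Proof. by apply: multiplierP => x /=; rewrite scalerA. Qed.
Fact multiplierZ1 : left_id 1 multiplierZ.
Proof. by move=> m; apply: multiplierP => b /=; rewrite scale1r. Qed.
Fact multiplierZDr : right_distributive multiplierZ +%R.
Proof. by move=> c m n; apply: multiplierP => b /=; rewrite scalerDr. Qed.
Fact multiplierZDl m : {morph multiplierZ^~ m : a b / a + b}.
Proof. by move=> c d; apply: multiplierP => b /=; rewrite scalerDl. Qed.
HB.instance Definition _ := GRing.Zmodule_isLmodule.Build R[i] (multiplier B)
  multiplierZA multiplierZ1 multiplierZDr multiplierZDl.

Fact multiplierMA : associative multiplierM.
Proof. by move=> x y z; apply: multiplierP. Qed.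
Fact multiplierMDl : left_distributive multiplierM +%R.
Proof.
move=> x y z; apply: multiplierP => b //=.
by rewrite (linear_funE (mright_linear z)).1.
Qed.
Fact multiplierMDr : right_distributive multiplierM +%R.
Proof.
move=> x y z; apply: multiplierP => b //=.
by rewrite (linear_funE (mleft_linear x)).1.
Qed.
Fact multiplierMZl (c : R[i]) x y :
  multiplierM (c *: x) y = c *: multiplierM x y.
Proof.
apply: multiplierP => b //=.
by rewrite (linear_funE (mright_linear y)).2.
Qed.
Fact multiplierMZr (c : R[i]) x y :
  multiplierM x (c *: y) = c *: multiplierM x y.
Proof.
apply: multiplierP => b //=.
by rewrite (linear_funE (mleft_linear x)).2.
Qed.
Fact multiplier_starD : {morph multiplier_star : x y / x + y}.
Proof. by move=> x y; apply: multiplierP => b /=; rewrite starD. Qed.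
Fact multiplier_starZ (c : R[i]) x :
  multiplier_star (c *: x) = c^* *: multiplier_star x.
Proof. by apply: multiplierP => b /=; rewrite starZ. Qed.
Fact multiplier_starM x y : multiplier_star (multiplierM x y) =
  multiplierM (multiplier_star y) (multiplier_star x).
Proof. by apply: multiplierP => b /=; rewrite starK. Qed.
Fact multiplier_starK : involutive multiplier_star.
Proof. by move=> x; apply: multiplierP => b /=; rewrite !starK. Qed.
HB.instance Definition _ := isStarAlgebra.Build R (multiplier B)
  multiplierMA multiplierMDl multiplierMDr multiplierMZl multiplierMZr
  multiplier_starD multiplier_starZ multiplier_starM multiplier_starK.

Fact multiplier1M : left_id multiplier1 multiplierM.
Proof. by move=> x; apply: multiplierP. Qed.
Fact multiplierM1 : right_id multiplier1 multiplierM.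
Proof. by move=> x; apply: multiplierP. Qed.
HB.instance Definition _ := hasStarUnit.Build R (multiplier B)
  multiplier1M multiplierM1.
End MultiplierAlgebra.

(* The canonical inclusion of B in M(B). *)
Section MultiplierEmbedding.
Variables (R : realType) (B : cstarType R).
#[local] Obligation Tactic := idtac.

Program Definition mult_of (a : B) : multiplier B :=
  @Multiplier R B (amul a) (amul^~ a) _ _ _ _ _ _ _.
Next Obligation. by move=> a c x y; rewrite amulDr amulZr. Qed.
Next Obligation. by move=> a c x y; rewrite amulDl amulZl. Qed.
Next Obligation. by move=> a; exists `|a| => // x; exact: norm_amul. Qed.
Next Obligation.
by move=> a; exists `|a| => // x; rewrite mulrC; exact: norm_amul.
Qed.
Next Obligation. by move=> a x y /=; rewrite amulA. Qed.
Next Obligation. by move=> a x y /=; rewrite amulA. Qed.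
Next Obligation. by move=> a x y /=; rewrite amulA. Qed.
End MultiplierEmbedding.

(* A bounded operator on H, carried together with its adjoint (which exists
   and is unique by the Riesz representation theorem). *)
Record bounded_operator (R : realType) (H : hilbertType R) := BoundedOperator {
  op :> H -> H;
  op_adj : H -> H;
  op_linear : linear op;
  op_adj_linear : linear op_adj;
  op_bounded : bounded_op op;
  op_adj_bounded : bounded_op op_adj;
  op_adjE : forall x y, inner (op x) y = inner x (op_adj y)
}.

Section BoundedOperators.
Variables (R : realType) (H : hilbertType R).
Implicit Types S T : bounded_operator H.
#[local] Obligation Tactic := idtac.

Lemma innerDr (x y z : H) : inner z (x + y) = inner z x + inner z y.
Proof. by rewrite innerC innerDl rmorphD /= -!innerC. Qed.
Lemma innerZr (c : R[i]) (x z : H) : inner z (c *: x) = c^* * inner z x.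
Proof. by rewrite innerC innerZl rmorphM /= -innerC. Qed.
Lemma innerNl (x z : H) : inner (- x) z = - inner x z.
Proof. by rewrite -scaleN1r innerZl mulN1r. Qed.
Lemma innerNr (x z : H) : inner z (- x) = - inner z x.
Proof. by rewrite innerC innerNl rmorphN /= -innerC. Qed.

Lemma inner0l (z : H) : inner 0 z = 0.
Proof. by rewrite -(scale0r (0 : H)) innerZl mul0r. Qed.
Lemma inner0r (z : H) : inner z 0 = 0.
Proof. by rewrite -(scale0r (0 : H)) innerZr rmorph0 mul0r. Qed.

Lemma inner_inj (x y : H) : (forall z, inner z x = inner z y) -> x = y.
Proof.
move=> xy; apply/eqP; rewrite -subr_eq0 -normr_eq0 -sqrf_eq0.
by rewrite -inner_norm innerDr innerNr xy subrr.
Qed.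

Lemma bounded_operatorP S T : S =1 T -> S = T.
Proof.
case: S => s s' ? ? ? ? sE; case: T => t t' ? ? ? ? tE /= /funext st.
have st' : s' = t'.
  by apply/funext => y; apply: inner_inj => x; rewrite -sE -tE st.
by subst; congr BoundedOperator; exact: Prop_irrelevance.
Qed.

HB.instance Definition _ := gen_eqMixin (bounded_operator H).
HB.instance Definition _ := gen_choiceMixin (bounded_operator H).

Program Definition bop0 : bounded_operator H :=
  @BoundedOperator R H (fun=> 0) (fun=> 0) _ _ _ _ _.
Next Obligation. exact: linear_fun0. Qed.
Next Obligation. exact: linear_fun0. Qed.
Next Obligation. exact: bounded_op0. Qed.
Next Obligation. exact: bounded_op0. Qed.
Next Obligation. by move=> x y /=; rewrite inner0l inner0r. Qed.

Program Definition bop1 : bounded_operator H :=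
  @BoundedOperator R H id id _ _ _ _ _.
Next Obligation. by []. Qed.
Next Obligation. by []. Qed.
Next Obligation. exact: bounded_op_id. Qed.
Next Obligation. exact: bounded_op_id. Qed.
Next Obligation. by []. Qed.

Program Definition bopN S : bounded_operator H :=
  @BoundedOperator R H (fun x => - S x) (fun x => - op_adj S x) _ _ _ _ _.
Next Obligation. by move=> S; exact/linear_funN/op_linear. Qed.
Next Obligation. by move=> S; exact/linear_funN/op_adj_linear. Qed.
Next Obligation. by move=> S; exact/bounded_opN/op_bounded. Qed.
Next Obligation. by move=> S; exact/bounded_opN/op_adj_bounded. Qed.
Next Obligation. by move=> S x y /=; rewrite innerNl innerNr op_adjE. Qed.

Program Definition bopD S T : bounded_operator H :=
  @BoundedOperator R H (fun x => S x + T x)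
    (fun x => op_adj S x + op_adj T x) _ _ _ _ _.
Next Obligation. by move=> S T; apply: linear_funD; exact: op_linear. Qed.
Next Obligation. by move=> S T; apply: linear_funD; exact: op_adj_linear. Qed.
Next Obligation. by move=> S T; apply: bounded_opD; exact: op_bounded. Qed.
Next Obligation. by move=> S T; apply: bounded_opD; exact: op_adj_bounded. Qed.
Next Obligation. by move=> S T x y /=; rewrite innerDl innerDr !op_adjE. Qed.

Program Definition bopZ (c : R[i]) S : bounded_operator H :=
  @BoundedOperator R H (fun x => c *: S x) (fun x => c^* *: op_adj S x)
    _ _ _ _ _.
Next Obligation. by move=> c S; exact/linear_funZ/op_linear. Qed.
Next Obligation. by move=> c S; exact/linear_funZ/op_adj_linear. Qed.
Next Obligation. by move=> c S; exact/bounded_opZ/op_bounded. Qed.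
Next Obligation. by move=> c S; exact/bounded_opZ/op_adj_bounded. Qed.
Next Obligation.
by move=> c S x y /=; rewrite innerZl innerZr conjCK op_adjE.
Qed.

Program Definition bopM S T : bounded_operator H :=
  @BoundedOperator R H (S \o T) (op_adj T \o op_adj S) _ _ _ _ _.
Next Obligation. by move=> S T; apply: linear_fun_comp; exact: op_linear. Qed.
Next Obligation.
by move=> S T; apply: linear_fun_comp; exact: op_adj_linear.
Qed.
Next Obligation. by move=> S T; apply: bounded_op_comp; exact: op_bounded. Qed.
Next Obligation.
by move=> S T; apply: bounded_op_comp; exact: op_adj_bounded.
Qed.
Next Obligation. by move=> S T x y /=; rewrite !op_adjE. Qed.

Program Definition bop_star S : bounded_operator H :=
  @BoundedOperator R H (op_adj S) S _ _ _ _ _.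
Next Obligation. by move=> S; exact: op_adj_linear. Qed.
Next Obligation. by move=> S; exact: op_linear. Qed.
Next Obligation. by move=> S; exact: op_adj_bounded. Qed.
Next Obligation. by move=> S; exact: op_bounded. Qed.
Next Obligation.
by move=> S x y /=; rewrite innerC -op_adjE -innerC.
Qed.

Fact bopDA : associative bopD.
Proof. by move=> x y z; apply: bounded_operatorP => h /=; rewrite addrA. Qed.
Fact bopDC : commutative bopD.
Proof. by move=> x y; apply: bounded_operatorP => h /=; rewrite addrC. Qed.
Fact bop0D : left_id bop0 bopD.
Proof. by move=> x; apply: bounded_operatorP => h /=; rewrite add0r. Qed.
Fact bopND : left_inverse bop0 bopN bopD.
Proof. by move=> x; apply: bounded_operatorP => h /=; rewrite addNr. Qed.
HB.instance Definition _ :=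
  GRing.isZmodule.Build (bounded_operator H) bopDA bopDC bop0D bopND.

Fact bopZA a b S : bopZ a (bopZ b S) = bopZ (a * b) S.
Proof. by apply: bounded_operatorP => h /=; rewrite scalerA. Qed.
Fact bopZ1 : left_id 1 bopZ.
Proof. by move=> S; apply: bounded_operatorP => h /=; rewrite scale1r. Qed.
Fact bopZDr : right_distributive bopZ +%R.
Proof. by move=> c S T; apply: bounded_operatorP => h /=; rewrite scalerDr. Qed.
Fact bopZDl S : {morph bopZ^~ S : a b / a + b}.
Proof. by move=> c d; apply: bounded_operatorP => h /=; rewrite scalerDl. Qed.
HB.instance Definition _ := GRing.Zmodule_isLmodule.Build R[i]
  (bounded_operator H) bopZA bopZ1 bopZDr bopZDl.

Fact bopMA : associative bopM.
Proof. by move=> x y z; apply: bounded_operatorP. Qed.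
Fact bopMDl : left_distributive bopM +%R.
Proof. by move=> x y z; apply: bounded_operatorP. Qed.
Fact bopMDr : right_distributive bopM +%R.
Proof.
move=> x y z; apply: bounded_operatorP => h /=.
by rewrite (linear_funE (op_linear x)).1.
Qed.
Fact bopMZl (c : R[i]) S T : bopM (c *: S) T = c *: bopM S T.
Proof. exact: bounded_operatorP. Qed.
Fact bopMZr (c : R[i]) S T : bopM S (c *: T) = c *: bopM S T.
Proof.
apply: bounded_operatorP => h /=.
by rewrite (linear_funE (op_linear S)).2.
Qed.
Fact bop_starD : {morph bop_star : S T / S + T}.
Proof. by move=> S T; apply: bounded_operatorP. Qed.
Fact bop_starZ (c : R[i]) S : bop_star (c *: S) = c^* *: bop_star S.
Proof. exact: bounded_operatorP. Qed.
Fact bop_starM S T : bop_star (bopM S T) = bopM (bop_star T) (bop_star S).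
Proof. exact: bounded_operatorP. Qed.
Fact bop_starK : involutive bop_star.
Proof. by move=> S; exact: bounded_operatorP. Qed.
HB.instance Definition _ := isStarAlgebra.Build R (bounded_operator H)
  bopMA bopMDl bopMDr bopMZl bopMZr bop_starD bop_starZ bop_starM bop_starK.

Fact bop1M : left_id bop1 bopM.
Proof. by move=> S; exact: bounded_operatorP. Qed.
Fact bopM1 : right_id bop1 bopM.
Proof. by move=> S; exact: bounded_operatorP. Qed.
HB.instance Definition _ := hasStarUnit.Build R (bounded_operator H)
  bop1M bopM1.
End BoundedOperators.

Record starHom (R : realType) (A B : starAlgType R) := StarHom {
  hom_fun :> A -> B;
  hom_linear : linear hom_fun;
  homM : forall x y, hom_fun (x ** y) = hom_fun x ** hom_fun y;
  hom_star : forall x, hom_fun (star x) = star (hom_fun x)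
}.

Record starAut (R : realType) (A : starAlgType R) := StarAut {
  aut_fun :> starHom A A;
  aut_inv_fun : starHom A A;
  autK : cancel aut_fun aut_inv_fun;
  aut_invK : cancel aut_inv_fun aut_fun
}.

Definition aut_inv (R : realType) (A : starAlgType R) (f : starAut A) :
  starAut A := StarAut (aut_invK f) (autK f).

Section Homs.
Variables (R : realType).
#[local] Obligation Tactic := idtac.

Program Definition hom_comp (A B C : starAlgType R) (g : starHom B C)
  (f : starHom A B) : starHom A C := @StarHom R A C (g \o f) _ _ _.
Next Obligation.
by move=> A B C g f; apply: linear_fun_comp; exact: hom_linear.
Qed.
Next Obligation. by move=> A B C g f x y /=; rewrite !homM. Qed.
Next Obligation. by move=> A B C g f x /=; rewrite !hom_star. Qed.

Program Definition mult_emb (B : cstarType R) : starHom B (multiplier B) :=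
  @StarHom R B (multiplier B) (@mult_of R B) _ _ _.
Next Obligation.
by move=> B c x y; apply: multiplierP => b /=;
  rewrite ?amulDl ?amulZl ?amulDr ?amulZr.
Qed.
Next Obligation.
by move=> B x y; apply: multiplierP => b /=; rewrite amulA.
Qed.
Next Obligation.
by move=> B x; apply: multiplierP => b /=; rewrite starM starK.
Qed.
End Homs.

Section ComplexFacts.
Variable R : realType.
Implicit Types z e : R[i].

Lemma complex_ge0_ReE z : 0 <= z -> z = (complex.Re z)%:C%C.
Proof. by case: z => a b; rewrite lecE /= => /andP[/eqP -> _]. Qed.

Lemma complex_normE z : `|z| = (complex.Re `|z|)%:C%C.
Proof. exact: complex_ge0_ReE. Qed.

Lemma complex_le_Re z e : z <= e -> complex.Re z <= complex.Re e.
Proof. by rewrite lecE => /andP[]. Qed.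

Lemma complex_lt_Re z e : z < e -> complex.Re z < complex.Re e.
Proof. by rewrite ltcE => /andP[]. Qed.

Lemma complex_norm_le_parts (a b : R) :
  `|a +i* b|%C <= (`|a| + `|b|)%:C%C.
Proof.
have -> : (a +i* b)%C = a%:C%C + 'i%C * b%:C%C.
  by simpc.
apply: le_trans (ler_normD _ _) _; rewrite normrM rmorphD /=.
have nC (x : R) : `|x%:C%C| = `|x|%:C%C.
  by rewrite normc_def /= expr0n addr0 sqrtr_sqr.
rewrite !nC (_ : `|'i%C| = 1) ?mul1r //.
by rewrite normc_def /= expr0n expr1n add0r sqrtr1.
Qed.

Lemma complex_abs_Re_lt z e : `|z| < e -> `|complex.Re z| < complex.Re e.
Proof.
move=> ze; have := le_lt_trans (normc_ge_Re z) ze.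
by move=> /complex_lt_Re.
Qed.

Lemma complex_abs_Im_lt z e : `|z| < e -> `|complex.Im z| < complex.Re e.
Proof.
move=> ze; have := @complex_abs_Re_lt ('i%C * z) e.
rewrite normrM (_ : `|'i%C| = 1) ?mul1r; last first.
  by rewrite normc_def /= expr0n expr1n add0r sqrtr1.
move=> /(_ ze); case: z ze => a b _ /=.
by rewrite mul0r mul1r sub0r normrN.
Qed.

Lemma real_filter_complete (T : Type) (F : set_system T) (g : T -> R) :
  ProperFilter F ->
  (forall e : R, 0 < e -> exists z : R, F [set t | `|z - g t| < e]) ->
  exists l : R, forall e : R, 0 < e -> F [set t | `|l - g t| < e].
Proof.
move=> FF Fg; have /R_complete : cauchy (g @ F).
  apply/cauchyP => e e0; have [z Fz] := Fg e e0; exists z.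
  by rewrite /fmap /= -ball_normE.
move=> /cvg_ex[l /cvgrPdist_lt Fl]; exists l => e e0.
by have := Fl e e0; rewrite near_map; apply: filterS.
Qed.

Lemma complex_filter_complete (T : Type) (F : set_system T) (g : T -> R[i]) :
  ProperFilter F ->
  (forall e, 0 < e -> exists z, F [set t | `|z - g t| < e]) ->
  exists l, forall e, 0 < e -> F [set t | `|l - g t| < e].
Proof.
move=> FF Fg.
have [a Fa] : exists a, forall e : R, 0 < e ->
    F [set t | `|a - complex.Re (g t)| < e].
  apply: real_filter_complete => e e0.
  have [|z Fz] := Fg e%:C%C; first by rewrite ltcR.
  exists (complex.Re z); apply: filterS Fz => t /= /complex_abs_Re_lt /=.
  by case: z (g t) => a b [c d].
have [b Fb] : exists b, forall e : R, 0 < e ->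
    F [set t | `|b - complex.Im (g t)| < e].
  apply: real_filter_complete => e e0.
  have [|z Fz] := Fg e%:C%C; first by rewrite ltcR.
  exists (complex.Im z); apply: filterS Fz => t /= /complex_abs_Im_lt /=.
  by case: z (g t) => a' b [c d].
exists (a +i* b)%C => e e0.
have eE : e = (complex.Re e)%:C%C by apply/complex_ge0_ReE/ltW.
have e20 : 0 < complex.Re e / 2 by rewrite divr_gt0 // -ltcR -eE.
apply: filterS (filterI (Fa _ e20) (Fb _ e20)) => t /= [ta tb].
case: (g t) ta tb => c d /= ta tb.
apply: le_lt_trans (complex_norm_le_parts (a - c) (b - d)) _.
by rewrite eE ltcR [X in _ < X]splitr ltrD.
Qed.
End ComplexFacts.

Record linf (R : realType) (X : Type) := Linf {
  linf_fun :> X -> R[i];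
  linf_bounded : exists M : R[i], forall x, `|linf_fun x| <= M
}.

Section Linf.
Variables (R : realType) (X : Type).
Implicit Types f g h : linf R X.
#[local] Obligation Tactic := idtac.

Lemma linfP f g : f =1 g -> f = g.
Proof.
case: f => f fP; case: g => g gP /= /funext fg; subst.
by congr Linf; exact: Prop_irrelevance.
Qed.

HB.instance Definition _ := gen_eqMixin (linf R X).
HB.instance Definition _ := gen_choiceMixin (linf R X).

Program Definition linf0 : linf R X := @Linf R X (fun=> 0) _.
Next Obligation. by exists 0 => x; rewrite normr0. Qed.

Program Definition linfN f : linf R X := @Linf R X (fun x => - f x) _.
Next Obligation.
by move=> f; have [M fM] := linf_bounded f; exists M => x; rewrite normrN.
Qed.

Program Definition linfD f g : linf R X := @Linf R X (fun x => f x + g x) _.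
Next Obligation.
move=> f g; have [M fM] := linf_bounded f; have [N gN] := linf_bounded g.
by exists (M + N) => x; rewrite (le_trans (ler_normD _ _)) // lerD.
Qed.

Program Definition linfZ (c : R[i]) f : linf R X :=
  @Linf R X (fun x => c * f x) _.
Next Obligation.
move=> c f; have [M fM] := linf_bounded f.
by exists (`|c| * M) => x; rewrite normrM ler_wpM2l.
Qed.

Program Definition linfM f g : linf R X := @Linf R X (fun x => f x * g x) _.
Next Obligation.
move=> f g; have [M fM] := linf_bounded f; have [N gN] := linf_bounded g.
by exists (M * N) => x; rewrite normrM ler_pM.
Qed.

Program Definition linf_star f : linf R X := @Linf R X (fun x => (f x)^*) _.
Next Obligation.
by move=> f; have [M fM] := linf_bounded f; exists M => x; rewrite norm_conjC.
Qed.

Fact linfDA : associative linfD.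
Proof. by move=> f g h; apply: linfP => x /=; rewrite addrA. Qed.
Fact linfDC : commutative linfD.
Proof. by move=> f g; apply: linfP => x /=; rewrite addrC. Qed.
Fact linf0D : left_id linf0 linfD.
Proof. by move=> f; apply: linfP => x /=; rewrite add0r. Qed.
Fact linfND : left_inverse linf0 linfN linfD.
Proof. by move=> f; apply: linfP => x /=; rewrite addNr. Qed.
HB.instance Definition _ :=
  GRing.isZmodule.Build (linf R X) linfDA linfDC linf0D linfND.

Fact linfZA a b f : linfZ a (linfZ b f) = linfZ (a * b) f.
Proof. by apply: linfP => x /=; rewrite mulrA. Qed.
Fact linfZ1 : left_id 1 linfZ.
Proof. by move=> f; apply: linfP => x /=; rewrite mul1r. Qed.
Fact linfZDr : right_distributive linfZ +%R.
Proof. by move=> c f g; apply: linfP => x /=; rewrite mulrDr. Qed.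
Fact linfZDl f : {morph linfZ^~ f : a b / a + b}.
Proof. by move=> c d; apply: linfP => x /=; rewrite mulrDl. Qed.
HB.instance Definition _ := GRing.Zmodule_isLmodule.Build R[i] (linf R X)
  linfZA linfZ1 linfZDr linfZDl.

Fact linfMA : associative linfM.
Proof. by move=> f g h; apply: linfP => x /=; rewrite mulrA. Qed.
Fact linfMDl : left_distributive linfM +%R.
Proof. by move=> f g h; apply: linfP => x /=; rewrite mulrDl. Qed.
Fact linfMDr : right_distributive linfM +%R.
Proof. by move=> f g h; apply: linfP => x /=; rewrite mulrDr. Qed.
Fact linfMZl (c : R[i]) f g : linfM (c *: f) g = c *: linfM f g.
Proof. by apply: linfP => x /=; rewrite mulrA. Qed.
Fact linfMZr (c : R[i]) f g : linfM f (c *: g) = c *: linfM f g.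
Proof. by apply: linfP => x /=; rewrite mulrCA. Qed.
Fact linf_starD : {morph linf_star : f g / f + g}.
Proof. by move=> f g; apply: linfP => x /=; rewrite rmorphD. Qed.
Fact linf_starZ (c : R[i]) f : linf_star (c *: f) = c^* *: linf_star f.
Proof. by apply: linfP => x /=; rewrite rmorphM. Qed.
Fact linf_starM f g : linf_star (linfM f g) = linfM (linf_star g) (linf_star f).
Proof. by apply: linfP => x /=; rewrite rmorphM mulrC. Qed.
Fact linf_starK : involutive linf_star.
Proof. by move=> f; apply: linfP => x /=; rewrite conjCK. Qed.
HB.instance Definition _ := isStarAlgebra.Build R (linf R X)
  linfMA linfMDl linfMDr linfMZl linfMZr
  linf_starD linf_starZ linf_starM linf_starK.

Definition linf_norm f : R[i] :=
  (sup [set complex.Re `|f x| | x in [set: X]])%:C%C.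

Lemma linf_norm_ge f x : `|f x| <= linf_norm f.
Proof.
have [M fM] := linf_bounded f.
rewrite (complex_normE (f x)) /linf_norm lecR; apply: ub_le_sup; last by exists x.
by exists (complex.Re M) => _ [y _ <-]; exact: complex_le_Re.
Qed.

Lemma linf_norm_le f (M : R[i]) :
  0 <= M -> (forall x, `|f x| <= M) -> linf_norm f <= M.
Proof.
move=> M0 fM; rewrite (complex_ge0_ReE M0) /linf_norm lecR.
have [[x0]|noX] := pselect (inhabited X).
  apply: ge_sup; first by exists (complex.Re `|f x0|), x0.
  by move=> _ [x _ <-]; exact: complex_le_Re.
rewrite (_ : [set _ | _ in _] = set0) ?sup0; last first.
  by apply/seteqP; split=> // y [x]; case: noX; exact: inhabits.
by rewrite -lecR -complex_ge0_ReE.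
Qed.

Lemma linf_norm_ge0 f : 0 <= linf_norm f.
Proof.
have [[x0]|noX] := pselect (inhabited X).
  by apply: le_trans (linf_norm_ge f x0); exact: normr_ge0.
rewrite /linf_norm (_ : [set _ | _ in _] = set0) ?sup0 //.
by apply/seteqP; split=> // y [x]; case: noX; exact: inhabits.
Qed.

Fact linf_normD f g : linf_norm (f + g) <= linf_norm f + linf_norm g.
Proof.
apply: linf_norm_le => [|x]; first by rewrite addr_ge0 ?linf_norm_ge0.
by rewrite (le_trans (ler_normD _ _)) // lerD // linf_norm_ge.
Qed.

Lemma linf_normZ_le (c : R[i]) f : linf_norm (c *: f) <= `|c| * linf_norm f.
Proof.
apply: linf_norm_le => [|x]; first by rewrite mulr_ge0 ?linf_norm_ge0.
by rewrite normrM ler_wpM2l // linf_norm_ge.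
Qed.

Fact linf_normZ (c : R[i]) f : linf_norm (c *: f) = `|c| * linf_norm f.
Proof.
apply/eqP; rewrite eq_le linf_normZ_le /=.
have [->|c0] := eqVneq c 0; first by rewrite normr0 mul0r linf_norm_ge0.
have nc : 0 < `|c| by rewrite normr_gt0.
rewrite -ler_pdivlMl // -normfV.
by rewrite (le_trans _ (linf_normZ_le _ _)) // scalerA mulVf // scale1r.
Qed.

Fact linf_norm0_eq0 f : linf_norm f = 0 -> f = 0.
Proof.
move=> f0; apply: linfP => x; apply/eqP; rewrite -normr_le0 -f0.
exact: linf_norm_ge.
Qed.

HB.instance Definition _ := Lmodule_isNormed.Build R[i] (linf R X)
  linf_normD linf_normZ linf_norm0_eq0.

Lemma linf_complete (F : set_system (linf R X)) :
  ProperFilter F -> cauchy F -> cvg F.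
Proof.
move=> FF /cauchyP Fc.
have Fd (e : R[i]) : 0 < e -> exists f : linf R X, F [set g | `|f - g| < e].
  by move=> e0; have [f Ff] := Fc e e0; exists f; move: Ff; rewrite -ball_normE.
have /choice[l Fl] : forall x, exists l : R[i],
    forall e : R[i], 0 < e -> F [set g : linf R X | `|l - g x| < e].
  move=> x; apply: complex_filter_complete => e e0.
  have [f Ff] := Fd e e0; exists (f x); apply: filterS Ff => g /= fg.
  exact: le_lt_trans (linf_norm_ge (f - g) x) fg.
have fl (e : R[i]) f : 0 < e -> F [set g | `|f - g| < e] ->
    forall x, `|f x - l x| <= e.
  move=> e0 Ff x; apply/ler_addgt0Pr => d d0.
  have [g [/= fg lg]] := filter_ex (filterI Ff (Fl x d d0)).
  have -> : f x - l x = (f x - g x) - (l x - g x) by rewrite opprB addrA subrK.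
  apply: le_trans (ler_normB _ _) _; apply: lerD; last exact: ltW.
  exact: le_trans (linf_norm_ge (f - g) x) (ltW fg).
have lb : exists M : R[i], forall x, `|l x| <= M.
  have [f Ff] := Fd 1 ltr01; exists (`|f| + 1) => x.
  have -> : l x = f x - (f x - l x) by rewrite subKr.
  apply: le_trans (ler_normB _ _) _; apply: lerD; first exact: linf_norm_ge.
  exact: fl.
apply/cvg_ex; exists (Linf lb); apply/cvgrPdist_lt => e e0.
have e2 : 0 < e / 2 by rewrite divr_gt0.
have [f Ff] := Fd _ e2; apply: filterS (Ff) => g /= fg.
have -> : Linf lb - g = (f - g) - (f - Linf lb).
  by rewrite opprB [RHS]addrC addrA subrK.
apply: le_lt_trans (ler_normB _ _) _; rewrite [e]splitr; apply: ltr_leD => //.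
by apply: linf_norm_le => [|x]; [exact: ltW|exact: (fl _ f)].
Qed.

HB.instance Definition _ := Uniform_isComplete.Build (linf R X) linf_complete.

Fact linf_normM f g : `|f ** g| <= `|f| * `|g|.
Proof.
apply: linf_norm_le => [|x]; first by rewrite mulr_ge0.
by rewrite normrM ler_pM // linf_norm_ge.
Qed.

Fact linf_cstar f : `|star f ** f| = `|f| ^+ 2.
Proof.
apply/eqP; rewrite eq_le; apply/andP; split.
  apply: linf_norm_le => [|x]; first by rewrite exprn_ge0.
  by rewrite normrM norm_conjC -expr2 lerXn2r ?nnegrE // linf_norm_ge.
rewrite -[leRHS]sqrtCK lerXn2r ?nnegrE ?sqrtC_ge0 //.
apply: linf_norm_le => [|x]; first by rewrite sqrtC_ge0.
rewrite -(ler_pXn2r (n := 2)) ?nnegrE ?sqrtC_ge0 // sqrtCK.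
apply: le_trans (linf_norm_ge (star f ** f) x).
by rewrite /= normrM norm_conjC expr2.
Qed.

HB.instance Definition _ :=
  isCStarAlgebra.Build R (linf R X) linf_normM linf_cstar.
End Linf.

Section SpanTheory.
Variables (R : realType) (V : normedModType R[i]).
Implicit Types S P : set V.

Lemma lin_span_gen S x : S x -> lin_span S x.
Proof.
by move=> Sx; exists 1%N, (fun=> 1), (fun=> x); rewrite big_ord1 scale1r.
Qed.

Lemma lin_span0 S : lin_span S 0.
Proof. by exists 0%N, (fun=> 0), (fun=> 0); rewrite big_ord0; split=> // -[]. Qed.

Lemma lin_spanP S (c : R[i]) x y :
  lin_span S x -> lin_span S y -> lin_span S (c *: x + y).
Proof.
move=> [m [a [u [Su ->]]]] [n [b [v [Sv ->]]]].
exists (m + n)%N,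
  (fun i : 'I_(m + n) => match fintype.split i with inl j => c * a j | inr k => b k end),
  (fun i : 'I_(m + n) => match fintype.split i with inl j => u j | inr k => v k end); split.
  by move=> i; case: (fintype.split i).
rewrite big_split_ord /= scaler_sumr; congr (_ + _); apply: eq_bigr => i _.
  by rewrite (unsplitK (inl i)) scalerA.
by rewrite (unsplitK (inr i)).
Qed.

Lemma lin_span_min S P : P 0 ->
    (forall (c : R[i]) x y, P x -> P y -> P (c *: x + y)) -> S `<=` P ->
  lin_span S `<=` P.
Proof.
move=> P0 Plin SP _ [n [c [x [Sx ->]]]].
elim/big_rec: _ => // i y _ Py; apply: Plin => //; exact: SP.
Qed.
End SpanTheory.

Section SubAlgebras.
Variables (R : realType) (A : cstarType R).
Implicit Types S : set A.

Record is_cstar_sub S : Prop := {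
  sub_zero : S 0;
  sub_linear : forall (c : R[i]) x y, S x -> S y -> S (c *: x + y);
  sub_mul : forall x y, S x -> S y -> S (x ** y);
  sub_star : forall x, S x -> S (star x);
  sub_closed : closed S
}.

Lemma closed_span_cstar_sub S :
    (forall x y, S x -> S y -> S (x ** y)) -> (forall x, S x -> S (star x)) ->
  is_cstar_sub (closed_span S).
Proof.
move=> SM Sstar; rewrite /closed_span; set L := lin_span S.
have LM x y : L x -> L y -> L (x ** y).
  move=> Lx; move: y; apply: lin_span_min.
  - by rewrite amul0r; exact: lin_span0.
  - by move=> c y z Ly Lz; rewrite amulDr amulZr; exact: lin_spanP.
  move=> y Sy; move: x Lx; apply: lin_span_min.
  - by rewrite amul0l; exact: lin_span0.
  - by move=> c x z Lx Lz; rewrite amulDl amulZl; exact: lin_spanP.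
  by move=> x Sx; apply/lin_span_gen/SM.
have Lstar x : L x -> L (star x).
  move: x; apply: lin_span_min.
  - by rewrite star0; exact: lin_span0.
  - by move=> c x y Lx Ly; rewrite starD starZ; exact: lin_spanP.
  by move=> x Sx; apply/lin_span_gen/Sstar.
split.
- by apply: subset_closure; exact: lin_span0.
- move=> c x y /closureP Cx /closureP Cy; apply/closureP => e e0.
  have d0 : 0 < e / 2 / (`|c| + 1) by rewrite !divr_gt0 // ltr_wpDl.
  have e20 : 0 < e / 2 by rewrite divr_gt0.
  have [x' Lx' xx'] := Cx _ d0; have [y' Ly' yy'] := Cy _ e20.
  exists (c *: x' + y'); first exact: lin_spanP.
  have -> : c *: x + y - (c *: x' + y') = c *: (x - x') + (y - y').
    by rewrite scalerBr opprD addrACA.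
  apply: le_lt_trans (ler_normD _ _) _; rewrite [e]splitr; apply: ler_ltD => //.
  rewrite normrZ; apply: le_trans (_ : (`|c| + 1) * `|x - x'| <= _).
    by rewrite ler_wpM2r // lerDl.
  by rewrite mulrC -ler_pdivlMr ?ltW // ltr_wpDl.
- move=> x y /closureP Cx /closureP Cy; apply/closureP => e e0.
  have e20 : 0 < e / 2 by rewrite divr_gt0.
  have d0 : 0 < e / 2 / (`|x| + 1) by rewrite !divr_gt0 // ltr_wpDl.
  have [y' Ly' yy'] := Cy _ d0.
  have d'0 : 0 < e / 2 / (`|y'| + 1) by rewrite !divr_gt0 // ltr_wpDl.
  have [x' Lx' xx'] := Cx _ d'0.
  exists (x' ** y'); first exact: LM.
  have -> : x ** y - x' ** y' = x ** (y - y') + (x - x') ** y'.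
    by rewrite amulDr amulDl amulNr amulNl addrA subrK.
  apply: le_lt_trans (ler_normD _ _) _; rewrite [e]splitr; apply: ler_ltD.
    apply: le_trans (norm_amul _ _) _.
    apply: le_trans (_ : (`|x| + 1) * `|y - y'| <= _).
      by rewrite ler_wpM2r // lerDl.
    by rewrite mulrC -ler_pdivlMr ?ltW // ltr_wpDl.
  apply: le_lt_trans (norm_amul _ _) _.
  apply: le_lt_trans (_ : `|x - x'| * (`|y'| + 1) < _).
    by rewrite ler_wpM2l // lerDl.
  by rewrite -ltr_pdivlMr // ltr_wpDl.
- move=> x /closureP Cx; apply/closureP => e e0.
  have [x' Lx' xx'] := Cx e e0; exists (star x'); first exact: Lstar.
  by rewrite -starN -starD norm_star.
- exact: closed_closure.
Qed.
End SubAlgebras.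

Record cstarSub (R : realType) (A : cstarType R) := CStarSub {
  sub_set : set A;
  sub_setP : is_cstar_sub sub_set
}.

Record sub_alg (R : realType) (A : cstarType R) (S : cstarSub A) := SubAlg {
  sub_val :> A;
  sub_valP : sub_set S sub_val
}.

Section SubAlg.
Variables (R : realType) (A : cstarType R) (S : cstarSub A).
Local Notation T := (sub_alg S).
Implicit Types x y z : T.

Lemma sub_val_inj : injective (@sub_val R A S).
Proof.
case=> x xP [y yP] /= xy; subst; congr SubAlg; exact: Prop_irrelevance.
Qed.

Let SP := sub_setP S.

Lemma sub_addP (x y : A) : sub_set S x -> sub_set S y -> sub_set S (x + y).
Proof. by move=> Sx Sy; rewrite -[x]scale1r; exact: (sub_linear SP). Qed.
Lemma sub_scaleP (c : R[i]) (x : A) : sub_set S x -> sub_set S (c *: x).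
Proof.
by move=> Sx; rewrite -[_ *: _]addr0; apply: (sub_linear SP) => //;
  exact: (sub_zero SP).
Qed.
Lemma sub_oppP (x : A) : sub_set S x -> sub_set S (- x).
Proof. by move=> Sx; rewrite -scaleN1r; exact: sub_scaleP. Qed.

HB.instance Definition _ := gen_eqMixin T.
HB.instance Definition _ := gen_choiceMixin T.

Definition sub0 : T := SubAlg (sub_zero SP).
Definition subN x : T := SubAlg (sub_oppP (sub_valP x)).
Definition subD x y : T := SubAlg (sub_addP (sub_valP x) (sub_valP y)).
Definition subZ (c : R[i]) x : T := SubAlg (sub_scaleP c (sub_valP x)).
Definition subM x y : T := SubAlg (sub_mul SP (sub_valP x) (sub_valP y)).
Definition sub_adj x : T := SubAlg (sub_star SP (sub_valP x)).

Fact subDA : associative subD.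
Proof. by move=> x y z; apply: sub_val_inj; rewrite /= addrA. Qed.
Fact subDC : commutative subD.
Proof. by move=> x y; apply: sub_val_inj; rewrite /= addrC. Qed.
Fact sub0D : left_id sub0 subD.
Proof. by move=> x; apply: sub_val_inj; rewrite /= add0r. Qed.
Fact subND : left_inverse sub0 subN subD.
Proof. by move=> x; apply: sub_val_inj; rewrite /= addNr. Qed.
HB.instance Definition _ := GRing.isZmodule.Build T subDA subDC sub0D subND.

Fact subZA a b x : subZ a (subZ b x) = subZ (a * b) x.
Proof. by apply: sub_val_inj; rewrite /= scalerA. Qed.
Fact subZ1 : left_id 1 subZ.
Proof. by move=> x; apply: sub_val_inj; rewrite /= scale1r. Qed.
Fact subZDr : right_distributive subZ +%R.
Proof. by move=> c x y; apply: sub_val_inj; rewrite /= scalerDr. Qed.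
Fact subZDl x : {morph subZ^~ x : a b / a + b}.
Proof. by move=> c d; apply: sub_val_inj; rewrite /= scalerDl. Qed.
HB.instance Definition _ :=
  GRing.Zmodule_isLmodule.Build R[i] T subZA subZ1 subZDr subZDl.

Fact subMA : associative subM.
Proof. by move=> x y z; apply: sub_val_inj; rewrite /= amulA. Qed.
Fact subMDl : left_distributive subM +%R.
Proof. by move=> x y z; apply: sub_val_inj; rewrite /= amulDl. Qed.
Fact subMDr : right_distributive subM +%R.
Proof. by move=> x y z; apply: sub_val_inj; rewrite /= amulDr. Qed.
Fact subMZl (c : R[i]) x y : subM (c *: x) y = c *: subM x y.
Proof. by apply: sub_val_inj; rewrite /= amulZl. Qed.
Fact subMZr (c : R[i]) x y : subM x (c *: y) = c *: subM x y.
Proof. by apply: sub_val_inj; rewrite /= amulZr. Qed.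
Fact sub_adjD : {morph sub_adj : x y / x + y}.
Proof. by move=> x y; apply: sub_val_inj; rewrite /= starD. Qed.
Fact sub_adjZ (c : R[i]) x : sub_adj (c *: x) = c^* *: sub_adj x.
Proof. by apply: sub_val_inj; rewrite /= starZ. Qed.
Fact sub_adjM x y : sub_adj (subM x y) = subM (sub_adj y) (sub_adj x).
Proof. by apply: sub_val_inj; rewrite /= starM. Qed.
Fact sub_adjK : involutive sub_adj.
Proof. by move=> x; apply: sub_val_inj; rewrite /= starK. Qed.
HB.instance Definition _ := isStarAlgebra.Build R T
  subMA subMDl subMDr subMZl subMZr sub_adjD sub_adjZ sub_adjM sub_adjK.

Definition sub_norm x : R[i] := `|sub_val x|.
Fact sub_normD x y : sub_norm (x + y) <= sub_norm x + sub_norm y.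
Proof. exact: ler_normD. Qed.
Fact sub_normZ (c : R[i]) x : sub_norm (c *: x) = `|c| * sub_norm x.
Proof. exact: normrZ. Qed.
Fact sub_norm0_eq0 x : sub_norm x = 0 -> x = 0.
Proof. by move=> /normr0_eq0 x0; exact: sub_val_inj. Qed.
HB.instance Definition _ :=
  Lmodule_isNormed.Build R[i] T sub_normD sub_normZ sub_norm0_eq0.

Lemma sub_complete (F : set_system T) : ProperFilter F -> cauchy F -> cvg F.
Proof.
move=> FF /cauchyP Fc.
have /cauchy_cvg/cvg_ex[l /cvgrPdist_lt Fl] : cauchy (@sub_val R A S @ F).
  apply/cauchyP => e e0; have [x Fx] := Fc e e0; exists (sub_val x).
  by move: Fx; rewrite -!ball_normE => Fx; exact: Fx.
have Sl : sub_set S l.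
  have [/(_ (sub_closed SP)) -> _] := closure_id (sub_set S).
  apply/closureP => e e0.
  by have [x lx] := filter_ex (Fl e e0); exists (sub_val x) => //; exact: sub_valP.
apply/cvg_ex; exists (SubAlg Sl); apply/cvgrPdist_lt => e e0.
exact: Fl.
Qed.
HB.instance Definition _ := Uniform_isComplete.Build T sub_complete.

Fact sub_normM x y : `|x ** y| <= `|x| * `|y|.
Proof. exact: norm_amul. Qed.
Fact sub_cstar x : `|star x ** x| = `|x| ^+ 2.
Proof. exact: cstar_norm. Qed.
HB.instance Definition _ := isCStarAlgebra.Build R T sub_normM sub_cstar.
End SubAlg.

Section BGamma.
Variables (R : realType) (G : ordGroupType).
#[local] Obligation Tactic := idtac.

Lemma le_stepP (x : G) :
  exists M : R[i], forall y : G, `|(x <= y)%R%:R : R[i]| <= M.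
Proof. by exists 1 => y; case: (x <= y); rewrite ?normr1 ?normr0. Qed.

Definition step (x : G) : linf R G :=
  @Linf R G (fun y => (x <= y)%R%:R) (le_stepP x).

Lemma stepM x y : step x ** step y = step (if x <= y then y else x).
Proof.
apply: linfP => z /=; rewrite -natrM mulnb; congr (_%:R); congr nat_of_bool.
case: ifPn => [xy|yx]; first by apply/andP/idP => [[]|yz] //; rewrite (le_trans xy).
have {}yx : y <= x by have := le_totalG x y; rewrite (negbTE yx).
by apply/andP/idP => [[]|xz] //; rewrite (le_trans yx).
Qed.

Lemma step_star x : star (step x) = step x.
Proof. by apply: linfP => z /=; rewrite rmorph_nat. Qed.

Lemma B_Gamma_subP : is_cstar_sub (closed_span (range step)).
Proof.
apply: closed_span_cstar_sub => [_ _ [x _ <-] [y _ <-]|_ [x _ <-]].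
  by rewrite stepM; eexists.
by rewrite step_star; eexists.
Qed.

Definition B_Gamma := sub_alg (CStarSub B_Gamma_subP).
HB.instance Definition _ := CStarAlgebra.on B_Gamma.

Lemma one_at_subP x : closed_span (range step) (step x).
Proof. by apply: subset_closure; apply: lin_span_gen; exists x. Qed.

Definition one_at (x : G) : B_Gamma := @SubAlg R _ (CStarSub B_Gamma_subP) _ (@one_at_subP x).

Definition B_Gamma_infty : set B_Gamma :=
  closed_span [set f | exists s t : G, s < t /\ f = one_at s - one_at t].
End BGamma.
Arguments one_at {R G}.

Section Translation.
Variables (R : realType) (G : ordGroupType).
#[local] Obligation Tactic := idtac.

Program Definition linf_shift (s : G) (f : linf R G) : linf R G :=
  @Linf R G (fun y => f (y - s)) _.
Next Obligation. by move=> s f; have [M fM] := linf_bounded f; exists M. Qed.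

Lemma linf_shift_linear s : linear (linf_shift s).
Proof. by move=> c f g; apply: linfP. Qed.

Lemma linf_shift_norm s f : `|linf_shift s f| <= `|f|.
Proof. by apply: linf_norm_le => // y; exact: (linf_norm_ge f (y - s)). Qed.

Lemma linf_shift_step s x : linf_shift s (step R x) = step R (x + s).
Proof.
apply: linfP => y /=; congr (_%:R); congr nat_of_bool; apply/idP/idP => xy.
  by have := lerD_shift s _ _ xy; rewrite addrC (addrC s) subrK.
by have := lerD_shift (- s) _ _ xy; rewrite addrC addrK addrC.
Qed.

Lemma tau_subP s (f : linf R G) : closed_span (range (@step R G)) f ->
  closed_span (range (@step R G)) (linf_shift s f).
Proof.
move=> /closureP Cf; apply/closureP => e e0.
have [g Lg fg] := Cf e e0; exists (linf_shift s g).
  move: g Lg {fg}; apply: lin_span_min.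
  - rewrite (_ : linf_shift s 0 = 0); first exact: lin_span0.
    by apply: linfP.
  - by move=> c g h Lg Lh; rewrite linf_shift_linear; exact: lin_spanP.
  by move=> _ [x _ <-]; rewrite linf_shift_step; apply: lin_span_gen; exists (x + s).
apply: le_lt_trans fg.
rewrite (_ : linf_shift s f - _ = linf_shift s (f - g)) ?linf_shift_norm //.
exact: linfP.
Qed.

Program Definition tau_hom (s : G) : starHom (B_Gamma R G) (B_Gamma R G) :=
  @StarHom R _ _
    (fun f => @SubAlg R _ (CStarSub (B_Gamma_subP R G)) _
                (@tau_subP s _ (sub_valP f))) _ _ _.
Next Obligation. by move=> s c f g; apply: sub_val_inj; exact: linfP. Qed.
Next Obligation. by move=> s f g; apply: sub_val_inj; exact: linfP. Qed.
Next Obligation. by move=> s f; apply: sub_val_inj; exact: linfP. Qed.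

Program Definition tau (s : G) : starAut (B_Gamma R G) :=
  @StarAut R _ (tau_hom s) (tau_hom (- s)) _ _.
Next Obligation.
by move=> s f; apply: sub_val_inj; apply: linfP => y /=; rewrite opprK addrK.
Qed.
Next Obligation.
by move=> s f; apply: sub_val_inj; apply: linfP => y /=; rewrite opprK subrK.
Qed.

Lemma tau_one_at s x : tau s (one_at x) = one_at (x + s).
Proof. by apply: sub_val_inj; exact: linf_shift_step. Qed.
End Translation.
Arguments tau {R G}.

Definition is_action (R : realType) (A : starAlgType R) (S : nmodType)
    (alpha : S -> starAut A) : Prop :=
  (forall a, alpha 0 a = a) /\
  (forall s t a, alpha (s + t) a = alpha s (alpha t a)).

(* The extension to G of an action of its positive cone:
   alpha_(-x) = alpha_x^-1. *)
Definition extend_action (R : realType) (A : starAlgType R) (G : ordGroupType)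
    (alpha : pcone G -> starAut A) (s : G) : starAut A :=
  match insub s with
  | Some x => alpha x
  | None => aut_inv (alpha (insubd (0 : pcone G) (- s)))
  end.

(* T is a C*-algebra tensor product of B and A: the completion of the algebraic
   tensor product in some C*-norm.  When B is nuclear, in particular
   when B is commutative as B_Gamma is, there is only one such norm, so T is
   determined up to isomorphism. *)
Record is_tensor_product (R : realType) (B A T : cstarType R)
    (tens : B -> A -> T) : Prop := {
  tens_linear_l : forall a, linear (tens^~ a);
  tens_linear_r : forall b, linear (tens b);
  tens_mul : forall b a b' a',
    tens b a ** tens b' a' = tens (b ** b') (a ** a');
  tens_star : forall b a, star (tens b a) = tens (star b) (star a);
  tens_inj : forall n (b : 'I_n -> B) (a : 'I_n -> A),
    (forall c : 'I_n -> R[i], \sum_(i < n) c i *: b i = 0 ->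
       forall i, c i = 0) ->
    \sum_(i < n) tens (b i) (a i) = 0 -> forall i, a i = 0;
  tens_dense : closed_span [set x | exists b a, x = tens b a] = setT
}.

Section Representations.
Variable R : realType.

Definition nondegenerate_hom (A B : cstarType R) (f : starHom A B) : Prop :=
  closed_span [set x | exists a b, x = f a ** b] = setT.

Definition nondegenerate_rep (A : cstarType R) (H : hilbertType R)
    (pi : starHom A (bounded_operator H)) : Prop :=
  closed_span [set x | exists a h, x = pi a h] = setT.

(* For a non-degenerate f, this says that e is the value at m of the unique
   extension of f to M(B). *)
Definition extends_at (B : cstarType R) (E : unitalStarAlgType R)
    (f : starHom B E) (m : multiplier B) (e : E) : Prop :=
  forall b, e ** f b = f (mleft m b).

Definition is_piso_rep (S : nmodType) (E : unitalStarAlgType R)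
    (V : S -> E) : Prop :=
  (forall s, V s ** star (V s) ** V s = V s) /\
  (forall s t, V s ** V t = V (s + t)).

Definition is_isometric_rep (S : nmodType) (E : unitalStarAlgType R)
    (V : S -> E) : Prop :=
  (forall s, star (V s) ** V s = aone) /\
  (forall s t, V s ** V t = V (s + t)).

Definition is_unitary_rep (S : nmodType) (E : unitalStarAlgType R)
    (U : S -> E) : Prop :=
  [/\ forall s, star (U s) ** U s = aone, forall s, U s ** star (U s) = aone
    & forall s t, U s ** U t = U (s + t)].

Definition piso_covariant (S : nmodType) (A : cstarType R)
    (E : unitalStarAlgType R) (alpha : S -> starAut A)
    (pi : starHom A E) (V : S -> E) : Prop :=
  [/\ is_piso_rep V,
      forall s a, pi (alpha s a) = V s ** pi a ** star (V s)
    & forall s a, star (V s) ** V s ** pi a = pi a ** (star (V s) ** V s)].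

Definition iso_covariant (S : nmodType) (A : cstarType R)
    (E : unitalStarAlgType R) (alpha : S -> starAut A)
    (pi : starHom A E) (V : S -> E) : Prop :=
  is_isometric_rep V /\
  (forall s a, pi (alpha s a) = V s ** pi a ** star (V s)).

Definition unitary_covariant (S : nmodType) (A : cstarType R)
    (E : unitalStarAlgType R) (alpha : S -> starAut A)
    (pi : starHom A E) (U : S -> E) : Prop :=
  is_unitary_rep U /\
  (forall s a, pi (alpha s a) = U s ** pi a ** star (U s)).

(* (iA, iS) is universal among the pairs on Hilbert spaces satisfying cov. *)
Definition universal_for (S : nmodType) (A : cstarType R)
    (cov : forall E : unitalStarAlgType R, starHom A E -> (S -> E) -> Prop)
    (B : cstarType R) (iA : starHom A B) (iS : S -> multiplier B) : Prop :=
  forall (H : hilbertType R) (pi : starHom A (bounded_operator H))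
         (V : S -> bounded_operator H),
    nondegenerate_rep pi -> cov (bounded_operator H) pi V ->
    exists rho : starHom B (bounded_operator H),
      [/\ nondegenerate_rep rho, forall a, rho (iA a) = pi a
        & forall s, extends_at rho (iS s) (V s)].

Record is_piso_crossed_product (S : nmodType) (A : cstarType R)
    (alpha : S -> starAut A) (B : cstarType R) (iA : starHom A B)
    (iS : S -> multiplier B) : Prop := {
  piso_nondegenerate : nondegenerate_hom iA;
  piso_cov : piso_covariant alpha (hom_comp (mult_emb B) iA) iS;
  piso_universal : universal_for (fun E => @piso_covariant S A E alpha) iA iS;
  piso_span : closed_span [set x | exists s a t,
    mult_emb B x = star (iS s) ** mult_emb B (iA a) ** iS t] = setT
}.

Record is_iso_crossed_product (S : nmodType) (A : cstarType R)
    (alpha : S -> starAut A) (B : cstarType R) (kA : starHom A B)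
    (kS : S -> multiplier B) : Prop := {
  iso_nondegenerate : nondegenerate_hom kA;
  iso_cov : iso_covariant alpha (hom_comp (mult_emb B) kA) kS;
  iso_universal : universal_for (fun E => @iso_covariant S A E alpha) kA kS;
  iso_generated : forall D : set B, is_cstar_sub D ->
    (forall a s x, mult_emb B x = mult_emb B (kA a) ** kS s -> D x) ->
    D = setT
}.

Record is_crossed_product (G : zmodType) (A : cstarType R)
    (gamma : G -> starAut A) (C : cstarType R) (j : starHom A C)
    (u : G -> multiplier C) : Prop := {
  cp_nondegenerate : nondegenerate_hom j;
  cp_cov : unitary_covariant gamma (hom_comp (mult_emb C) j) u;
  cp_universal : universal_for (fun E => @unitary_covariant G A E gamma) j u;
  cp_span : closed_span [set x | exists a s,
    mult_emb C x = mult_emb C (j a) ** u s] = setT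
}.

(* For a gamma-invariant ideal I of A, the crossed product of I by G as an ideal
   of C: the inclusion of I in A induces an injective homomorphism of crossed
   products with this range. *)
Definition ideal_crossed_product (G : zmodType) (A C : cstarType R)
    (j : starHom A C) (u : G -> multiplier C) (I : set A) : set C :=
  closed_span [set x | exists2 a, I a &
    exists s, mult_emb C x = mult_emb C (j a) ** u s].

(* The map between the crossed products induced by the universal pair
   (kA, kS), viewed as a covariant partial-isometric representation. *)
Definition natural_map (S : nmodType) (A P Q : cstarType R)
    (iA : starHom A P) (iS : S -> multiplier P)
    (kA : starHom A Q) (kS : S -> multiplier Q) (phi : starHom P Q) : Prop :=
  (forall a, phi (iA a) = kA a) /\
  (forall s, extends_at (hom_comp (mult_emb Q) phi) (iS s) (kS s)).

Definition hom_ker (A B : starAlgType R) (f : starHom A B) : set A :=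
  [set a | f a = 0].

Definition is_projection (E : starAlgType R) (p : E) : Prop :=
  star p = p /\ p ** p = p.

(* p D p, for p in M(C) and D a subset of C. *)
Definition corner (C : cstarType R) (p : multiplier C) (D : set C) : set C :=
  [set x | exists2 c, D c & mult_emb C x = p ** mult_emb C c ** p].

Definition full_corner (C : cstarType R) (p : multiplier C) : Prop :=
  is_projection p /\
  closed_span [set x | exists c d,
    mult_emb C x = mult_emb C c ** p ** mult_emb C d] = setT.
End Representations.

(* Main.v *)
(* The partial isometries [V_s = p u_s^* p] and the homomorphism [a |-> j (1_0 (x) a)]
   form a covariant pair in the corner [D = p C p], which gives [Psi : P -> D].

   Injectivity: let [(pi, V)] come from a representation of [P] on [H].  Each [V_t] is
   a coisometry, so [W_t = V_t^*] is a semigroup of isometries.  On the functions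
   [F : Gamma -> H] with [F (x + t) = W_t (F x)] for all large [x], normed by the
   eventually constant value of [|F x|], the translations are unitary, and
   [1_y |-> (F |-> (x |-> W_(x+y) V_(x+y) (F x)))] and
   [a |-> (F |-> (x |-> pi (alpha_x^-1 a) (F x)))] define a representation of
   [B_Gamma (x) A] covariant for the translations.  The resulting representation of
   [C], cut down to the copy [h |-> (x |-> W_x h)] of [H], is the given
   representation of [P] composed with [Psi].

   Kernel: [1 - V_s^* V_s] is the image of [1_0 - 1_s], so modulo the ideal generated by
   [B_(Gamma,infty)] the pair in [D] is isometric, and [Psi] modulo this ideal factors
   through [phi].  Conversely the generators of that ideal lie in the image of
   [ker phi].

   Both steps represent an abstract C*-algebra on a Hilbert space, by the
   Gelfand-Naimark-Segal construction for states separating a given element from a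
   given closed ideal. *)
Require Import Defs.
From HB Require Import structures.
From mathcomp Require Import all_boot all_order all_algebra.
From mathcomp Require Import all_classical all_reals all_analysis.
From mathcomp.real_closed Require Import complex.
From mathcomp Require Import ring lra.

Set Implicit Arguments.
Unset Strict Implicit.
Unset Printing Implicit Defensive.

Import Order.TTheory GRing.Theory Num.Theory.
Import numFieldNormedType.Exports.

Local Open Scope classical_set_scope.
Local Open Scope ring_scope.

(** * Norms, limits and closed spans *)

(** [P] and [C] are known only through universal properties for pairs on Hilbert spaces, and no norm
    formula accompanies them. Every estimate is therefore extracted from a supply of
    representations, and even a homomorphism from [P] into the corner has to be assembled from them.
    The norm of the given tensor product [T] is also unspecified. A representation of [T] on the
    dilation space exists only because finite sums of steps split into orthogonal blocks, on each of
    which the operator is a partial sum that any C*-norm controls. The sign in V_s = p u_s^* p comes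
    from [gamma] involving alpha^-1: it is u_(-s), not u_s, that implements alpha_s. Surjectivity of
    alpha_s is what makes V_s a coisometry, so that germs at infinity of functions on the group can
    play the part of the inductive limit of copies of H along the isometries V_t^*. Non-unital
    algebras are treated inside their multiplier algebras. Positivity rests on squares and norm
    inequalities: square roots come from an iteration, and each root commutes with whatever commutes
    with the original element, which stands in for functional calculus. *)

Section ComplexModulus.
Variable R : realType.
Implicit Types c d : R[i].

Definition cabs c : R := complex.Re `|c|.

Lemma cabsE c : `|c| = (cabs c)%:C%C.
Proof. exact: complex_normE. Qed.

Lemma cabs_ge0 c : 0 <= cabs c.
Proof. by rewrite -lecR -cabsE normr_ge0. Qed.

Lemma cabs_real (t : R) : cabs t%:C%C = `|t|.
Proof. by rewrite /cabs normc_def /= expr0n addr0 sqrtr_sqr. Qed.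

Lemma conj_realC (t : R) : (t%:C%C)^* = t%:C%C :> R[i].
Proof. by apply/eqP; rewrite eq_complex /= oppr0 !eqxx. Qed.

Lemma realC_inj (s t : R) : s%:C%C = t%:C%C :> R[i] -> s = t.
Proof. by case. Qed.

Lemma cabs0 : cabs 0 = 0.
Proof. by rewrite -[X in cabs X](rmorph0 (@real_complex R)) cabs_real normr0. Qed.

Lemma cabs1 : cabs 1 = 1.
Proof. by rewrite -[X in cabs X](rmorph1 (@real_complex R)) cabs_real normr1. Qed.

Lemma cabsM c d : cabs (c * d) = cabs c * cabs d.
Proof. by apply: realC_inj; rewrite rmorphM -!cabsE normrM. Qed.
End ComplexModulus.

Section RealNorm.
Variables (R : realType) (V : normedModType R[i]).
Implicit Types (x y : V) (t : R).

(* The norm of a [normedModType R[i]] is an element of [R[i]]; [nr] reads it in [R]. *)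
Definition nr x : R := complex.Re `|x|.

Lemma nrE x : `|x| = (nr x)%:C%C.
Proof. by rewrite [LHS]complex_ge0_ReE. Qed.

Lemma nr_ge0 x : 0 <= nr x.
Proof. by rewrite -lecR -nrE normr_ge0. Qed.

Lemma nr0 : nr 0 = 0.
Proof. by rewrite /nr normr0. Qed.

Lemma nr_eq0 x : nr x = 0 -> x = 0.
Proof. by move=> x0; apply/eqP; rewrite -normr_eq0 nrE x0. Qed.

Lemma nr_le0 x : nr x <= 0 -> x = 0.
Proof. by move=> x0; apply: nr_eq0; apply/eqP; rewrite eq_le x0 nr_ge0. Qed.

Lemma nrN x : nr (- x) = nr x.
Proof. by rewrite /nr normrN. Qed.

Lemma nrB x y : nr (x - y) = nr (y - x).
Proof. by rewrite -nrN opprB. Qed.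

Lemma nr_triangle x y : nr (x + y) <= nr x + nr y.
Proof. by rewrite -lecR rmorphD /= -!nrE ler_normD. Qed.

Lemma nr_triangleB x y : nr (x - y) <= nr x + nr y.
Proof. by rewrite (le_trans (nr_triangle _ _)) // nrN. Qed.

Lemma nr_dist x y z : nr (x - z) <= nr (x - y) + nr (y - z).
Proof. by rewrite -[x - z](subrKA y) nr_triangle. Qed.

Lemma nrZC (c : R[i]) x : nr (c *: x) = cabs c * nr x.
Proof. by rewrite /nr normrZ (nrE x) (cabsE c) /= mul0r subr0. Qed.

Lemma nrZ t x : nr (t%:C%C *: x) = `|t| * nr x.
Proof. by rewrite nrZC cabs_real. Qed.

Lemma lt_nr x (M : R) : (`|x| < M%:C%C) = (nr x < M).
Proof. by rewrite nrE ltcR. Qed.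

Lemma nr_dist_le x y : nr x <= nr y + nr (x - y).
Proof. by have := nr_triangle y (x - y); rewrite addrC subrK. Qed.
End RealNorm.

Section Limits.
Variable R : realType.

(** A one-sided condition: for sequences of norms it is convergence to 0, and a constant satisfies
    it exactly when it is at most 0, which is how inequalities pass to the limit. *)
Definition null (r : nat -> R) :=
  forall e : R, 0 < e -> exists N, forall n, (N <= n)%N -> r n < e.

Lemma null_le (r s : nat -> R) : (forall n, r n <= s n) -> null s -> null r.
Proof.
move=> rs s0 e /s0[N sN]; exists N => n /sN; exact: le_lt_trans.
Qed.

Lemma nullD (r s : nat -> R) : null r -> null s -> null (fun n => r n + s n).
Proof.
move=> r0 s0 e e0; have e2 : 0 < e / 2 by rewrite divr_gt0.
have [N rN] := r0 _ e2; have [M sM] := s0 _ e2.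
exists (maxn N M) => n; rewrite geq_max => /andP[/rN ? /sM ?].
by rewrite [e]splitr ltrD.
Qed.

Lemma nullZ (c : R) (r : nat -> R) : (forall n, 0 <= r n) ->
  null r -> null (fun n => c * r n).
Proof.
move=> rp r0 e e0; have k0 : 0 < `|c| + 1 by rewrite ltr_wpDl.
have [N rN] := r0 _ (divr_gt0 e0 k0); exists N => n /rN.
rewrite ltr_pdivlMr // => h; apply: le_lt_trans h; rewrite mulrC ler_wpM2l //.
by rewrite (le_trans (ler_norm c)) // lerDl.
Qed.

Lemma null_inv : null (fun n => n.+1%:R^-1).
Proof.
move=> e e0; exists (Num.truncn (e^-1)) => n.
move=> nN; rewrite -[e]invrK ltf_pV2 ?posrE ?invr_gt0 //.
by apply: lt_le_trans (truncnS_gt _) _; rewrite ler_nat.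
Qed.

Lemma null_cst (c : R) : null (fun=> c) -> c <= 0.
Proof.
by move=> c0; rewrite leNgt; apply/negP => /c0[N /(_ N (leqnn _))]; rewrite ltxx.
Qed.

Lemma null_bound (r : nat -> R) (c : R) :
  null r -> (forall n, c <= r n) -> c <= 0.
Proof. by move=> r0 cr; apply: null_cst; exact: null_le r0. Qed.

Section Tends.
Variable V : normedModType R[i].
Implicit Types (u v : nat -> V) (l m : V).

Definition tends u l := null (fun n => nr (u n - l)).

Lemma tends_cst l : tends (fun=> l) l.
Proof. by move=> e e0; exists 0%N => n _; rewrite subrr nr0. Qed.

Lemma tends_uniq u l m : tends u l -> tends u m -> l = m.
Proof.
move=> ul um; apply/eqP; rewrite -subr_eq0; apply/eqP/nr_le0.
apply: (null_bound (nullD ul um)) => n.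
by rewrite (nrB (u n)); exact: nr_dist.
Qed.

Lemma tendsD u v l m : tends u l -> tends v m ->
  tends (fun n => u n + v n) (l + m).
Proof.
move=> ul vm; apply: null_le (nullD ul vm) => n.
by rewrite opprD addrACA nr_triangle.
Qed.

Lemma tends_bounded u l : tends u l -> exists N M : nat,
  forall n, (N <= n)%N -> nr (u n) <= M%:R.
Proof.
move=> /(_ 1 ltr01)[N uN]; exists N, (Num.truncn (nr l + 1)).+1 => n /uN h.
apply: le_trans (nr_dist_le (u n) l) _; rewrite -lerBrDr.
rewrite lerBrDr ltW // (le_lt_trans _ (truncnS_gt _)) // lerD2l ltW //.
Qed.

Lemma tends_nr u l (C : R) : (forall n, nr (u n) <= C) -> tends u l ->
  nr l <= C.
Proof.
move=> uC ul; rewrite -subr_le0; apply: (null_bound ul) => n.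
by rewrite nrB lerBlDr addrC (le_trans (nr_dist_le l (u n))) // lerD2r.
Qed.

Definition seq_closed (P : set V) :=
  forall u l, (forall n, P (u n)) -> tends u l -> P l.

Lemma closure_tends (S : set V) l :
  closure S l <-> exists2 u, (forall n, S (u n)) & tends u l.
Proof.
split=> [Sl|[u Su ul] B /nbhs_ballP[e /= e0 lB]].
  have /choice[u uP] : forall n : nat, exists x, S x /\ nr (x - l) < n.+1%:R^-1.
    move=> n; have n0 : 0 < (n.+1%:R^-1 : R)%:C%C by rewrite ltcR invr_gt0.
    have [x [Sx]] := Sl _ (nbhsx_ballx l _ n0).
    by rewrite -ball_normE /= => lx; exists x; rewrite nrB -lt_nr.
  exists u => [n|]; first by have [] := uP n.
  by apply: null_le null_inv => n; have [_ /ltW] := uP n.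
have [|N uN] := ul (complex.Re e).
  by rewrite -ltcR -complex_ge0_ReE // ltW.
exists (u N); split => //; apply: lB; rewrite -ball_normE /=.
by rewrite (complex_ge0_ReE (ltW e0)) lt_nr nrB uN.
Qed.

Lemma closed_seq (P : set V) : closed P <-> seq_closed P.
Proof.
split=> [cP u l Pu ul|cP l /closure_tends[u Pu ul]]; last exact: cP ul.
by apply: cP; apply/closure_tends; exists u.
Qed.

Lemma seq_closed_closure (S : set V) : seq_closed (closure S).
Proof. by apply/closed_seq; exact: closed_closure. Qed.

Lemma closed_span_min (S P : set V) : P 0 ->
    (forall (c : R[i]) x y, P x -> P y -> P (c *: x + y)) -> seq_closed P ->
    S `<=` P ->
  closed_span S `<=` P.
Proof.
move=> P0 Plin cP SP l /closure_tends[u uS ul]; apply: cP ul => n.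
exact: lin_span_min (uS n).
Qed.

Lemma closed_span_gen (S : set V) x : S x -> closed_span S x.
Proof. by move=> Sx; apply/subset_closure/lin_span_gen. Qed.

Lemma closed_span0 (S : set V) : closed_span S 0.
Proof. exact/subset_closure/lin_span0. Qed.
End Tends.

Lemma tends_lip (V W : normedModType R[i]) (f : V -> W) (C : R) u l :
  (forall n, nr (f (u n) - f l) <= C * nr (u n - l)) ->
  tends u l -> tends (fun n => f (u n)) (f l).
Proof.
move=> fC ul; apply: null_le fC _; apply: nullZ ul => n; exact: nr_ge0.
Qed.

Lemma bounded_opP (V W : normedModType R[i]) (f : V -> W) :
  bounded_op f <-> exists2 M : R, 0 <= M & forall x, nr (f x) <= M * nr x.
Proof.
split=> [[M M0 fM]|[M M0 fM]].
  exists (complex.Re M) => [|x]; first by rewrite -lecR -complex_ge0_ReE.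
  by move: (fM x); rewrite {1}(complex_ge0_ReE M0) !nrE -rmorphM lecR.
by exists M%:C%C => [|x]; rewrite ?lecR // !nrE -rmorphM lecR.
Qed.

Lemma linearB_fun (V W : lmodType R[i]) (f : V -> W) : linear f ->
  (f 0 = 0) * (forall x, f (- x) = - f x) * (forall x y, f (x - y) = f x - f y).
Proof.
move=> /linear_funE lf; have f0 : f 0 = 0 by rewrite -(scale0r 0) lf scale0r.
have fN x : f (- x) = - f x by rewrite -scaleN1r lf scaleN1r.
by split=> // x y; rewrite lf fN.
Qed.

Lemma tends_lin (V W : normedModType R[i]) (f : V -> W) u l : linear f ->
  bounded_op f -> tends u l -> tends (fun n => f (u n)) (f l).
Proof.
move=> lf /bounded_opP[M _ fM]; apply: (tends_lip (C := M)) => n.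
by rewrite -(linearB_fun lf).2.
Qed.

Lemma tendsZ (V : normedModType R[i]) (c : R[i]) (u : nat -> V) l :
  tends u l -> tends (fun n => c *: u n) (c *: l).
Proof.
apply: (tends_lip (C := cabs c)) => n.
by rewrite -scalerBr nrZC.
Qed.

Lemma tendsN (V : normedModType R[i]) (u : nat -> V) l :
  tends u l -> tends (fun n => - u n) (- l).
Proof.
by apply: (tends_lip (C := 1)) => n; rewrite mul1r -opprD nrN.
Qed.

Lemma tendsB (V : normedModType R[i]) (u v : nat -> V) l m :
  tends u l -> tends v m -> tends (fun n => u n - v n) (l - m).
Proof. by move=> ul /tendsN; exact: tendsD. Qed.

Lemma tends_cauchy (V : completeNormedModType R[i]) (u : nat -> V) :
  (forall e : R, 0 < e -> exists N, forall n m, (N <= n)%N -> (N <= m)%N ->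
     nr (u n - u m) < e) ->
  exists l, tends u l.
Proof.
move=> uc; have : cauchy (u @ \oo).
  apply/cauchyP => e e0; have [|N uN] := uc (complex.Re e).
    by rewrite -ltcR -complex_ge0_ReE // ltW.
  exists (u N), N => // n /= Nn; rewrite -ball_normE /=.
  by rewrite (complex_ge0_ReE (ltW e0)) lt_nr uN.
move=> /cauchy_cvg/cvg_ex[l /cvgrPdist_lt ul]; exists l => e e0.
have [|N _ uN] := ul e%:C%C; first by rewrite ltcR.
by exists N => n Nn; rewrite nrB -lt_nr; exact: uN.
Qed.

Lemma tends_is_cauchy (V : normedModType R[i]) (u : nat -> V) l : tends u l ->
  forall e : R, 0 < e -> exists N, forall n m, (N <= n)%N -> (N <= m)%N ->
     nr (u n - u m) < e.
Proof.
move=> ul e e0; have e2 : 0 < e / 2 by rewrite divr_gt0.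
have [N uN] := ul _ e2; exists N => n m /uN un /uN um.
apply: le_lt_trans (nr_dist _ l _) _; rewrite [e]splitr ltrD //.
by rewrite nrB.
Qed.

Lemma bl_ext (V W : normedModType R[i]) (f g : V -> W) (S : set V) :
  linear f -> bounded_op f -> linear g -> bounded_op g ->
  closed_span S = setT -> (forall x, S x -> f x = g x) -> f =1 g.
Proof.
move=> lf bf lg bg ST fg x; have : closed_span S x by rewrite ST.
apply: (@closed_span_min _ S [set x | f x = g x]) => //=.
- by rewrite (linearB_fun lf).1.1 (linearB_fun lg).1.1.
- by move=> c y z fy fz; rewrite lf lg fy fz.
move=> u l uP ul; apply: (tends_uniq (tends_lin lf bf ul)).
by under eq_fun do rewrite uP; exact: tends_lin.
Qed.

(** The pairs (i a, i' a) form a linear relation with dense domain rather than a map; the bound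
    makes this relation single-valued and continuous. *)
Lemma extend_linear (I : Type) (V : normedModType R[i])
    (W : completeNormedModType R[i]) (i : I -> V) (i' : I -> W) (M : R) :
  0 <= M ->
  closure (range i) = setT ->
  (forall c a b, exists z, i z = c *: i a + i b /\ i' z = c *: i' a + i' b) ->
  (forall a, nr (i' a) <= M * nr (i a)) ->
  exists f : V -> W, [/\ linear f, bounded_op f, forall x, nr (f x) <= M * nr x
    & forall a, f (i a) = i' a].
Proof.
move=> M0 iT iD iM.
have iB a b : nr (i' a - i' b) <= M * nr (i a - i b).
  have [z [iz i'z]] := iD (-1) b a.
  by rewrite addrC -scaleN1r -i'z [in leRHS]addrC -scaleN1r -iz.
have seq_i x : exists a : nat -> I, tends (i \o a) x.
  have : closure (range i) x by rewrite iT.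
  case/closure_tends => u uS ux.
  have /choice[a ia] : forall n, exists a, i a = u n.
    by move=> n; have [a _ <-] := uS n; exists a.
  by exists a; rewrite (_ : i \o a = u) //; apply/funext.
(* The value at x is the limit along every approximating sequence; linearity then follows by using
   combinations of sequences for c x + y. *)
have /choice[f fP] : forall x, exists y, forall a, tends (i \o a) x ->
    tends (i' \o a) y.
  move=> x; have [a ax] := seq_i x.
  have [|y ay] := @tends_cauchy W (i' \o a).
    move=> e e0; have k0 : 0 < M + 1 by rewrite ltr_wpDl.
    have [N aN] := tends_is_cauchy ax (divr_gt0 e0 k0).
    exists N => n m nN mN; have := aN n m nN mN; rewrite ltr_pdivlMr // => h.
    apply: le_lt_trans (iB _ _) _; apply: le_lt_trans h.
    by rewrite mulrC ler_wpM2l ?nr_ge0 // lerDl.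
  exists y => b bx; have /null_le : forall n, nr (i' (b n) - y) <=
      M * nr (i (b n) - i (a n)) + nr (i' (a n) - y).
    by move=> n; apply: le_trans (nr_dist _ (i' (a n)) _) _; rewrite lerD2r iB.
  apply; apply: nullD ay; apply: nullZ => [n|]; first exact: nr_ge0.
  have := tendsB bx ax; rewrite subrr /tends.
  by under eq_fun do rewrite subr0.
have fi a : f (i a) = i' a.
  by apply: (tends_uniq (fP _ (fun=> a) (tends_cst _))); exact: tends_cst.
have fM x : nr (f x) <= M * nr x.
  have [a ax] := seq_i x; have ay := fP _ _ ax.
  rewrite -subr_le0; apply: (null_bound (r := fun n =>
    nr (i' (a n) - f x) + M * nr (i (a n) - x))).
    by apply: nullD ay _; apply: nullZ ax => n; exact: nr_ge0.
  move=> n; have h1 := nr_dist_le (f x) (i' (a n)).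
  have h2 := iM (a n); have h3 := nr_dist_le (i (a n)) x.
  have h4 : M * nr (i (a n)) <= M * (nr x + nr (i (a n) - x)) by rewrite ler_wpM2l.
  rewrite (nrB (i' (a n))); lra.
exists f; split=> //; last by apply/bounded_opP; exists M.
move=> c x y; have [a ax] := seq_i x; have [b by_] := seq_i y.
have /choice[z zP] : forall n, exists z,
    i z = c *: i (a n) + i (b n) /\ i' z = c *: i' (a n) + i' (b n).
  by move=> n; exact: iD.
have zx : tends (i \o z) (c *: x + y).
  rewrite (_ : i \o z = fun n => c *: i (a n) + i (b n)).
    by apply: tendsD => //; exact: tendsZ.
  by apply/funext => n /=; have [] := zP n.
apply: (tends_uniq (fP _ _ zx)).
rewrite (_ : i' \o z = fun n => c *: i' (a n) + i' (b n)).
  by apply: tendsD; [apply: tendsZ|]; exact: fP.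
by apply/funext => n /=; have [] := zP n.
Qed.
End Limits.

(** * Exponential against linear growth *)

Section Powers.
Variable R : realType.

(** If x = (1 + d) t with d > 0, Bernoulli's inequality at exponent 2^m, squared, makes (1 +
    d)^(2^(m+1)) grow quadratically in 2^m, against a linear bound. *)
Lemma root_bound (x t K : R) : 0 <= x -> 0 <= t ->
  (forall m, x ^+ (2 ^ m) <= K * (2 ^ m).+1%:R * t ^+ (2 ^ m)) -> x <= t.
Proof.
move=> x0 t0 xt; rewrite leNgt; apply/negP => tx.
have [t00|t_gt0] := eqVneq t 0.
  by have := xt 0%N; rewrite t00 /= expr1 mulr0 leNgt (le_lt_trans t0 tx).
have {}t_gt0 : 0 < t by rewrite lt_neqAle eq_sym t_gt0.
pose d := x / t - 1.
have d0 : 0 < d by rewrite subr_gt0 ltr_pdivlMr // mul1r.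
have xE : x = (1 + d) * t by rewrite /d addrC subrK mulfVK // gt_eqF.
have bern n : 1 + n%:R * d <= (1 + d) ^+ n.
  elim: n => [|n IH]; first by rewrite mul0r addr0 expr0.
  rewrite exprS; apply: le_trans (_ : (1 + d) * (1 + n%:R * d) <= _).
    have n0 : 0 <= n%:R :> R by [].
    rewrite -natr1; nra.
  by rewrite ler_wpM2l // addr_ge0 // ltW.
have key m : (1 + d) ^+ (2 ^ m) <= K * (2 ^ m).+1%:R.
  have := xt m; rewrite [in leLHS]xE exprMn ler_pM2r //.
  exact: exprn_gt0.
have K0 : 0 < K.
  have := key 0%N; rewrite expn0 expr1 => h.
  have : 0 < K * 2%:R by apply: lt_le_trans h; lra.
  by rewrite pmulr_lgt0.
(* With N = 2^m >= m, this choice gives (N d)^2 >= 4 K N, which exceeds the bound K (2 N + 1) <= 3 K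
   N. *)
pose m := (Num.truncn (4 * K / d ^+ 2)).+1.
have h1 : 4 * K < m%:R * d ^+ 2.
  by rewrite -ltr_pdivrMr ?exprn_gt0 // truncnS_gt.
have h2 := key m.+1; rewrite expnSr exprM in h2.
have h3 : (1 + (2 ^ m)%:R * d) ^+ 2 <= (1 + d) ^+ (2 ^ m) ^+ 2.
  have d1 : 0 <= 1 + (2 ^ m)%:R * d by rewrite addr_ge0 // mulr_ge0 // ltW.
  have d2 : 0 <= (1 + d) ^+ (2 ^ m) by rewrite exprn_ge0 // addr_ge0 // ltW.
  by rewrite lerXn2r // bern.
have mN : m%:R <= (2 ^ m)%:R :> R by rewrite ler_nat ltnW // ltn_expl.
have m0 : 1 <= (2 ^ m)%:R :> R by rewrite (ler_nat _ 1) expn_gt0.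
have NE : (2 ^ m * 2).+1%:R = (2 ^ m)%:R * 2 + 1 :> R by rewrite -natr1 natrM.
move: h1 h2 h3 mN m0; rewrite NE; set N := (2 ^ m)%:R; set M := m%:R.
move=> h1 h2 h3 mN m0.
have : N * (4 * K) <= N * (N * d ^+ 2).
  have N0 : 0 <= N by lra.
  by rewrite ler_wpM2l // (le_trans (ltW h1)) // ler_wpM2r // sqr_ge0.
have : 0 < N * d by rewrite mulr_gt0 //; lra.
set Nd := N * d; have -> : N * (N * d ^+ 2) = Nd ^+ 2 by rewrite /Nd; ring.
have : K <= K * N by rewrite ler_peMr // ltW.
move: h2 h3; set B := (1 + d) ^+ _; move=> h2 h3 h4 h5 h6.
have : K * (N * 2 + 1) = 2 * (K * N) + K by ring.
have : (1 + Nd) ^+ 2 = 1 + 2 * Nd + Nd ^+ 2 by ring.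
nra.
Qed.
End Powers.

(** * Multipliers and operators as C*-algebras *)

Section SeqComplete.
Variables (R : realType) (V : normedModType R[i]).

(** A Cauchy filter contains balls of radius 1/(n+1); their centres form a Cauchy sequence, and the
    filter converges to its limit. *)
Lemma seq_complete :
  (forall u : nat -> V, (forall e : R, 0 < e -> exists N, forall n m,
     (N <= n)%N -> (N <= m)%N -> nr (u n - u m) < e) ->
     exists l, tends u l) ->
  forall F : set_system V, ProperFilter F -> cauchy F -> cvg F.
Proof.
move=> VC F FF /cauchyP Fc.
have /choice[u uF] : forall n : nat, exists x, F [set y | nr (x - y) < n.+1%:R^-1].
  move=> n; have [|x Fx] := Fc (n.+1%:R^-1 : R)%:C%C; first by rewrite ltcR invr_gt0.
  exists x; apply: filterS Fx => y; rewrite -ball_normE /=.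
  by rewrite lt_nr.
have nE (e : R) : 0 < e -> exists N, forall n, (N <= n)%N -> n.+1%:R^-1 < e :> R.
  exact: null_inv.
have [|l ul] := VC u.
  move=> e e0; have [N Ne] := nE _ (divr_gt0 e0 (ltr0Sn R 1)).
  exists N => n m /Ne ne /Ne me.
  have [y [/= ny my]] := filter_ex (filterI (uF n) (uF m)).
  apply: le_lt_trans (nr_dist _ y _) _; rewrite (nrB y) [e]splitr.
  by rewrite ltrD // (lt_trans ny ne, lt_trans my me).
apply/cvg_ex; exists l; apply/cvgrPdist_lt => e e0.
rewrite (complex_ge0_ReE (ltW e0)).
have e0' : 0 < complex.Re e by rewrite -ltcR -complex_ge0_ReE // ltW.
have [N Ne] := nE _ (divr_gt0 e0' (ltr0Sn R 1)).
have [M Me] := ul _ (divr_gt0 e0' (ltr0Sn R 1)).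
apply: filterS (uF (maxn N M)) => y /= uy; rewrite lt_nr.
apply: le_lt_trans (nr_dist _ (u (maxn N M)) _) _; rewrite [ltRHS]splitr.
rewrite ltrD // ?(lt_trans uy) ?Ne ?leq_maxl //.
by rewrite nrB Me ?leq_maxr.
Qed.
End SeqComplete.

Section OperatorNorm.
Variables (R : realType) (V W : normedModType R[i]).
Implicit Types f g : V -> W.

Definition opn f : R := sup [set nr (f x) | x in [set x | nr x <= 1]].

Lemma opn_le f (M : R) : 0 <= M -> (forall x, nr (f x) <= M * nr x) ->
  opn f <= M.
Proof.
move=> M0 fM; apply: ge_sup.
  by exists (nr (f 0)), 0 => //=; rewrite nr0.
move=> _ [x /= x1 <-]; apply: le_trans (fM x) _.
by rewrite -[leRHS]mulr1 ler_wpM2l.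
Qed.

Lemma opn_has_sup f : bounded_op f ->
  has_ubound [set nr (f x) | x in [set x | nr x <= 1]].
Proof.
move=> /bounded_opP[M M0 fM]; exists M => _ [x /= x1 <-].
by apply: le_trans (fM x) _; rewrite -[leRHS]mulr1 ler_wpM2l.
Qed.

Lemma opn_ge0 f : bounded_op f -> 0 <= opn f.
Proof.
move=> bf; apply: le_trans (nr_ge0 (f 0)) _; apply: ub_le_sup.
  exact: opn_has_sup.
by exists 0 => //=; rewrite nr0.
Qed.

Lemma opn_ge f x : linear f -> bounded_op f -> nr (f x) <= opn f * nr x.
Proof.
move=> lf bf; have [x0|x0] := eqVneq (nr x) 0.
  by rewrite (nr_eq0 x0) (linearB_fun lf).1.1 !nr0 mulr0.
have {}x0 : 0 < nr x by rewrite lt_neqAle eq_sym x0 nr_ge0.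
rewrite -ler_pdivrMr // mulrC -[X in X * _]ger0_norm ?invr_ge0 ?nr_ge0 //.
rewrite -nrZ -(linear_funE lf).2; apply: ub_le_sup; first exact: opn_has_sup.
eexists; last by []; rewrite /= nrZ ger0_norm ?invr_ge0 ?nr_ge0 //.
by rewrite mulVf // gt_eqF.
Qed.

Lemma opn_eq0 f : linear f -> bounded_op f -> opn f = 0 -> forall x, f x = 0.
Proof.
move=> lf bf f0 x; apply: nr_le0.
by rewrite (le_trans (opn_ge x lf bf)) // f0 mul0r.
Qed.

Lemma opnD f g : linear f -> bounded_op f -> linear g -> bounded_op g ->
  opn (fun x => f x + g x) <= opn f + opn g.
Proof.
move=> lf bf lg bg; apply: opn_le => [|x]; first by rewrite addr_ge0 ?opn_ge0.
by rewrite mulrDl (le_trans (nr_triangle _ _)) // lerD // opn_ge.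
Qed.

Lemma opnZ_le (c : R[i]) f : linear f -> bounded_op f ->
  opn (fun x => c *: f x) <= cabs c * opn f.
Proof.
move=> lf bf; have c0 := cabs_ge0 c.
apply: opn_le => [|x]; first by rewrite mulr_ge0 ?opn_ge0.
by rewrite nrZC -mulrA ler_wpM2l // opn_ge.
Qed.

Lemma opnZ (c : R[i]) f : linear f -> bounded_op f ->
  opn (fun x => c *: f x) = cabs c * opn f.
Proof.
move=> lf bf; apply/eqP; rewrite eq_le opnZ_le //=.
have [->|c0] := eqVneq c 0.
  by rewrite cabs0 mul0r opn_ge0 //; exact: bounded_opZ.
have nc : 0 < cabs c by rewrite -ltcR -cabsE normr_gt0.
rewrite -ler_pdivlMl //.
have := @opnZ_le c^-1 (fun x => c *: f x) (linear_funZ c lf) (bounded_opZ c bf).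
under eq_fun do rewrite scalerA mulVf // scale1r.
rewrite (_ : cabs c^-1 = (cabs c)^-1) //; apply: (mulfI (negbT (gt_eqF nc))).
by rewrite -cabsM (mulfV c0) cabs1 mulfV // gt_eqF.
Qed.
End OperatorNorm.

Section OperatorLimit.
Variables (R : realType) (V : normedModType R[i]) (W : completeNormedModType R[i]).

Lemma op_limit (T : nat -> V -> W) : (forall n, linear (T n)) ->
  (forall n, bounded_op (T n)) ->
  (forall e : R, 0 < e -> exists N, forall n m : nat, (N <= n)%N -> (N <= m)%N ->
     forall x, nr (T n x - T m x) <= e * nr x) ->
  exists L : V -> W, [/\ linear L, bounded_op L,
    (forall x, tends (T ^~ x) (L x))
    & forall e : R, 0 < e -> exists N, forall n, (N <= n)%N ->
        forall x, nr (T n x - L x) <= e * nr x].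
Proof.
move=> lT bT cT.
have /choice[L TL] : forall x, exists l, tends (T ^~ x) l.
  move=> x; apply: tends_cauchy => e e0.
  have k0 : 0 < nr x + 1 by rewrite ltr_wpDl // nr_ge0.
  have [N TN] := cT _ (divr_gt0 e0 k0); exists N => n m nN mN.
  apply: le_lt_trans (TN _ _ nN mN x) _.
  rewrite -mulrA gtr_pMr // mulrC ltr_pdivrMr // mul1r ltrDl //.
have lL : linear L.
  move=> c x y; apply: (tends_uniq (TL _)).
  under eq_fun do rewrite lT.
  by apply: tendsD => //; exact: tendsZ.
have TLe (e : R) : 0 < e -> exists N, forall n, (N <= n)%N ->
    forall x, nr (T n x - L x) <= e * nr x.
  move=> e0; have [N TN] := cT e e0; exists N => n nN x.
  have h : tends (fun m => T n x - T (m + N)%N x) (T n x - L x).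
    apply: tendsB (tends_cst _) _ => d d0.
    have [M TM] := TL x d d0; exists M => m mM.
    by apply: TM; rewrite (leq_trans mM) // leq_addr.
  by apply: tends_nr h => m; apply: TN => //; exact: leq_addl.
exists L; split => //.
have [N TN] := TLe 1 ltr01; have /bounded_opP[M M0 TM] := bT N.
apply/bounded_opP; exists (M + 1) => [|x]; first exact: addr_ge0.
apply: le_trans (nr_dist_le _ (T N x)) _.
rewrite nrB mulrDl lerD //; exact: TN.
Qed.
End OperatorLimit.

Section MultiplierNorm.
Variables (R : realType) (B : cstarType R).
Implicit Types (m n : multiplier B) (x y : B).

Lemma nr_amul x y : nr (x ** y) <= nr x * nr y.
Proof. by rewrite -lecR rmorphM /= -!nrE norm_amul. Qed.

Lemma nr_star x : nr (star x) = nr x.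
Proof. by rewrite /nr norm_star. Qed.

Lemma nr_cstar x : nr (star x ** x) = nr x ^+ 2.
Proof.
by rewrite {1}/nr cstar_norm nrE -rmorphXn.
Qed.

Lemma amul_star_eq0 x : star x ** x = 0 -> x = 0.
Proof.
move=> x0; have := nr_cstar x; rewrite x0 nr0 => /esym/eqP.
by rewrite sqrf_eq0 => /eqP/nr_eq0.
Qed.

Lemma amul_inj x y : (forall z, x ** z = y ** z) -> x = y.
Proof.
move=> xy; apply/eqP; rewrite -subr_eq0; apply/eqP.
apply: star_inj; rewrite star0; apply: amul_star_eq0.
by rewrite starK amulDl amulNl xy subrr.
Qed.

(** Since a (m b) = (a m) b, the left action determines every product (a m) b, hence a m itself. *)
Lemma multiplier_ext m n : (forall b, mleft m b = mleft n b) -> m = n.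
Proof.
move=> mn; apply: multiplierP => // b; apply: amul_inj => z.
by rewrite -!mleft_right mn.
Qed.

Definition mnr m := opn (mleft m).

Lemma mnr_ge m x : nr (mleft m x) <= mnr m * nr x.
Proof. by apply: opn_ge; [exact: mleft_linear|exact: mleft_bounded]. Qed.

Lemma mnr_ge0 m : 0 <= mnr m.
Proof. exact/opn_ge0/mleft_bounded. Qed.

Lemma mright_ge m x : nr (mright m x) <= mnr m * nr x.
Proof.
set y := mright m x; have [y0|y0] := eqVneq (nr y) 0.
  by rewrite y0 mulr_ge0 ?mnr_ge0 ?nr_ge0.
have {}y0 : 0 < nr y by rewrite lt_neqAle eq_sym y0 nr_ge0.
rewrite -(ler_pM2r y0) -expr2 -[X in X ^+ 2]nr_star -nr_cstar starK.
rewrite -mleft_right (le_trans (nr_amul _ _)) // mulrAC (mulrC _ (nr x)) mulrA.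
by rewrite -mulrA ler_wpM2l ?nr_ge0 // -[in leRHS]nr_star mnr_ge.
Qed.

Lemma mnr_star m : mnr (star m) <= mnr m.
Proof.
apply: opn_le => [|x]; first exact: mnr_ge0.
by rewrite /= nr_star (le_trans (mright_ge _ _)) // nr_star.
Qed.

Definition mult_norm m : R[i] := (mnr m)%:C%C.

Fact mult_normD m n : mult_norm (m + n) <= mult_norm m + mult_norm n.
Proof.
rewrite -rmorphD lecR; apply: opnD;
  by [exact: mleft_linear|exact: mleft_bounded].
Qed.

Fact mult_normZ (c : R[i]) m : mult_norm (c *: m) = `|c| * mult_norm m.
Proof.
rewrite cabsE -rmorphM; congr (_%:C%C).
by rewrite -opnZ; [|exact: mleft_linear|exact: mleft_bounded].
Qed.

Fact mult_norm0_eq0 m : mult_norm m = 0 -> m = 0.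
Proof.
move=> /realC_inj m0; apply: multiplier_ext.
by apply: opn_eq0 m0; [exact: mleft_linear|exact: mleft_bounded].
Qed.

HB.instance Definition _ := Lmodule_isNormed.Build R[i] (multiplier B)
  mult_normD mult_normZ mult_norm0_eq0.

Lemma nr_multE m : nr m = mnr m. Proof. by []. Qed.

Lemma multiplier_complete (F : set_system (multiplier B)) :
  ProperFilter F -> cauchy F -> cvg F.
Proof.
apply: seq_complete => u uc.
have cu e : 0 < e -> exists N, forall n m : nat, (N <= n)%N -> (N <= m)%N ->
    forall x, nr (mleft (u n) x - mleft (u m) x) <= e * nr x.
  move=> e0; have [N uN] := uc e e0; exists N => n m nN mN x.
  have := mnr_ge (u n - u m) x; move/le_trans; apply.
  by rewrite ler_wpM2r ?nr_ge0 // ltW // -nr_multE uN.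
have cr e : 0 < e -> exists N, forall n m : nat, (N <= n)%N -> (N <= m)%N ->
    forall x, nr (mright (u n) x - mright (u m) x) <= e * nr x.
  move=> e0; have [N uN] := uc e e0; exists N => n m nN mN x.
  have := mright_ge (u n - u m) x; move/le_trans; apply.
  by rewrite ler_wpM2r ?nr_ge0 // ltW // -nr_multE uN.
have [l [ll lb lt le]] := op_limit (fun k => mleft_linear (u k))
  (fun k => mleft_bounded (u k)) cu.
have [r [rl rb rt re]] := op_limit (fun k => mright_linear (u k))
  (fun k => mright_bounded (u k)) cr.
have tl a (v : nat -> B) b : tends v b -> tends (fun k => a ** v k) (a ** b).
  by apply: (tends_lip (C := nr a)) => n; rewrite -amulNr -amulDr nr_amul.
have tr a (v : nat -> B) b : tends v b -> tends (fun k => v k ** a) (b ** a).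
  apply: (tends_lip (f := amul^~ a) (C := nr a)) => n.
  by rewrite -amulNl -amulDl mulrC nr_amul.
have lM a b : l (a ** b) = l a ** b.
  apply: (tends_uniq (lt _)); under eq_fun do rewrite mleftM.
  exact: tr.
have rM a b : r (a ** b) = a ** r b.
  apply: (tends_uniq (rt _)); under eq_fun do rewrite mrightM.
  exact: tl.
have lr a b : a ** l b = r a ** b.
  apply: (tends_uniq (tl _ _ _ (lt b))); under eq_fun do rewrite mleft_right.
  exact: tr.
exists (Multiplier ll rl lb rb lM rM lr) => e e0.
have [N leN] := le _ (divr_gt0 e0 (ltr0Sn R 1)); exists N => n /leN nN.
apply: le_lt_trans (_ : e / 2 < e); last by rewrite ltr_pdivrMr // ltr_pMr // ltr1n.
apply: opn_le => [|x]; first by rewrite divr_ge0 // ltW.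
exact: nN.
Qed.
HB.instance Definition _ :=
  Uniform_isComplete.Build (multiplier B) multiplier_complete.

Fact mult_normM m n : `|m ** n| <= `|m| * `|n|.
Proof.
rewrite -[`|m|]/((mnr m)%:C%C) -[`|n|]/((mnr n)%:C%C) -rmorphM lecR.
apply: opn_le => [|x]; first by rewrite mulr_ge0 ?mnr_ge0.
rewrite /= (le_trans (mnr_ge _ _)) // -mulrA ler_wpM2l ?mnr_ge0 //.
exact: mnr_ge.
Qed.

Fact mult_cstar m : `|star m ** m| = `|m| ^+ 2.
Proof.
rewrite -[`|m|]/((mnr m)%:C%C) -[LHS]/((mnr (star m ** m))%:C%C) -rmorphXn.
congr (_%:C%C); apply/eqP; rewrite eq_le; apply/andP; split.
  have := mult_normM (star m) m; rewrite -[`|m|]/((mnr m)%:C%C).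
  rewrite -[`|star m|]/((mnr (star m))%:C%C) -rmorphM lecR.
  move/le_trans; apply; rewrite expr2 ler_wpM2r ?mnr_ge0 //; exact: mnr_star.
rewrite -[leRHS]sqr_sqrtr ?mnr_ge0 // lerXn2r ?nnegrE ?mnr_ge0 ?sqrtr_ge0 //.
apply: opn_le => [|x]; first exact: sqrtr_ge0.
rewrite -(ler_pXn2r (n := 2)) ?nnegrE ?nr_ge0 ?mulr_ge0 ?sqrtr_ge0 ?nr_ge0 //.
rewrite exprMn sqr_sqrtr ?mnr_ge0 // -nr_cstar.
have -> : star (mleft m x) ** mleft m x = star x ** mleft (star m ** m) x.
  by rewrite /= -starM -mleft_right starM starK.
apply: le_trans (nr_amul _ _) _; rewrite nr_star mulrC expr2 mulrA.
by rewrite ler_wpM2r ?nr_ge0 // mnr_ge.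
Qed.

HB.instance Definition _ :=
  isCStarAlgebra.Build R (multiplier B) mult_normM mult_cstar.

Lemma nr_emb x : nr (mult_emb B x : multiplier B) = nr x.
Proof.
apply/eqP; rewrite eq_le; apply/andP; split.
  by apply: opn_le => [|y]; [exact: nr_ge0|exact: nr_amul].
have [x0|x0] := eqVneq (nr x) 0; first by rewrite x0 nr_ge0.
have {}x0 : 0 < nr x by rewrite lt_neqAle eq_sym x0 nr_ge0.
have := mnr_ge (mult_emb B x) (star x).
rewrite /= -{1}[x]starK nr_cstar nr_star expr2 ler_pM2r //.
Qed.
End MultiplierNorm.

#[short(type="unitalCstarType")]
HB.structure Definition UnitalCStarAlgebra (R : realType) :=
  {A of hasStarUnit R A & CStarAlgebra R A}.

HB.instance Definition _ (R : realType) (B : cstarType R) :=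
  UnitalStarAlgebra.on (multiplier B).

Section SemiInner.
Variables (R : realType) (V : lmodType R[i]) (s : V -> V -> R[i]).
Hypothesis sDl : forall x y z, s (x + y) z = s x z + s y z.
Hypothesis sZl : forall c x z, s (c *: x) z = c * s x z.
Hypothesis sC : forall x y, s y x = (s x y)^*.
Hypothesis s_ge0 : forall x, 0 <= s x x.

Lemma sip_Dr x y z : s z (x + y) = s z x + s z y.
Proof. by rewrite sC sDl rmorphD /= -!sC. Qed.
Lemma sip_Zr c x z : s z (c *: x) = c^* * s z x.
Proof. by rewrite sC sZl rmorphM /= -sC. Qed.

Definition sq x : R := complex.Re (s x x).

Lemma sqE x : s x x = (sq x)%:C%C.
Proof. exact: complex_ge0_ReE. Qed.

Lemma sq_ge0 x : 0 <= sq x.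
Proof. by rewrite -lecR -sqE. Qed.

(** The form is evaluated at x - t s(x,y) y with t real, so that the cross terms become real; then t
    is optimized. *)
Lemma sip_cauchy_schwarz x y : cabs (s x y) ^+ 2 <= sq x * sq y.
Proof.
set N := _ ^+ 2; have NE : N%:C%C = s x y * (s x y)^*.
  by rewrite -normCK rmorphXn /= -cabsE.
have N0 : 0 <= N by rewrite sqr_ge0.
clearbody N.
have key (t : R) : 0 <= sq x - (t + t) * N + t * t * N * sq y.
  rewrite -lecR; have := s_ge0 (x + (- (t%:C%C * s x y)) *: y).
  rewrite !sDl !sip_Dr !sZl !sip_Zr (sC x y) !sqE rmorphN rmorphM /=.
  rewrite conj_realC.
  rewrite [X in 0 <= X -> _](_ : _ = (sq x - (t + t) * N + t * t * N * sq y)%:C%C) //.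
  by rewrite !(rmorphD, rmorphN, rmorphM) /= NE; ring.
have [y0|y0] := eqVneq (sq y) 0.
  have [->|N1] := eqVneq N 0; first by rewrite y0 mulr0.
  (* For a null vector y the inequality is linear in t, and this t would make its right-hand side
     equal to -1. *)
  have := key ((sq x + 1) / (2 * N)); rewrite y0 mulr0 addr0.
  rewrite (_ : (_ + _) * N = sq x + 1); last by field.
  lra.
have {}y0 : 0 < sq y by rewrite lt_neqAle eq_sym y0 sq_ge0.
have := key (sq y)^-1.
have -> : sq x - ((sq y)^-1 + (sq y)^-1) * N + (sq y)^-1 * (sq y)^-1 * N * sq y =
    sq x - N / sq y.
  by field; rewrite gt_eqF.
by rewrite subr_ge0 ler_pdivrMr.
Qed.
End SemiInner.

Section OperatorAlgebra.
Variables (R : realType) (H : hilbertType R).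
Implicit Types (S T : bounded_operator H) (x y : H).

Lemma inner_ge0 x : 0 <= inner x x.
Proof. by rewrite inner_norm exprn_ge0. Qed.

Lemma inner_nr x : inner x x = (nr x ^+ 2)%:C%C.
Proof. by rewrite inner_norm nrE rmorphXn. Qed.

Lemma cauchy_schwarz x y : cabs (inner x y) <= nr x * nr y.
Proof.
have := sip_cauchy_schwarz (@innerDl R H) (@innerZl R H) (@innerC R H) inner_ge0 x y.
rewrite /sq !inner_nr /= -exprMn => h.
rewrite -(ler_pXn2r (n := 2)) // nnegrE ?mulr_ge0 ?nr_ge0 //.
exact: cabs_ge0.
Qed.

Definition bnr S := opn (op S).

Lemma bnr_ge S x : nr (S x) <= bnr S * nr x.
Proof. by apply: opn_ge; [exact: op_linear|exact: op_bounded]. Qed.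

Lemma bnr_ge0 S : 0 <= bnr S.
Proof. exact/opn_ge0/op_bounded. Qed.

Lemma nr_inner_self x (c : R) : cabs (inner x x) <= c * nr x -> 0 <= c ->
  nr x <= c.
Proof.
rewrite inner_nr cabs_real ger0_norm ?sqr_ge0 //.
have [->//|x0] := eqVneq (nr x) 0.
by rewrite expr2 ler_pM2r // lt_neqAle eq_sym x0 nr_ge0.
Qed.

Lemma adj_ge S x : nr (op_adj S x) <= bnr S * nr x.
Proof.
apply: nr_inner_self; last by rewrite mulr_ge0 ?bnr_ge0 ?nr_ge0.
rewrite -op_adjE (le_trans (cauchy_schwarz _ _)) //.
by rewrite mulrAC ler_wpM2r ?nr_ge0 // bnr_ge.
Qed.

Lemma bnr_star S : bnr (star S) <= bnr S.
Proof. by apply: opn_le; [exact: bnr_ge0|exact: adj_ge]. Qed.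

Definition bop_norm S : R[i] := (bnr S)%:C%C.

Fact bop_normD S T : bop_norm (S + T) <= bop_norm S + bop_norm T.
Proof.
rewrite -rmorphD lecR; apply: opnD; by [exact: op_linear|exact: op_bounded].
Qed.

Fact bop_normZ (c : R[i]) S : bop_norm (c *: S) = `|c| * bop_norm S.
Proof.
rewrite cabsE -rmorphM; congr (_%:C%C).
by rewrite -opnZ; [|exact: op_linear|exact: op_bounded].
Qed.

Fact bop_norm0_eq0 S : bop_norm S = 0 -> S = 0.
Proof.
move=> /realC_inj S0; apply: bounded_operatorP.
by apply: opn_eq0 S0; [exact: op_linear|exact: op_bounded].
Qed.

HB.instance Definition _ := Lmodule_isNormed.Build R[i] (bounded_operator H)
  bop_normD bop_normZ bop_norm0_eq0.

Lemma nr_bopE S : nr S = bnr S. Proof. by []. Qed.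

Lemma tends_inner (u v : nat -> H) x y : tends u x -> tends v y ->
  tends (fun n => inner (u n) (v n) : R[i]^o) (inner x y).
Proof.
move=> ux vy; have [N [M vM]] := tends_bounded vy.
have h : null (fun n => M%:R * nr (u n - x) + nr x * nr (v n - y)).
  by apply: nullD; apply: nullZ => // n; exact: nr_ge0.
move=> e /h[K hK]; exists (maxn N K) => n; rewrite geq_max => /andP[/vM vn /hK].
apply: le_lt_trans.
have -> : inner (u n) (v n) - inner x y = inner (u n - x) (v n) + inner x (v n - y).
  rewrite innerDl innerDr innerNl innerNr; ring.
apply: le_trans (nr_triangle (_ : R[i]^o) _) _; rewrite lerD //.
  apply: le_trans (cauchy_schwarz _ _) _.
  by rewrite mulrC ler_wpM2r ?nr_ge0.
exact: cauchy_schwarz.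
Qed.

Lemma bop_complete (F : set_system (bounded_operator H)) :
  ProperFilter F -> cauchy F -> cvg F.
Proof.
apply: seq_complete => u uc.
have cu e : 0 < e -> exists N, forall n m : nat, (N <= n)%N -> (N <= m)%N ->
    forall x, nr (u n x - u m x) <= e * nr x.
  move=> e0; have [N uN] := uc e e0; exists N => n m nN mN x.
  have := bnr_ge (u n - u m) x; move/le_trans; apply.
  by rewrite ler_wpM2r ?nr_ge0 // ltW // -nr_bopE uN.
have cr e : 0 < e -> exists N, forall n m : nat, (N <= n)%N -> (N <= m)%N ->
    forall x, nr (op_adj (u n) x - op_adj (u m) x) <= e * nr x.
  move=> e0; have [N uN] := uc e e0; exists N => n m nN mN x.
  have := adj_ge (u n - u m) x; move/le_trans; apply.
  by rewrite ler_wpM2r ?nr_ge0 // ltW // -nr_bopE uN.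
have [l [ll lb lt le]] := op_limit (fun n => op_linear (u n))
  (fun n => op_bounded (u n)) cu.
have [r [rl rb rt re]] := op_limit (fun n => op_adj_linear (u n))
  (fun n => op_adj_bounded (u n)) cr.
have lr x y : inner (l x) y = inner x (r y).
  apply: (tends_uniq (tends_inner (lt x) (tends_cst y))).
  by under eq_fun do rewrite op_adjE; exact: tends_inner (tends_cst x) (rt y).
exists (BoundedOperator ll rl lb rb lr) => e e0.
have [N leN] := le _ (divr_gt0 e0 (ltr0Sn R 1)); exists N => n /leN nN.
apply: le_lt_trans (_ : e / 2 < e); last by rewrite ltr_pdivrMr // ltr_pMr // ltr1n.
apply: opn_le => [|x]; first by rewrite divr_ge0 // ltW.
exact: nN.
Qed.
HB.instance Definition _ :=
  Uniform_isComplete.Build (bounded_operator H) bop_complete.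

Fact bop_normM S T : `|S ** T| <= `|S| * `|T|.
Proof.
rewrite -[`|S|]/((bnr S)%:C%C) -[`|T|]/((bnr T)%:C%C) -rmorphM lecR.
apply: opn_le => [|x]; first by rewrite mulr_ge0 ?bnr_ge0.
rewrite /= (le_trans (bnr_ge _ _)) // -mulrA ler_wpM2l ?bnr_ge0 //.
exact: bnr_ge.
Qed.

Fact bop_cstar S : `|star S ** S| = `|S| ^+ 2.
Proof.
rewrite -[`|S|]/((bnr S)%:C%C) -[LHS]/((bnr (star S ** S))%:C%C) -rmorphXn.
congr (_%:C%C); apply/eqP; rewrite eq_le; apply/andP; split.
  have := bop_normM (star S) S; rewrite -[`|S|]/((bnr S)%:C%C).
  rewrite -[`|star S|]/((bnr (star S))%:C%C) -rmorphM lecR.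
  move/le_trans; apply; rewrite expr2 ler_wpM2r ?bnr_ge0 //; exact: bnr_star.
rewrite -[leRHS]sqr_sqrtr ?bnr_ge0 // lerXn2r ?nnegrE ?bnr_ge0 ?sqrtr_ge0 //.
apply: opn_le => [|x]; first exact: sqrtr_ge0.
rewrite -(ler_pXn2r (n := 2)) ?nnegrE ?nr_ge0 ?mulr_ge0 ?sqrtr_ge0 ?nr_ge0 //.
rewrite exprMn sqr_sqrtr ?bnr_ge0 //.
have -> : nr (S x) ^+ 2 = cabs (inner x ((star S ** S) x)).
  by rewrite /= -op_adjE inner_nr cabs_real ger0_norm ?sqr_ge0.
apply: le_trans (cauchy_schwarz _ _) _; rewrite mulrC expr2 mulrA.
by rewrite ler_wpM2r ?nr_ge0 // bnr_ge.
Qed.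

HB.instance Definition _ :=
  isCStarAlgebra.Build R (bounded_operator H) bop_normM bop_cstar.
End OperatorAlgebra.

HB.instance Definition _ (R : realType) (H : hilbertType R) :=
  UnitalStarAlgebra.on (bounded_operator H).

(** * Linear identities by comparison of coefficients *)

Section LinearReflection.
Variables (K : pzRingType) (V : lmodType K).

Inductive lexp := LVar of nat | LZero | LAdd of lexp & lexp | LOpp of lexp
  | LScale of K & lexp.

Fixpoint leval (xs : seq V) (e : lexp) : V :=
  match e with
  | LVar n => nth 0 xs n
  | LZero => 0
  | LAdd a b => leval xs a + leval xs b
  | LOpp a => - leval xs a
  | LScale c a => c *: leval xs a
  end.

Fixpoint lcoef (i : nat) (e : lexp) : K :=
  match e with
  | LVar n => if eqn n i then 1 else 0
  | LZero => 0
  | LAdd a b => lcoef i a + lcoef i b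
  | LOpp a => - lcoef i a
  | LScale c a => c * lcoef i a
  end.

(** A conjunction computed from the number of atoms: after [cbn], splitting leaves one [ring] goal
    per atom. *)
Fixpoint lcoef_eq (a b : lexp) (n : nat) : Prop :=
  if n is m.+1 then lcoef m a = lcoef m b /\ lcoef_eq a b m else True.

Lemma leval_coef xs e : leval xs e = \sum_(i < size xs) lcoef i e *: nth 0 xs i.
Proof.
elim: e => [n||a IHa b IHb|a IHa|c a IHa] /=; rewrite ?IHa ?IHb.
- have [nxs|xsn] := ltnP n (size xs); last first.
    rewrite nth_default // big1 // => i _.
    case: eqnP => [ni|_]; last by rewrite scale0r.
    by move: (ltn_ord i); rewrite -ni ltnNge xsn.
  rewrite (bigD1 (Ordinal nxs)) //= -[eqn n n]/(n == n) eqxx scale1r big1 ?addr0 //.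
  move=> i ni; case: eqnP => [ni'|_]; last by rewrite scale0r.
  by case/eqP: ni; apply: val_inj.
- by rewrite big1 // => i _; rewrite scale0r.
- by rewrite -big_split; apply: eq_bigr => i _; rewrite scalerDl.
- by rewrite -sumrN; apply: eq_bigr => i _; rewrite scaleNr.
by rewrite scaler_sumr; apply: eq_bigr => i _; rewrite scalerA.
Qed.

Lemma leval_eq xs a b : lcoef_eq a b (size xs) -> leval xs a = leval xs b.
Proof.
rewrite !leval_coef => ab; apply: eq_bigr => i _; congr (_ *: _).
move: (nat_of_ord i) (ltn_ord i) => {i}.
elim: (size xs) ab => //= n IH [abn /IH{}IH] i; rewrite ltnS leq_eqVlt.
by case/orP => [/eqP->|/IH].
Qed.
End LinearReflection.

(* Products are compared argument by argument: the same product may carry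
   different, convertible, structure instances. *)
Ltac lm_same x y :=
  first [ constr_eq x y
        | lazymatch x with
          | @amul _ _ ?a ?b =>
            lazymatch y with @amul _ _ ?c ?d => lm_same a c; lm_same b d end
          | @star _ _ ?a =>
            lazymatch y with @star _ _ ?c => lm_same a c end
          | @aone _ _ => lazymatch y with @aone _ _ => idtac end
          end ].
Ltac lm_index x l :=
  match l with
  | ?y :: _ => let _ := match goal with _ => lm_same x y end in constr:(O)
  | _ :: ?l' => let n := lm_index x l' in constr:(S n)
  end.
Ltac lm_mem x l :=
  match l with
  | nil => constr:(false)
  | ?y :: _ => let _ := match goal with _ => lm_same x y end in constr:(true)
  | _ :: ?l' => lm_mem x l'
  end.
Ltac lm_atoms e l :=
  lazymatch e with
  | (?a + ?b)%R => let l' := lm_atoms a l in lm_atoms b l'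
  | (- ?a)%R => lm_atoms a l
  | (_ *: ?a)%R => lm_atoms a l
  | 0%R => l
  | _ => lazymatch lm_mem e l with true => l | false => constr:(e :: l) end
  end.
Ltac lm_reify K e l :=
  lazymatch e with
  | (?a + ?b)%R => let a' := lm_reify K a l in let b' := lm_reify K b l in
      constr:(@LAdd K a' b')
  | (- ?a)%R => let a' := lm_reify K a l in constr:(@LOpp K a')
  | (?c *: ?a)%R => let a' := lm_reify K a l in constr:(@LScale K c a')
  | 0%R => constr:(@LZero K)
  | _ => let n := lm_index e l in constr:(@LVar K n)
  end.
Ltac lmod_with K :=
  lazymatch goal with
  | |- @eq ?T ?a ?b =>
    let l := lm_atoms a (@nil T) in let l := lm_atoms b l in
    let a' := lm_reify K a l in let b' := lm_reify K b l in
    refine (@leval_eq K _ l a' b' _);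
    cbn [lcoef_eq lcoef size eqn]; repeat split; try ring
  end.

Section PositivityPrelim.
Variable R : realType.

Lemma cabs_half : cabs (2^-1 : R[i]) = 2^-1.
Proof.
have : cabs (2 * 2^-1 : R[i]) = 1 by rewrite mulfV ?cabs1 // pnatr_eq0.
rewrite cabsM => h; have -> : (2^-1 : R) = 2^-1 * (cabs (2 : R[i]) * cabs 2^-1).
  by rewrite h mulr1.
have -> : (2 : R[i]) = (2 : R)%:C%C by rewrite rmorph_nat.
by rewrite cabs_real ger0_norm // mulKf // pnatr_eq0.
Qed.

(** An opaque-looking atom for [ring], which is given [icic] as an additional equation. *)
Definition ic : R[i] := ('i)%C.

Lemma icic : ic * ic = -1.
Proof. by rewrite -expr2 sqr_i. Qed.

Lemma ic_conj : ic^* = - ic.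
Proof. by apply/eqP; rewrite eq_complex /= oppr0 !eqxx. Qed.

Lemma half_conj : (2^-1 : R[i])^* = 2^-1.
Proof. by rewrite rmorphV ?unitfE ?pnatr_eq0 //= rmorph_nat. Qed.

Lemma half2 : (2^-1 : R[i]) + 2^-1 = 1.
Proof. by field. Qed.
End PositivityPrelim.
Arguments ic {R}.

Ltac nc_expand := rewrite ?(amulDl, amulDr, amulNl, amulNr, amulZl, amulZr,
  amul0l, amul0r, amul1l, amul1r, amulA).
(* [lmod] decides the linear identities over [R[i]], by comparing coefficients. *)
Ltac lmod := match goal with |- @eq ?T _ _ =>
  match goal with R : realType |- _ => lmod_with (R[i] : pzRingType) end end.
Ltac nc := nc_expand; lmod.

(** * Square roots by iteration *)

Section QuasiSqrt.
Variables (R : realType) (B : cstarType R).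
Implicit Types x y z k : B.

Lemma tendsM (u v : nat -> B) x y : tends u x -> tends v y ->
  tends (fun n => u n ** v n) (x ** y).
Proof.
move=> ux vy; have [N [M vM]] := tends_bounded vy.
have h : null (fun n => M%:R * nr (u n - x) + nr x * nr (v n - y)).
  by apply: nullD; apply: nullZ => // n; exact: nr_ge0.
move=> e /h[K hK]; exists (maxn N K) => n; rewrite geq_max => /andP[/vM vn /hK].
apply: le_lt_trans.
have -> : u n ** v n - x ** y = (u n - x) ** v n + x ** (v n - y) by nc.
apply: le_trans (nr_triangle _ _) _; rewrite lerD ?nr_amul //.
by apply: le_trans (nr_amul _ _) _; rewrite mulrC ler_wpM2r ?nr_ge0.
Qed.

Lemma tends_star (u : nat -> B) x : tends u x ->
  tends (fun n => star (u n)) (star x).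
Proof.
by apply: (tends_lip (C := 1)) => n; rewrite mul1r -starN -starD nr_star.
Qed.

Fixpoint qs z n : B :=
  if n is m.+1 then 2^-1 *: (z + qs z m ** qs z m) else 0.

Fixpoint kap n : R := if n is m.+1 then 2^-1 * (1 + kap m * kap m) else 0.

Lemma kap01 n : 0 <= kap n <= 1.
Proof. by elim: n => [|n /andP[IH0 IH1]] /=; nra. Qed.

Lemma kap_homo : {homo kap : n m / (n <= m)%N >-> n <= m}.
Proof.
apply: homo_leq => //; first exact: le_trans.
by move=> n /=; have := kap01 n; nra.
Qed.

Lemma nr_qs z n : nr z <= 1 -> nr (qs z n) <= kap n.
Proof.
move=> z1; elim: n => [|n IH] /=; first by rewrite nr0.
rewrite nrZC cabs_half ler_pM2l ?invr_gt0 // (le_trans (nr_triangle _ _)) //.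
rewrite lerD // (le_trans (nr_amul _ _)) // ler_pM ?nr_ge0 //.
Qed.

(** By a^2 - b^2 = a (a - b) + (a - b) b and the bounds of [nr_qs], the distances obey the recursion
    satisfied by the differences of [kap]. *)
Lemma qs_dist z n d : nr z <= 1 ->
  nr (qs z (n + d) - qs z n) <= kap (n + d) - kap n.
Proof.
move=> z1; elim: n => [|n IH] /=; first by rewrite !subr0 nr_qs.
rewrite -scalerBr nrZC cabs_half.
have -> : z + qs z (n + d) ** qs z (n + d) - (z + qs z n ** qs z n) =
  qs z (n + d) ** (qs z (n + d) - qs z n) + (qs z (n + d) - qs z n) ** qs z n.
  by nc.
have h1 := nr_qs (n + d) z1; have h2 := nr_qs n z1.
set a := qs z (n + d) in IH h1 *; set b := qs z n in IH h2 *.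
have h3 := nr_triangle (a ** (a - b)) ((a - b) ** b).
have h4 := nr_amul a (a - b); have h5 := nr_amul (a - b) b.
have h6 := nr_ge0 a; have h7 := nr_ge0 b; have h8 := nr_ge0 (a - b).
nra.
Qed.

(* The fixed point of [k |-> (z + k^2) / 2] is [1 - sqrt (1 - z)]; the scalar
   iteration started from [z = 1] dominates the increments. *)
Lemma quasi_sqrt z : nr z <= 1 -> exists k, [/\ nr k <= 1, k + k - k ** k = z,
  star z = z -> star k = k & forall x, x ** z = z ** x -> x ** k = k ** x].
Proof.
move=> z1.
have kc : cvgn kap.
  apply: nondecreasing_is_cvgn; first exact: kap_homo.
  by exists 1 => _ [n _ <-]; have /andP[] := kap01 n.
have [|k qk] := @tends_cauchy R B (qs z).
  move=> e e0; have e2 : 0 < e / 2 by rewrite divr_gt0.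
  have /cvgrPdist_lt/(_ _ e2)[N _ kN] := kc.
  have near0 n : (N <= n)%N -> nr (qs z n - qs z N) < e / 2.
    move=> /subnKC <-; apply: le_lt_trans (qs_dist _ _ z1) _.
    have lim_ge m : kap m <= limn kap by exact: nondecreasing_cvgn_le kap_homo kc m.
    have := kN N (leqnn N); have := lim_ge N; have := lim_ge (N + (n - N))%N.
    by move=> ? ?; rewrite /= ger0_norm ?subr_ge0 //; lra.
  exists N => n m /near0 nN /near0 mN; apply: le_lt_trans (nr_dist _ (qs z N) _) _.
  by rewrite (nrB (qs z N)) [e]splitr ltrD.
have qk' : tends (fun n => qs z n.+1) k.
  by move=> e /qk[N qN]; exists N => n nN; apply: qN; exact: leqW.
have kE : k = 2^-1 *: (z + k ** k).
  apply: (tends_uniq qk'); apply: tendsZ; apply: tendsD; first exact: tends_cst.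
  exact: tendsM.
exists k; split.
- apply: tends_nr qk => n; apply: le_trans (nr_qs n z1) _.
  by have /andP[] := kap01 n.
- have k2 : k + k = z + k ** k by rewrite {1 2}kE -scalerDl half2 scale1r.
  by rewrite k2 addrK.
- move=> zs; apply: (tends_uniq (tends_star qk)).
  rewrite (_ : (fun n => _) = qs z) //; apply/funext; elim=> [|n IH] /=.
    by rewrite star0.
  by rewrite starZ half_conj starD starM zs IH.
move=> x xz; have qx n : x ** qs z n = qs z n ** x.
  elim: n => [|n IH] /=; first by rewrite amul0l amul0r.
  by rewrite amulZl amulZr amulDr amulDl xz amulA IH -!amulA IH.
apply: (tends_uniq (tendsM (tends_cst x) qk)).
by under eq_fun do rewrite qx; exact: tendsM qk (tends_cst x).
Qed.
End QuasiSqrt.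

(** * Positive elements *)

Section Positivity.
Variables (R : realType) (E : unitalCstarType R).
Implicit Types (x y z h k a b : E) (t : R).

Definition rs t : E := t%:C%C *: aone.

(* Positivity without spectral theory: [h] is the square of a self-adjoint element. *)
Definition pos h := exists k, star k = k /\ h = k ** k.

Lemma nr1_le : nr (aone : E) <= 1.
Proof.
have := nr_cstar (aone : E); rewrite (_ : star (aone : E) = aone); last first.
  by rewrite -[LHS]amul1l -[X in X ** _]starK -starM amul1l starK.
rewrite amul1l expr2 => h; have := nr_ge0 (aone : E); rewrite le_eqVlt.
case/orP=> [/eqP<-|n0]; first exact: ler01.
by move: h; rewrite -{1}[nr _]mulr1 => /(mulfI (negbT (gt_eqF n0)))<-.
Qed.

Lemma star1 : star (aone : E) = aone.
Proof. by rewrite -[LHS]amul1l -[X in X ** _]starK -starM amul1l starK. Qed.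

Lemma starB x y : star (x - y) = star x - star y.
Proof. by rewrite starD starN. Qed.

Lemma star_rs t : star (rs t) = rs t.
Proof. by rewrite starZ conj_realC star1. Qed.

Lemma nr_rs t : 0 <= t -> nr (rs t) <= t.
Proof.
by move=> t0; rewrite nrZ ger0_norm // -[leRHS]mulr1 ler_wpM2l ?nr1_le.
Qed.

Lemma rs_comm t x : rs t ** x = x ** rs t.
Proof. by rewrite /rs amulZl amulZr amul1l amul1r. Qed.

Lemma sqr_star x : star x = x -> nr (x ** x) = nr x ^+ 2.
Proof. by move=> xs; rewrite -nr_cstar xs. Qed.

Lemma sqr_eq0 x : star x = x -> x ** x = 0 -> x = 0.
Proof. by move=> xs xx; apply: amul_star_eq0; rewrite xs. Qed.

Lemma star_mul_comm x y : star x = x -> star y = y -> x ** y = y ** x ->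
  star (x ** y) = x ** y.
Proof. by move=> xs ys xy; rewrite starM xs ys -xy. Qed.

(** For commuting x and y, the element u = x + i y has u^* u = x^2 + y^2, and its real part x has
    norm at most |u|. *)
Lemma nr_sqr_le x y : star x = x -> star y = y -> x ** y = y ** x ->
  nr (x ** x) <= nr (x ** x + y ** y).
Proof.
move=> xs ys xy; pose u := x + ic *: y.
have us : star u = x - ic *: y by rewrite starD starZ ic_conj xs ys scaleNr.
have -> : x ** x + y ** y = star u ** u.
  by rewrite us /u; nc_expand; rewrite xy; lmod; ring: (@icic R).
rewrite nr_cstar sqr_star // lerXn2r ?nnegrE ?nr_ge0 //.
have -> : x = 2^-1 *: (u + star u) by rewrite us /u; lmod; field.
rewrite nrZC cabs_half mulrC ler_pdivrMr // (le_trans (nr_triangle _ _)) //.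
by rewrite nr_star; lra.
Qed.

Lemma pos_star h : pos h -> star h = h.
Proof. by case=> k [ks ->]; rewrite starM ks. Qed.

Lemma pos0 : pos 0.
Proof. by exists 0; rewrite star0 amul0l. Qed.

Lemma pos_sqr k : star k = k -> pos (k ** k).
Proof. by move=> ks; exists k. Qed.

(** Here 1 - k^2 = (1 - m)^2 with m commuting with k, so that [nr_sqr_le] compares it with (1 - m)^2
    + k^2 = 1. *)
Lemma nr_1subsqr k : star k = k -> nr k <= 1 -> nr (aone - k ** k) <= 1.
Proof.
move=> ks k1; have [|m [m1 mE ms mc]] := @quasi_sqrt R E (k ** k).
  by rewrite sqr_star // expr2 mulr_ile1 ?nr_ge0.
have {}ms : star m = m by apply: ms; rewrite starM ks.
have mk : k ** m = m ** k by apply: mc; rewrite amulA.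
have E1 : aone - k ** k = (aone - m) ** (aone - m).
  by rewrite -mE; nc.
rewrite E1; apply: le_trans nr1_le.
have := @nr_sqr_le (aone - m) k; rewrite -E1 subrK; apply => //.
  by rewrite starB star1 ms.
by nc_expand; rewrite mk; lmod.
Qed.

(** With its converse [ball_pos], this turns positivity into membership in a ball, a condition that
    visibly survives sums; being a square does not. *)
Lemma pos_ball h t : pos h -> nr h <= t -> nr (rs t - h) <= t.
Proof.
case=> k [ks ->] kt; have t0 := le_trans (nr_ge0 _) kt.
have [t00|tn0] := eqVneq t 0.
  have -> : k ** k = 0 by apply: nr_le0; rewrite -t00.
  by rewrite subr0; exact: nr_rs.
have {}t0 : 0 < t by rewrite lt_neqAle eq_sym tn0.
pose s := Num.sqrt t; have s0 : 0 < s by rewrite sqrtr_gt0.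
have ss : s ^+ 2 = t by rewrite sqr_sqrtr ?ltW.
have := @nr_1subsqr ((s^-1)%:C%C *: k).
rewrite starZ ks conj_realC => /(_ erefl).
have si0 : 0 <= s^-1 by rewrite invr_ge0 ltW.
have k1 : nr ((s^-1)%:C%C *: k) <= 1.
  rewrite nrZ ger0_norm // mulrC ler_pdivrMr // mul1r.
  rewrite -(ler_pXn2r (n := 2)) ?nnegrE ?nr_ge0 ?(ltW s0) // ss.
  by rewrite -sqr_star.
move=> /(_ k1) h1.
have -> : rs t - k ** k =
    t%:C%C *: (aone - ((s^-1)%:C%C *: k) ** ((s^-1)%:C%C *: k)).
  rewrite amulZl amulZr scalerBr !scalerA -!rmorphM.
  rewrite (_ : t * (s^-1 * s^-1) = 1) ?scale1r // -ss; field.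
  by rewrite gt_eqF.
by rewrite nrZ gtr0_norm // -[leRHS]mulr1 ler_pM2l.
Qed.

(** The element z = 1 - h/t has norm at most 1, and [quasi_sqrt] supplies k with (1 - k)^2 = 1 - z =
    h/t; the root is sqrt(t) (1 - k). The ball condition on the root makes it positive in turn. *)
Lemma ball_sqrt h t : star h = h -> 0 <= t -> nr (rs t - h) <= t ->
  exists r, [/\ star r = r, h = r ** r, nr (rs (Num.sqrt t) - r) <= Num.sqrt t
    & forall x, x ** h = h ** x -> x ** r = r ** x].
Proof.
move=> hs; rewrite le_eqVlt => /orP[/eqP<-|t0] ht.
  exists 0; rewrite star0 amul0l sqrtr0; split=> //.
  - by apply: nr_le0; move: ht; rewrite nrB /rs scale0r subr0.
  - by rewrite /rs scale0r subr0 nr0.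
  - by move=> x _; rewrite amul0l amul0r.
pose s := Num.sqrt t; have s0 : 0 < s by rewrite sqrtr_gt0.
have ss : s * s = t by rewrite -expr2 sqr_sqrtr ?ltW.
pose z : E := (t^-1)%:C%C *: (rs t - h).
have [|k [k1 kE ks kc]] := @quasi_sqrt R E z.
  rewrite nrZ ger0_norm ?invr_ge0 ?(ltW t0) // mulrC ler_pdivrMr //.
  by rewrite mul1r.
have {}ks : star k = k by apply: ks; rewrite starZ conj_realC starB star_rs hs.
exists (s%:C%C *: (aone - k)); split.
- by rewrite starZ conj_realC starB star1 ks.
- have E1 : (aone - k) ** (aone - k) = aone - z by rewrite -kE; nc.
  rewrite amulZl amulZr scalerA -rmorphM ss E1 /z scalerBr scalerA -rmorphM.
  by rewrite divff ?gt_eqF // scale1r /rs opprB addrC subrK.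
- rewrite /rs -scalerBr opprB addrC subrK nrZ ger0_norm ?(ltW s0) //.
  by rewrite -[leRHS]mulr1 ler_pM2l.
move=> x xh; have := kc x; rewrite /z amulZl amulZr amulDl amulDr amulNl amulNr.
rewrite xh rs_comm => /(_ erefl) xk.
by rewrite amulZl amulZr amulDl amulDr amulNl amulNr amul1l amul1r xk.
Qed.

Lemma ball_pos h t : star h = h -> 0 <= t -> nr (rs t - h) <= t -> pos h.
Proof. by move=> hs t0 /(ball_sqrt hs t0)[r [rs_ -> _ _]]; exists r. Qed.

Lemma pos_sqrt h : pos h -> exists r, [/\ star r = r, h = r ** r, pos r
  & forall x, x ** h = h ** x -> x ** r = r ** x].
Proof.
move=> ph; have [r [rstar hr rb rc]] := ball_sqrt (pos_star ph) (nr_ge0 h)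
  (pos_ball ph (lexx _)).
by exists r; split=> //; apply: ball_pos rb => //; exact: sqrtr_ge0.
Qed.

Lemma pos_add h k : pos h -> pos k -> pos (h + k).
Proof.
move=> ph pk; apply: (ball_pos (t := nr h + nr k)).
- by rewrite starD !pos_star.
- by rewrite addr_ge0 ?nr_ge0.
rewrite (_ : rs _ - _ = (rs (nr h) - h) + (rs (nr k) - k)); last first.
  by rewrite /rs rmorphD /=; lmod.
by rewrite (le_trans (nr_triangle _ _)) // lerD // pos_ball.
Qed.

Lemma pos_scale t h : 0 <= t -> pos h -> pos (t%:C%C *: h).
Proof.
move=> t0 [k [ks ->]]; exists ((Num.sqrt t)%:C%C *: k).
rewrite starZ conj_realC ks amulZl amulZr scalerA -rmorphM -expr2.
by rewrite sqr_sqrtr.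
Qed.

Lemma pos1 : pos aone.
Proof. by exists aone; rewrite star1 amul1l. Qed.

Lemma pos_rs t : 0 <= t -> pos (rs t).
Proof. by move=> t0; apply: pos_scale => //; exact: pos1. Qed.

Lemma pos_sub t h : star h = h -> nr h <= t -> pos (rs t - h).
Proof.
move=> hs ht; apply: (ball_pos (t := t)).
- by rewrite starB star_rs hs.
- exact: le_trans (nr_ge0 _) ht.
by rewrite opprB addrC subrK.
Qed.

(** The roots of a and t - a commute because each commutes with all that its square commutes with;
    then [nr_sqr_le] applies to two squares with sum t. *)
Lemma pos_nr_le a t : pos a -> pos (rs t - a) -> 0 <= t -> nr a <= t.
Proof.
move=> pa pb t0; have [x [xs aE _ xc]] := pos_sqrt pa.
have [y [ys bE _ yc]] := pos_sqrt pb.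
have xa : x ** a = a ** x by rewrite aE amulA.
have xy : x ** y = y ** x.
  by apply: yc; rewrite amulDr amulDl amulNr amulNl xa rs_comm.
rewrite aE; apply: le_trans (nr_sqr_le xs ys xy) _.
by rewrite -aE -bE addrC subrK nr_rs.
Qed.

Lemma nr_mono a b : pos a -> pos b -> nr a <= nr (a + b).
Proof.
move=> pa pb; apply: pos_nr_le => //; last exact: nr_ge0.
rewrite (_ : _ - a = (rs (nr (a + b)) - (a + b)) + b); last by lmod.
by apply: pos_add => //; apply: pos_sub => //; rewrite starD !pos_star.
Qed.

Lemma pos_antisym h : pos h -> pos (- h) -> h = 0.
Proof. by move=> ph pn; apply: nr_le0; have := nr_mono ph pn; rewrite subrr nr0. Qed.

Fixpoint apow x n : E := if n is m.+1 then x ** apow x m else aone.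

Lemma apowD x m n : apow x (m + n) = apow x m ** apow x n.
Proof. by elim: m => [|m IH] /=; rewrite ?amul1l // IH amulA. Qed.

Lemma apow_comm x y n : x ** y = y ** x -> x ** apow y n = apow y n ** x.
Proof.
by move=> xy; elim: n => [|n IH] /=; rewrite ?amul1l ?amul1r // amulA xy -!amulA IH.
Qed.

Lemma apow_star x n : star x = x -> star (apow x n) = apow x n.
Proof.
move=> xs; elim: n => [|n IH] /=; first exact: star1.
by rewrite starM IH xs -apow_comm.
Qed.

Lemma nr_apow x n : nr (apow x n) <= nr x ^+ n.
Proof.
elim: n => [|n IH] /=; first exact: nr1_le.
by rewrite exprS (le_trans (nr_amul _ _)) // ler_wpM2l ?nr_ge0.
Qed.

Lemma nr_apow2 x m : star x = x -> nr (apow x (2 ^ m)) = nr x ^+ (2 ^ m).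
Proof.
move=> xs; elim: m => [|m IH]; first by rewrite /= amul1r.
rewrite expnS mul2n -addnn apowD sqr_star ?apow_star // IH -exprM.
by rewrite muln2 addnn.
Qed.

(* With [t = |y|^2] and [d = t - y^* y], pulling [y] through the powers of
   [t - y y^*] bounds [d^n] by [(n + 1) t^n], hence [|d| <= t]. *)
Lemma sqr_neg_eq0 y q : star q = q -> pos (y ** star y) ->
  star y ** y = - (q ** q) -> q ** q = 0.
Proof.
move=> qs py yq; set t := nr y ^+ 2.
have nyy : nr (y ** star y) = t by rewrite -{1}[y]starK nr_cstar nr_star.
have t0 : 0 <= t by rewrite sqr_ge0.
pose s := rs t - y ** star y; pose d := rs t - star y ** y.
have sn : nr s <= t by apply: pos_ball => //; rewrite nyy.
have dyy : d = rs t + q ** q by rewrite /d yq opprK.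
have sy : s ** y = y ** d by rewrite /s /d /rs; nc.
have sny n : apow s n ** y = y ** apow d n.
  elim: n => [|n IH] /=; first by rewrite amul1l amul1r.
  by rewrite -amulA IH amulA sy amulA.
have dn n : nr (apow d n) <= n.+1%:R * t ^+ n.
  elim: n => [|n IH]; first by rewrite /= expr0 mulr1 nr1_le.
  have -> : apow d n.+1 = t%:C%C *: apow d n - star y ** (apow s n ** y).
    by rewrite sny /= {1}/d /rs; nc.
  have h1 := nr_triangleB (t%:C%C *: apow d n) (star y ** (apow s n ** y)).
  apply: le_trans h1 _; rewrite nrZ ger0_norm //.
  have h2 : nr (star y ** (apow s n ** y)) <= t ^+ n.+1.
    apply: le_trans (nr_amul _ _) _; rewrite nr_star.
    rewrite (_ : t ^+ n.+1 = nr y * (t ^+ n * nr y)); last by rewrite exprS /t; ring.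
    rewrite ler_wpM2l ?nr_ge0 // (le_trans (nr_amul _ _)) // ler_wpM2r ?nr_ge0 //.
    by rewrite (le_trans (nr_apow _ _)) // lerXn2r ?nnegrE ?nr_ge0.
  apply: le_trans (lerD _ h2) _; first by apply: ler_wpM2l IH.
  by rewrite -[n.+2%:R]natr1 exprS; lra.
have dt : nr d <= t.
  apply: (root_bound (K := 1)); rewrite ?nr_ge0 // => m.
  rewrite -nr_apow2; first by rewrite mul1r; exact: dn.
  by rewrite /d starB star_rs starM starK.
(* The bound on d = t + q^2 places -q^2 in the ball that characterizes positivity, so both q^2 and
   -q^2 are positive. *)
apply: pos_antisym; first exact: pos_sqr.
apply: (ball_pos (t := t)) => //; first by rewrite starN starM qs.
by rewrite opprK -dyy.
Qed.

Lemma re_im x : exists a b, [/\ star a = a, star b = b & x = a + ic *: b].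
Proof.
exists (2^-1 *: (x + star x)), (- (2^-1 * ic) *: (x - star x)); split.
- by rewrite starZ half_conj starD starK addrC.
- rewrite starZ rmorphN rmorphM /= half_conj ic_conj starB starK.
  by lmod.
by lmod; field: (@icic R).
Qed.

(** Let w be the root of h^2, so that v = w - h is twice the negative part of h = x^* x, and let r
    be the root of w. For y = x v one gets y^* y = v h v = -(r v)^2, while y y^* is positive. Then
    [sqr_neg_eq0] forces r v = 0, hence v = 0 and h = w. *)
Lemma pos_starM x : pos (star x ** x).
Proof.
have [h hE] : exists h, h = star x ** x by exists (star x ** x).
rewrite -hE; have hs : star h = h by rewrite hE starM starK.
have [w [ws wE pw wc]] := pos_sqrt (pos_sqr hs).
have hw : h ** w = w ** h by apply: wc; rewrite amulA.
have [r [rstar rE _ rc]] := pos_sqrt pw.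
have hr := rc _ hw; have wr : w ** r = r ** w by rewrite rE amulA.
pose v := w - h; have vs : star v = v by rewrite /v starB ws hs.
have rv : r ** v = v ** r by rewrite /v; nc_expand; rewrite wr hr.
pose y := x ** v; pose q := r ** v.
have qs : star q = q by exact: star_mul_comm.
have hv : h ** v = - (w ** v) by rewrite /v; nc_expand; rewrite hw wE; lmod.
have yq : star y ** y = - (q ** q).
  have -> : star y ** y = v ** (h ** v) by rewrite /y hE starM vs !amulA.
  rewrite hv amulNr; congr (- _).
  have -> : v ** (w ** v) = (v ** r) ** (r ** v) by rewrite rE !amulA.
  by rewrite -rv.
have py : pos (y ** star y).
  have [a [b [as_ bs yE]]] := re_im y.
  (* For y = a + i b the commutators cancel in y y^* + y^* y = 2 a^2 + 2 b^2. *)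
  have -> : y ** star y = (a ** a + a ** a) + (b ** b + b ** b) - star y ** y.
    rewrite yE starD starZ ic_conj as_ bs; nc_expand; lmod; ring: (@icic R).
  by rewrite yq opprK; do ?[apply: pos_add]; exact: pos_sqr.
have qq := sqr_neg_eq0 qs py yq.
have q0 := sqr_eq0 qs qq.
have wv : w ** v = 0 by rewrite rE -amulA -/q q0 amul0r.
have ww : w ** w = w ** h.
  by apply/eqP; rewrite -subr_eq0 -amulNr -amulDr -/v wv.
have vv : v ** v = 0.
  by rewrite {1}/v amulDl amulNl wv sub0r hv wv opprK.
have := sqr_eq0 vs vv => /eqP; rewrite subr_eq0 => /eqP <-.
exact: pw.
Qed.

Lemma pos_conj x h : pos h -> pos (star x ** h ** x).
Proof.
case=> k [ks ->]; have := pos_starM (k ** x).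
by rewrite starM ks !amulA.
Qed.

Lemma pos_mul_comm x y : pos x -> pos y -> x ** y = y ** x -> pos (x ** y).
Proof.
move=> px py xy; have [f [fs yE _ fc]] := pos_sqrt py.
have fx := fc _ xy.
by rewrite yE amulA fx -[X in X ** _ ** _]fs; exact: pos_conj.
Qed.

(** With d = x - y, the positive elements d x d and d y d add up to d (x + y) d = 0, so both vanish;
    their difference is d^3. *)
Lemma pos_sqrt_uniq x y : pos x -> pos y -> x ** y = y ** x ->
  x ** x = y ** y -> x = y.
Proof.
move=> px py xy xxyy; apply/eqP; rewrite -subr_eq0; apply/eqP.
set d := x - y; have ds : star d = d by rewrite /d starB !pos_star.
have e0 : d ** x ** d + d ** y ** d = 0.
  rewrite -amulDl -amulDr.
  rewrite (_ : d ** (x + y) = 0) ?amul0l // /d; nc_expand.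
  by rewrite xy xxyy; lmod.
have p1 : pos (d ** x ** d) by rewrite -{1}ds; exact: pos_conj.
have p2 : pos (d ** y ** d) by rewrite -{1}ds; exact: pos_conj.
have z1 : d ** x ** d = 0.
  by apply: nr_le0; have := nr_mono p1 p2; rewrite e0 nr0.
have z2 : d ** y ** d = 0 by move: e0; rewrite z1 add0r.
have xd : x ** d = d ** x by rewrite /d; nc_expand; rewrite xy.
have yd : y ** d = d ** y by rewrite /d; nc_expand; rewrite xy.
have ddd : d ** d ** d = 0.
  transitivity (d ** x ** d - d ** y ** d); last by rewrite z1 z2 subr0.
  by rewrite {2}/d; nc.
apply: sqr_eq0 => //; apply: sqr_eq0; first by rewrite starM ds.
by rewrite amulA ddd amul0l.
Qed.

(** The operator form of n a (1 - a)^n <= 1. It follows from (1 - a)^n (1 + n a) <= 1, where the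
    induction step from m to m + 1 gains the positive term (m + 1) a (1 - a)^m a. *)
Lemma nr_pos_pow a n : pos a -> nr a <= 1 ->
  n%:R * nr (a ** apow (aone - a) n) <= 1.
Proof.
move=> pa a1; set e := aone - a.
have pe : pos e.
  rewrite /e (_ : aone = rs 1); last by rewrite /rs scale1r.
  by apply: pos_sub => //; exact: pos_star.
have ae : a ** e = e ** a by rewrite /e; nc.
have pn m : pos (apow e m).
  elim: m => [|m IH] /=; first exact: pos1.
  by apply: pos_mul_comm => //; rewrite -apow_comm.
have aen m := apow_comm m ae.
have pP m : pos (aone - apow e m ** (aone + m%:R%:C%C *: a)).
  elim: m => [|m IH] /=.
    by rewrite scale0r addr0 amul1r subrr; exact: pos0.
  have -> : aone - e ** apow e m ** (aone + m.+1%:R%:C%C *: a) =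
     (aone - apow e m ** (aone + m%:R%:C%C *: a)) +
     m.+1%:R%:C%C *: (a ** apow e m ** a).
    rewrite -natr1 rmorphD {1}/e; nc_expand; rewrite !aen; nc_expand; lmod.
  apply: pos_add => //; apply: pos_scale => //.
  by rewrite -{1}(pos_star pa); exact: pos_conj.
have pan : pos (n%:R%:C%C *: (a ** apow e n)).
  by apply: pos_scale => //; exact: pos_mul_comm.
have := pos_nr_le pan _ ler01; rewrite nrZ ger0_norm //; apply.
rewrite (_ : _ - _ = (aone - apow e n ** (aone + n%:R%:C%C *: a)) + apow e n).
  exact: pos_add.
by rewrite /rs scale1r aen; nc.
Qed.
End Positivity.

(** * Homomorphisms and approximate units *)

Section HomTheory.
Variables (R : realType) (A B : starAlgType R) (f : starHom A B).

Lemma hom0 : f 0 = 0.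
Proof. by rewrite (linearB_fun (hom_linear f)).1.1. Qed.
Lemma homN x : f (- x) = - f x.
Proof. by rewrite (linearB_fun (hom_linear f)).1.2. Qed.
Lemma homB x y : f (x - y) = f x - f y.
Proof. by rewrite (linearB_fun (hom_linear f)).2. Qed.
Lemma homD x y : f (x + y) = f x + f y.
Proof. by rewrite (linear_funE (hom_linear f)).1. Qed.
Lemma homZ c x : f (c *: x) = c *: f x.
Proof. by rewrite (linear_funE (hom_linear f)).2. Qed.
End HomTheory.

Section MultiplierEmb.
Variables (R : realType) (B : cstarType R).
Implicit Types (m : multiplier B) (b : B).

Lemma emb_l m b : mult_emb B (mleft m b) = m ** mult_emb B b.
Proof. by apply: multiplier_ext => x /=; rewrite mleftM. Qed.

Lemma emb_r m b : mult_emb B (mright m b) = mult_emb B b ** m.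
Proof. by apply: multiplier_ext => x /=; rewrite mleft_right. Qed.

Lemma emb_inj : injective (mult_emb B).
Proof.
move=> x y /(congr1 (fun m => nr (m - mult_emb B y))).
rewrite subrr nr0 -homB nr_emb => /nr_eq0/eqP; rewrite subr_eq0 => /eqP //.
Qed.
End MultiplierEmb.

Section Homs.
Variable R : realType.

(** For |b| <= 1 one has 1 - b^* b = (1 - k)^2 with k in A itself, so the square can be carried to
    the multipliers of B although f has no unit to preserve. *)
Lemma hom_contractive (A B : cstarType R) (f : starHom A B) a :
  nr (f a) <= nr a.
Proof.
have key b : nr b <= 1 -> nr (f b) <= 1.
  move=> b1; have [|k [_ kE ks _]] := @quasi_sqrt R A (star b ** b).
    by rewrite nr_cstar expr2 mulr_ile1 ?nr_ge0.
  have {}ks : star k = k by apply: ks; rewrite starM starK.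
  have h1 : mult_emb B (f (star b ** b)) =
      star (mult_emb B (f b)) ** mult_emb B (f b).
    by rewrite homM hom_star homM hom_star.
  have : nr (f (star b ** b)) <= 1.
    rewrite -(nr_emb (f _)); apply: pos_nr_le => //.
      by rewrite h1; exact: pos_starM.
    exists (aone - mult_emb B (f k)); split.
      by rewrite starB star1 -!hom_star ks.
    rewrite -kE !homB !homD !homM /rs scale1r; nc.
  rewrite homM hom_star nr_cstar => h.
  by rewrite -(ler_pXn2r (n := 2)) ?nnegrE ?nr_ge0 // expr1n.
have [a0|a0] := eqVneq (nr a) 0.
  by rewrite (nr_eq0 a0) hom0 !nr0.
have {}a0 : 0 < nr a by rewrite lt_neqAle eq_sym a0 nr_ge0.
have ia0 : 0 <= (nr a)^-1 by rewrite invr_ge0 ltW.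
have h1 : nr ((nr a)^-1%:C%C *: a) <= 1.
  by rewrite nrZ ger0_norm // mulVf // gt_eqF.
have := key _ h1; rewrite homZ nrZ ger0_norm //.
by rewrite mulrC ler_pdivrMr // mul1r.
Qed.

Lemma hom_bounded (A B : cstarType R) (f : starHom A B) : bounded_op f.
Proof.
apply/bounded_opP; exists 1 => // x; rewrite mul1r; exact: hom_contractive.
Qed.

Lemma tends_hom (A B : cstarType R) (f : starHom A B) u l : tends u l ->
  tends (fun n => f (u n)) (f l).
Proof. by apply: tends_lin; [exact: hom_linear|exact: hom_bounded]. Qed.

Lemma hom_ext (A B : cstarType R) (f g : starHom A B) (S : set A) :
  closed_span S = setT -> (forall x, S x -> f x = g x) -> f =1 g.
Proof.
by apply: bl_ext; by [exact: hom_linear|exact: hom_bounded].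
Qed.

(* The positive square roots of [h^2 |h - r|^2] in the two algebras, where
   [h = a^* a] and [r = |f h|], are matched by uniqueness:
   [f (h |h - r|) = f h (r - f h)]; injectivity then gives [h (r - h) >= 0]. *)
Lemma injective_hom_isometric (A B : cstarType R) (f : starHom A B) :
  injective f -> forall a, nr (f a) = nr a.
Proof.
move=> finj a; apply/eqP; rewrite eq_le hom_contractive /=.
have [h hE] : exists h, h = star a ** a by exists (star a ** a).
have hs : star h = h by rewrite hE starM starK.
set r := nr (f h); have r0 : 0 <= r by exact: nr_ge0.
suff hr : nr h <= r.
  rewrite -(ler_pXn2r (n := 2)) ?nnegrE ?nr_ge0 //.
  by rewrite -!nr_cstar -hom_star -homM -hE.
pose eh := mult_emb A h; have ehs : star eh = eh by rewrite -hom_star hs.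
pose x := eh - rs _ r.
have xs : star x = x by rewrite /x starB star_rs ehs.
have [m [ms mE pm mc]] := pos_sqrt (pos_sqr xs).
have hx : eh ** x = x ** eh by rewrite /x /rs; nc.
have hm : eh ** m = m ** eh by apply: mc; rewrite !amulA hx -!amulA hx.
have [w [ws wE _ wc]] := pos_sqrt pm.
have hw := wc _ hm.
(* As c = a w with w^2 = m, the product y = c^* c is h |h - r|: it lies in A although |h - r| is
   only a multiplier. *)
pose c := mright w a.
have [y yc] : exists y, y = star c ** c by exists (star c ** c).
have yE : mult_emb A y = m ** eh.
  transitivity (w ** (eh ** w)); last by rewrite hw wE !amulA.
  by rewrite yc homM hom_star emb_r starM ws -hom_star /eh hE homM !amulA.
have hy : h ** y = y ** h.
  by apply: emb_inj; rewrite !homM yE amulA hm.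
have yy : y ** y = h ** h ** h ** h - (r + r)%:C%C *: (h ** h ** h)
    + (r * r)%:C%C *: (h ** h).
  apply: emb_inj; rewrite homM yE.
  have -> : m ** eh ** (m ** eh) = x ** x ** eh ** eh.
    by rewrite mE !amulA; congr (_ ** _); rewrite -!amulA hm.
  rewrite !(homD, homN, homZ, homM) -/eh /x /rs rmorphD rmorphM.
  by nc_expand; lmod.
pose z := r%:C%C *: h - h ** h.
have fy : f y = f z.
  apply: emb_inj; apply: pos_sqrt_uniq.
  - by rewrite yc homM hom_star homM hom_star; exact: pos_starM.
  - have ph : pos (mult_emb B (f h)).
      by rewrite hE homM hom_star homM hom_star; exact: pos_starM.
    have -> : mult_emb B (f z) = mult_emb B (f h) ** (rs _ r - mult_emb B (f h)).
      by rewrite !(homB, homZ, homM) /rs; nc.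
    apply: pos_mul_comm => //; last by rewrite /rs; nc.
    by apply: pos_sub; rewrite ?nr_emb // -!hom_star hs.
  - rewrite -!homM; congr (mult_emb B (f _)); rewrite /z.
    have hhy : y ** h ** h = h ** h ** y by rewrite -hy -amulA -hy amulA.
    by nc_expand; rewrite hhy -hy; lmod.
  - rewrite -!homM; congr (mult_emb B (f _)); rewrite yy /z rmorphD rmorphM; nc.
have {}fy := finj _ _ fy.
have [h0|h0] := eqVneq (nr h) 0; first by rewrite h0.
have {}h0 : 0 < nr h by rewrite lt_neqAle eq_sym h0 nr_ge0.
rewrite -(ler_pM2r h0) -expr2 -nr_cstar hs.
have -> : r * nr h = nr (r%:C%C *: h) by rewrite nrZ ger0_norm.
have -> : r%:C%C *: h = h ** h + y by rewrite fy /z; lmod.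
rewrite -nr_emb -[leRHS]nr_emb homD; apply: nr_mono.
  by rewrite homM; exact: pos_sqr.
by rewrite yc homM hom_star; exact: pos_starM.
Qed.

Lemma isometry_closed_image (A B : cstarType R) (f : starHom A B) (S : set A) :
  (forall a, nr (f a) = nr a) -> seq_closed S -> seq_closed (f @` S).
Proof.
move=> fi cS u l uS ul.
have /choice[v vP] : forall n, exists a, S a /\ f a = u n.
  by move=> n; have [a Sa fa] := uS n; exists a.
have [|a va] := @tends_cauchy R A v.
  move=> e /(tends_is_cauchy ul)[N uN]; exists N => n m nN mN.
  by rewrite -fi homB (vP n).2 (vP m).2 uN.
exists a; first by apply: cS va => n; have [] := vP n.
apply: (tends_uniq (tends_hom f va)).
by under eq_fun do rewrite (vP _).2.
Qed.
End Homs.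

(** * Approximate units adapted to one element *)

Section ApproximateUnits.
Variables (R : realType) (B : cstarType R).
Implicit Types (I : set B) (b c x y : B).

Record left_ideal I : Prop := LeftIdeal {
  idl0 : I 0;
  idl_lin : forall (c : R[i]) x y, I x -> I y -> I (c *: x + y);
  idl_mul : forall x y, I y -> I (x ** y)
}.

(** This is 1 - (1 - a)^n, written without the unit. *)
Fixpoint aunit (a : B) n := if n is k.+1 then a + aunit a k - a ** aunit a k else 0.

Lemma emb_aunit a n :
  aone - mult_emb B (aunit a n) = apow (aone - mult_emb B a) n.
Proof.
elim: n => [|n IH]; first by rewrite [aunit a 0]/= hom0 subr0.
have -> : aunit a n.+1 = a + aunit a n - a ** aunit a n by [].
have -> : apow (aone - mult_emb B a) n.+1 =
  (aone - mult_emb B a) ** apow (aone - mult_emb B a) n by [].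
by rewrite -IH homB homD homM; nc.
Qed.

Lemma aunit_ideal I a n : left_ideal I -> I a -> I (aunit a n).
Proof.
move=> idI Ia; elim: n => [|n IH] /=; first exact: idl0.
rewrite -addrA -[a]scale1r; apply: idl_lin => //; rewrite scale1r addrC -scaleN1r.
by apply: idl_lin => //; exact: idl_mul.
Qed.

(** For a = d^* d with d a small multiple of c, the square of |d - d g_n| is |a (1 - a)^(2n)|, at
    most 1/n by [nr_pos_pow]. Tying the sequence to c avoids nets and keeps it in every left ideal
    that contains c. *)
Lemma approx_unit c : exists g : nat -> B,
  [/\ tends (fun n => c ** g n) c,
      forall n, nr (aone - mult_emb B (g n)) <= 1,
      forall n, star (g n) = g n
    & forall I, left_ideal I -> I c -> forall n, I (g n)].
Proof.
pose t := (nr c + 1)^-1.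
have t0 : 0 < t by rewrite invr_gt0 ltr_wpDl // nr_ge0.
pose d := t%:C%C *: c.
have d1 : nr d <= 1.
  by rewrite nrZ gtr0_norm // mulrC ler_pdivrMr ?ltr_wpDl ?nr_ge0 // mul1r lerDl.
have [a aE] : exists a, a = star d ** d by exists (star d ** d).
have as_ : star a = a by rewrite aE starM starK.
have pa : pos (mult_emb B a) by rewrite aE homM hom_star; exact: pos_starM.
have a1 : nr (mult_emb B a) <= 1.
  by rewrite nr_emb aE nr_cstar expr2 mulr_ile1 ?nr_ge0.
have es : star (aone - mult_emb B a) = aone - mult_emb B a.
  by rewrite starB star1 -hom_star as_.
have e1 : nr (aone - mult_emb B a) <= 1.
  have := pos_ball pa a1; by rewrite /rs scale1r.
have dist n : n%:R * nr (d - d ** aunit a n) ^+ 2 <= 1.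
  have -> : nr (d - d ** aunit a n) ^+ 2 =
      nr (mult_emb B a ** apow (aone - mult_emb B a) (n + n)).
    rewrite -(nr_emb (_ - _)) homB homM.
    have -> : mult_emb B d - mult_emb B d ** mult_emb B (aunit a n) =
        mult_emb B d ** apow (aone - mult_emb B a) n by rewrite -emb_aunit; nc.
    rewrite -nr_cstar starM apow_star // apowD !amulA.
    rewrite -[X in nr (X ** _)]amulA -hom_star -homM -aE.
    congr (nr (_ ** _)); apply/esym/apow_comm; nc.
  apply: le_trans (nr_pos_pow (n + n) pa a1).
  by rewrite ler_wpM2r ?nr_ge0 // ler_nat leq_addr.
exists (aunit a); split=> [|n|n|I idI Ic n].
- move=> e e0; pose K := Num.truncn ((t * e) ^+ 2)^-1.
  have te : 0 < t * e by rewrite mulr_gt0.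
  exists K.+1 => n nK; rewrite nrB -(ltr_pM2l t0).
  have -> : t * nr (c - c ** aunit a n) = nr (d - d ** aunit a n).
    by rewrite -{1}(gtr0_norm t0) -nrZ scalerBr /d amulZl.
  rewrite -(ltr_pXn2r (n := 2)) ?nnegrE ?nr_ge0 ?(ltW te) //.
  have n0 : 0 < n%:R :> R by rewrite ltr0n; exact: leq_trans nK.
  have := dist n; rewrite -ler_pdivlMl // mulr1; move/le_lt_trans; apply.
  rewrite -[ltRHS]invrK ltf_pV2 ?posrE ?invr_gt0 ?exprn_gt0 //.
  by apply: lt_le_trans (truncnS_gt _) _; rewrite ler_nat.
- rewrite emb_aunit (le_trans (nr_apow _ _)) // exprn_ile1 ?nr_ge0 //.
- elim: n => [|n IH] /=; first by rewrite star0.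
  have ag : a ** aunit a n = aunit a n ** a.
    elim: n {IH} => [|n IH] /=; first by rewrite amul0l amul0r.
    have h : a ** aunit a n ** a = a ** a ** aunit a n by rewrite -amulA -IH amulA.
    by nc_expand; rewrite h -IH; lmod.
  by rewrite starD starN starD starM IH as_ ag.
apply: aunit_ideal => //; rewrite aE; apply: idl_mul => //.
by rewrite /d -[_ *: _]addr0; apply: idl_lin => //; exact: idl0.
Qed.

Lemma mul_dense x : closed_span [set z : B | exists a b, z = a ** b] x.
Proof.
have [g [xg _ _ _]] := approx_unit x.
apply/closure_tends; exists (fun n => x ** g n) => // n; apply: lin_span_gen.
by exists x, (g n).
Qed.

(** Take d = c g with g from an approximate unit for i. For k = 1 - g the assumption gives k c^* c k
    <= t k^2 + k i k, where |k| <= 1 and i k is small. *)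
Lemma ideal_dist I c i t : left_ideal I -> 0 <= t -> I i -> star i = i ->
  pos (rs _ t - mult_emb B (star c ** c) + mult_emb B i) ->
  forall e : R, 0 < e -> exists2 d, I d & nr (c - d) ^+ 2 <= t + e.
Proof.
move=> idI t0 Ii is_ pI e e0.
have [g [ig g1 gs gI]] := approx_unit i.
have k0 : 0 < nr i + 1 by rewrite ltr_wpDl // nr_ge0.
have [N /(_ N (leqnn N)) iN] := ig e e0.
exists (c ** g N); first by apply: idl_mul => //; exact: gI.
pose k : multiplier B := aone - mult_emb B (g N).
have ks : star k = k by rewrite /k starB star1 -hom_star gs.
have cE : mult_emb B (c - c ** g N) = mult_emb B c ** k.
  by rewrite homB homM /k; nc.
rewrite -(nr_emb (_ - _)) cE -nr_cstar starM ks.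
have pX : pos (k ** star (mult_emb B c) ** (mult_emb B c ** k)).
  by rewrite -{1}ks -starM; exact: pos_starM.
have pY : pos (k ** (rs _ t - mult_emb B (star c ** c) + mult_emb B i) ** k).
  by rewrite -{1}ks; exact: pos_conj.
apply: le_trans (nr_mono pX pY) _.
have -> : k ** star (mult_emb B c) ** (mult_emb B c ** k) +
    k ** (rs _ t - mult_emb B (star c ** c) + mult_emb B i) ** k =
    t%:C%C *: (k ** k) + k ** (mult_emb B i ** k).
  by rewrite homM hom_star /rs; nc.
have kk : nr k <= 1 := g1 N.
apply: le_trans (nr_triangle _ _) _; rewrite lerD //.
  rewrite nrZ ger0_norm // -[leRHS]mulr1 ler_wpM2l // (le_trans (nr_amul _ _)) //.
  by rewrite mulr_ile1 ?nr_ge0.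
have -> : mult_emb B i ** k = mult_emb B (i - i ** g N) by rewrite homB homM /k; nc.
apply: le_trans (nr_amul _ _) _; rewrite nr_emb -[leRHS]mul1r.
by rewrite ler_pM ?nr_ge0 // nrB ltW.
Qed.
End ApproximateUnits.

(** * Separation by a maximal cone *)

Section ConeSeparation.
Variables (R : realType) (V : lmodType R[i]) (K : set V) (u : V).
Implicit Types (x y : V) (s t : R).
Hypothesis KD : forall x y, K x -> K y -> K (x + y).
Hypothesis KZ : forall t x, 0 <= t -> K x -> K (t%:C%C *: x).
Hypothesis Ku : forall x, exists2 t, 0 <= t & K (t%:C%C *: u + x).
Hypothesis K_proper : ~ K (- u).
Hypothesis K0 : K 0.

(** The last clause is conditional so that the empty set qualifies: it is the union of the empty
    chain in [Zorn_bigcup]. *)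
Let subcone (M : set V) := [/\ forall x y, M x -> M y -> M (x + y),
  forall t x, 0 < t -> M x -> M (t%:C%C *: x), ~ M (- u) & M !=set0 -> K `<=` M].

(** If a maximal M contains neither x nor -x, adjoining either one brings in -u. Eliminating x
    between the two expressions of -u puts -u in M. *)
Lemma half_space : exists M : set V, [/\ subcone M, K `<=` M
  & forall x, M x \/ M (- x)].
Proof.
have [F Fsub Ftot|M [[MD MZ Mu MK] Mmax]] := @Zorn_bigcup V subcone.
  split=> [x y [M FM Mx] [N FN Ny]|t x t0 [M FM Mx]|[M FM]|[x [M FM Mx]]].
  - have [MN|NM] := Ftot _ _ FM FN.
      by exists N => //; have [ND _ _ _] := Fsub _ FN; apply: ND => //; exact: MN.
    by exists M => //; have [MD _ _ _] := Fsub _ FM; apply: MD => //; exact: NM.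
  - by exists M => //; have [_ MZ _ _] := Fsub _ FM; exact: MZ.
  - by have [_ _ ] := Fsub _ FM.
  move=> y Ky; exists M => //; have [_ _ _ MK] := Fsub _ FM; apply: MK => //.
  by exists x.
have Mn0 : M !=set0.
  have [//|M0] := pselect (M !=set0); exfalso; apply: (Mmax K); last first.
    split; [exact: KD|by move=> t x t0; apply: KZ; exact: ltW|exact: K_proper|by move=> _ z].
  split; first by move=> x Mx; case: M0; exists x.
  by move=> KM; apply: M0; exists 0; exact: KM.
exists M; split=> //; first exact: MK.
have M0 : M 0 := MK Mn0 _ K0.
move=> x; have [Mx|nMx] := pselect (M x); first by left.
have [Mx'|nMx'] := pselect (M (- x)); first by right.
have ext y : ~ M y -> exists m t, [/\ M m, 0 < t & m + t%:C%C *: y = - u].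
  move=> nMy; apply: contrapT => no.
  apply: (Mmax [set z | exists m t, [/\ M m, 0 <= t & z = m + t%:C%C *: y]]).
    split=> [m Mm|]; first by exists m, 0; rewrite scale0r addr0.
    move=> sub; apply: nMy; apply: sub; exists 0, 1; split=> //.
    by rewrite scale1r add0r.
  split.
  - move=> _ _ [m [s [Mm s0 ->]]] [n [t [Mn t0 ->]]]; exists (m + n), (s + t).
    by split; rewrite ?addr_ge0 //; [exact: MD|rewrite rmorphD /= scalerDl addrACA].
  - move=> s _ s0 [m [t [Mm t0 ->]]]; exists (s%:C%C *: m), (s * t).
    by split; rewrite ?mulr_ge0 ?(ltW s0) //; [exact: MZ|rewrite rmorphM scalerDr scalerA].
  - move=> [m [t [Mm t0 E]]]; move: t0; rewrite le_eqVlt => /orP[/eqP t0|t0].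
      by apply: Mu; rewrite E -t0 scale0r addr0.
    by apply: no; exists m, t.
  by move=> _ z Kz; exists z, 0; split=> //; [exact: MK|rewrite scale0r addr0].
have [m [s [Mm s0 mE]]] := ext _ nMx.
have [n [t [Mn t0 nE]]] := ext _ nMx'.
exfalso; apply: Mu.
have st : 0 < (s + t)^-1 by rewrite invr_gt0 addr_gt0.
have -> : - u = (s + t)^-1%:C%C *: (t%:C%C *: m + s%:C%C *: n).
  have -> : m = - u - s%:C%C *: x by rewrite -mE addrK.
  have -> : n = - u + t%:C%C *: x by rewrite -nE scalerN subrK.
  have h : (s + t)^-1%:C%C * (s%:C%C + t%:C%C) = 1 :> R[i].
    by rewrite -rmorphD -rmorphM mulVf ?gt_eqF ?addr_gt0.
  move: ((s + t)^-1)%:C%C s%:C%C t%:C%C h => i p q h.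
  have {}h : i * p = 1 - i * q by rewrite -h; ring.
  by lmod; ring: h.
by apply: (MZ _ _ st); apply: MD; [exact: (MZ _ _ t0)|exact: (MZ _ _ s0)].
Qed.

(** The functional is the cut f x = sup of the t with x - t u in M. Superadditivity holds because M
    is a cone; the reverse inequality needs M to be a half space. *)
Lemma cone_functional : exists f : V -> R,
  [/\ forall x y, f (x + y) = f x + f y, forall t x, f (t%:C%C *: x) = t * f x,
      forall x, K x -> 0 <= f x & f u = 1].
Proof.
have [M [[MD MZ Mu _] KM Mtot]] := half_space.
have M0 : M 0 by exact: KM.
have MZ0 t x : 0 <= t -> M x -> M (t%:C%C *: x).
  by rewrite le_eqVlt => /orP[/eqP<-|]; [rewrite scale0r|exact: MZ].
have Mge0 t : M (t%:C%C *: u) -> 0 <= t.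
  move=> Mt; rewrite leNgt; apply/negP => t0; apply: Mu.
  have := MZ (- t)^-1 _ _ Mt; rewrite scalerA -rmorphM invrN mulNr mulVf ?lt_eqF //.
  by rewrite rmorphN scaleN1r; apply; rewrite oppr_gt0 invr_lt0.
pose S x := [set t | M (x - t%:C%C *: u)]; pose f x := sup (S x).
have Sn0 x : S x !=set0.
  have [t t0 Kt] := Ku x; exists (- t).
  suff : M (x - (- t)%:C%C *: u) by [].
  by rewrite rmorphN scaleNr opprK addrC; exact: KM.
have Sub x : has_ubound (S x).
  have [t t0 Kt] := Ku (- x); exists t => s /= Ms; rewrite -subr_ge0.
  apply: Mge0; rewrite (_ : _ *: u = (x - s%:C%C *: u) + (t%:C%C *: u - x)).
    by apply: MD => //; exact: KM.
  by rewrite rmorphB; lmod.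
have fge x t : S x t -> t <= f x by apply: ub_le_sup.
have fle x t : (forall s, S x s -> s <= t) -> f x <= t by move=> h; apply: ge_sup.
have fsup x y : f x + f y <= f (x + y).
  rewrite -lerBrDr; apply: (fle _ _) => s Ss; rewrite lerBrDr addrC -lerBrDr.
  apply: (fle _ _) => t St; rewrite lerBrDr; apply: fge; rewrite /S /mkset.
  rewrite (_ : _ - _ = (x - s%:C%C *: u) + (y - t%:C%C *: u)); first exact: MD.
  by rewrite rmorphD; lmod.
have f0 : f 0 = 0.
  apply/eqP; rewrite eq_le; apply/andP; split.
    apply: (fle _ _) => s; rewrite /S /mkset sub0r -scaleNr -rmorphN => /Mge0.
    by rewrite oppr_ge0.
  by apply: fge; rewrite /S /mkset scale0r subr0.
have fN x : f (- x) = - f x.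
  apply/eqP; rewrite eq_le; apply/andP; split.
    by rewrite -subr_le0 opprK -f0 -[X in _ <= f X](addNr x) fsup.
  rewrite lerNl; apply/ler_addgt0Pl => e e0.
  rewrite -lerBlDl; rewrite leNgt; apply/negP => h.
  (* For such a t, x - t u is outside M, so its opposite is inside, and then -t <= f (-x). *)
  have [t h1 h2] : exists2 t, f x < t & t < - f (- x).
    by exists ((f x + - f (- x)) / 2); lra.
  have nS : ~ M (x - t%:C%C *: u) by move=> /fge; lra.
  have [//|] := Mtot (x - t%:C%C *: u); rewrite opprB => h3.
  have : - t <= f (- x) by apply: fge; rewrite /S /mkset rmorphN scaleNr opprK addrC.
  lra.
have fD x y : f (x + y) = f x + f y.
  apply/eqP; rewrite eq_le fsup andbT.
  have := fsup (x + y) (- y); rewrite addrK fN; lra.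
have fZp t x : 0 < t -> t * f x <= f (t%:C%C *: x).
  move=> t0; rewrite -ler_pdivlMl //; apply: (fle _ _) => s Ss.
  rewrite ler_pdivlMl //; apply: fge; rewrite /S /mkset rmorphM -scalerA -scalerBr.
  exact: MZ.
have fZ0 t x : 0 <= t -> f (t%:C%C *: x) = t * f x.
  rewrite le_eqVlt => /orP[/eqP<-|t0]; first by rewrite scale0r f0 mul0r.
  apply/eqP; rewrite eq_le fZp // andbT.
  have := @fZp t^-1 (t%:C%C *: x); rewrite invr_gt0 scalerA -rmorphM mulVf ?gt_eqF //.
  by rewrite scale1r => /(_ t0); rewrite ler_pdivrMl.
exists f; split=> // [t x|x Kx|].
- have [t0|/ltW t0] := leP 0 t; first exact: fZ0.
  rewrite -[t]opprK rmorphN scaleNr fN fZ0 ?oppr_ge0 //; ring.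
- by apply: fge; rewrite /S /mkset scale0r subr0; exact: KM.
apply/eqP; rewrite eq_le; apply/andP; split.
  apply: (fle _ _) => s; rewrite /S /mkset -{1}[u]scale1r -scalerBl -[1]/(1%:C%C) -rmorphB.
  by move=> /Mge0; rewrite subr_ge0.
by apply: fge; rewrite /S /mkset scale1r subrr.
Qed.
End ConeSeparation.

(** * States and the Gelfand-Naimark-Segal construction *)

Section States.
Variables (R : realType) (B : cstarType R).
Local Notation M := (multiplier B).
Implicit Types (I : set B) (x y : M).

Definition re x : M := 2^-1 *: (x + star x).

Lemma re_star x : star (re x) = re x.
Proof. by rewrite /re starZ half_conj starD starK addrC. Qed.

Lemma re_sa x : star x = x -> re x = x.
Proof. by rewrite /re => ->; lmod; field. Qed.

(** The cone to separate is generated by the positive elements, the self-adjoint part of I, the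
    skew-adjoint elements and h - l. That no t < l dominates h modulo I is what keeps -1 out of
    it. *)
Lemma state_exists I (h : B) (l : R) : I 0 ->
    (forall (c : R[i]) (x y : B), I x -> I y -> I (c *: x + y)) ->
    (forall x : B, I x -> I (star x)) -> star h = h ->
    (forall t i, t < l -> I i -> star i = i ->
       ~ pos (rs _ t - mult_emb B h + mult_emb B i)) ->
  exists f : M -> R, [/\ forall x y, f (x + y) = f x + f y,
    forall (t : R) x, f (t%:C%C *: x) = t * f x, forall x, pos x -> 0 <= f x,
    f aone = 1 & [/\ l <= f (mult_emb B h), forall i, I i -> f (mult_emb B i) = 0
    & forall x, star x = - x -> f x = 0]].
Proof.
move=> I0 IL Is hs hl.
have ID (x y : B) : I x -> I y -> I (x + y) by rewrite -{2}[x]scale1r; exact: IL.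
have IZ c (x : B) : I x -> I (c *: x) by move=> Ix; rewrite -[_ *: _]addr0; exact: IL.
have IN (x : B) : I x -> I (- x) by rewrite -scaleN1r; exact: IZ.
pose d : M := mult_emb B h - rs _ l.
have ds : star d = d by rewrite /d starB star_rs -hom_star hs.
pose K : set M := [set x | exists i s, [/\ I i, star i = i, 0 <= s
  & pos (re x - s%:C%C *: d + mult_emb B i)]].
have reD x y : re (x + y) = re x + re y by rewrite /re starD; lmod.
have reZ (t : R) x : re (t%:C%C *: x) = t%:C%C *: re x.
  by rewrite /re starZ conj_realC; lmod.
have KD x y : K x -> K y -> K (x + y).
  move=> [i [s [Ii is_ s0 px]]] [k [t [Ik ks t0 py]]].
  exists (i + k), (s + t); split; [exact: ID|by rewrite starD is_ ks|exact: addr_ge0|].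
  rewrite (_ : _ + _ = (re x - s%:C%C *: d + mult_emb B i) +
    (re y - t%:C%C *: d + mult_emb B k)); first exact: pos_add.
  by rewrite reD homD rmorphD /=; lmod.
have KZ (t : R) x : 0 <= t -> K x -> K (t%:C%C *: x).
  move=> t0 [i [s [Ii is_ s0 px]]]; exists (t%:C%C *: i), (t * s).
  split; [exact: IZ|by rewrite starZ conj_realC is_|exact: mulr_ge0|].
  rewrite (_ : _ + _ = t%:C%C *: (re x - s%:C%C *: d + mult_emb B i)).
    exact: pos_scale.
  by rewrite reZ homZ rmorphM; lmod.
have Kpos x : pos x -> K x.
  move=> px; exists 0, 0; split=> //; first exact: star0.
  by rewrite scale0r subr0 hom0 addr0 re_sa //; exact: pos_star.
have [f [fD fZ fK f1]] : exists f : M -> R,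
  [/\ forall x y, f (x + y) = f x + f y, forall (t : R) x, f (t%:C%C *: x) = t * f x,
      forall x, K x -> 0 <= f x & f aone = 1].
  apply: cone_functional => //.
  - move=> x; exists (nr (re x)); first exact: nr_ge0.
    exists 0, 0; split=> //; first exact: star0.
    rewrite scale0r subr0 hom0 addr0 reD reZ (re_sa (@star1 _ _)) -[re x]opprK.
    by rewrite [X in nr X]opprK; apply: pos_sub; rewrite ?nrN // starN re_star.
  - move=> [i [s [Ii is_ s0]]]; rewrite re_sa; last by rewrite starN star1.
    move: s0; rewrite le_eqVlt => /orP[/eqP<-|s0].
      rewrite scale0r subr0 => p.
      (* If -1 + i is positive, adding N times it to |h| - h dominates h modulo I by |h| - N = -|l|
         - 1, which is below l. *)
      pose N := nr h + `|l| + 1; have N0 : 0 <= N by rewrite !addr_ge0 ?nr_ge0.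
      apply: (hl (nr h - N) (N%:C%C *: i)).
      + by rewrite /N; have := ler_norm (- l); rewrite normrN; lra.
      + exact: IZ.
      + by rewrite starZ conj_realC is_.
      rewrite (_ : _ + _ = (rs _ (nr h) - mult_emb B h) +
        N%:C%C *: (- aone + mult_emb B i)).
        apply: pos_add; last exact: pos_scale.
        by apply: pos_sub; rewrite ?nr_emb // -hom_star hs.
      by rewrite homZ /rs rmorphB /=; lmod.
    (* Dividing -1 - s (h - l) + i by s dominates h modulo I by l - 1/s. *)
    move=> p; apply: (hl (l - s^-1) (s^-1%:C%C *: i)).
    + by rewrite ltrBlDr ltrDl invr_gt0.
    + exact: IZ.
    + by rewrite starZ conj_realC is_.
    rewrite (_ : _ + _ = s^-1%:C%C *: (- aone - s%:C%C *: d + mult_emb B i)).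
      by apply: pos_scale => //; rewrite invr_ge0 ltW.
    have si : s^-1%:C%C * s%:C%C = 1 :> R[i].
      by rewrite -rmorphM mulVf ?gt_eqF.
    rewrite homZ /d /rs rmorphB /=; move: s^-1%:C%C s%:C%C si => p1 p2 si.
    by lmod; ring: si.
  - by apply: Kpos; exact: pos0.
have fN x : f (- x) = - f x.
  by rewrite -scaleN1r -[-1]/(-1 : R[i]) (_ : -1 = (-1)%:C%C) ?fZ ?mulN1r // rmorphN rmorph1.
have f0 x : K x -> K (- x) -> f x = 0.
  by move=> /fK h1 /fK; rewrite fN oppr_ge0 => h2; apply/eqP; rewrite eq_le h2 h1.
have fskew x : star x = - x -> f x = 0.
  move=> xs; apply: f0; exists 0, 0; split=> //; rewrite ?star0 //.
    by rewrite /re xs subrr scaler0 scale0r subr0 hom0 addr0; exact: pos0.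
  by rewrite /re starN xs opprK addNr scaler0 scale0r subr0 hom0 addr0; exact: pos0.
exists f; split=> //; first by move=> x /Kpos/fK.
split=> //.
  rewrite -subr_ge0 -[l]mulr1 -f1 -fZ -fN -fD; apply: fK; exists 0, 1.
  split=> //; first exact: star0.
  by rewrite re_sa // scale1r subrr hom0 addr0; exact: pos0.
move=> i Ii; have ii : I (2^-1 *: (i + star i)) by apply: IZ; apply: ID => //; exact: Is.
have sta : star (2^-1 *: (i + star i)) = 2^-1 *: (i + star i).
  by rewrite starZ half_conj starD starK addrC.
have reE : re (mult_emb B i) = mult_emb B (2^-1 *: (i + star i)).
  by rewrite homZ homD hom_star.
apply: f0.
  exists (- (2^-1 *: (i + star i))), 0; split=> //; first exact: IN.
    by rewrite starN sta.
  by rewrite scale0r subr0 reE -homD subrr hom0; exact: pos0.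
exists (2^-1 *: (i + star i)), 0; split=> //.
have -> : re (- mult_emb B i) = - re (mult_emb B i) by rewrite /re starN; lmod.
by rewrite scale0r subr0 reE -homN -homD addNr hom0; exact: pos0.
Qed.
End States.

Section ComplexState.
Variables (R : realType) (B : cstarType R) (f : multiplier B -> R).
Local Notation M := (multiplier B).
Implicit Types (x y : M).
Hypothesis fD : forall x y, f (x + y) = f x + f y.
Hypothesis fZ : forall (t : R) x, f (t%:C%C *: x) = t * f x.
Hypothesis f_ge0 : forall x, pos x -> 0 <= f x.
Hypothesis f1 : f aone = 1.
Hypothesis fskew : forall x, star x = - x -> f x = 0.

(** The complex-linear functional with real part f. *)
Definition cstate x : R[i] := (f x)%:C%C - ic * (f (ic *: x))%:C%C.

Let fN x : f (- x) = - f x.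
Proof.
have -> : - x = (-1)%:C%C *: x by rewrite rmorphN rmorph1 scaleN1r.
by rewrite fZ mulN1r.
Qed.

Lemma complex_parts (c : R[i]) : exists s t : R, c = s%:C%C + ic * t%:C%C.
Proof. by case: c => s t; exists s, t; rewrite /ic; simpc. Qed.

Lemma cstate_linear : linear (cstate : M -> R[i]^o).
Proof.
move=> c x y; have [s [t ->]] := complex_parts c; rewrite /cstate.
have h1 : f ((s%:C%C + ic * t%:C%C) *: x) = s * f x + t * f (ic *: x).
  by rewrite -!fZ -fD; congr f; lmod.
have h2 : f (ic *: ((s%:C%C + ic * t%:C%C) *: x)) = s * f (ic *: x) - t * f x.
  by rewrite -!fZ -fN -fD; congr f; lmod; ring: (@icic R).
rewrite scalerDr !fD h1 h2 !rmorphD rmorphN !rmorphM /= -[RHS]/(_ * _ + _).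
by ring: (@icic R).
Qed.

Lemma cstate_sa x : star x = x -> cstate x = (f x)%:C%C.
Proof.
move=> xs; have h : f (ic *: x) = 0.
  by apply: fskew; rewrite starZ ic_conj xs scaleNr.
by rewrite /cstate h mulr0 subr0.
Qed.

Lemma cstate_star x : cstate (star x) = (cstate x)^*.
Proof.
have h1 : f (star x) = f x.
  have /eqP : f (x - star x) = 0 by apply: fskew; rewrite starB starK opprB.
  by rewrite fD fN subr_eq0 => /eqP.
have h2 : f (ic *: star x) = - f (ic *: x).
  have /eqP : f (ic *: x + ic *: star x) = 0.
    by apply: fskew; rewrite starD !starZ starK ic_conj; lmod.
  by rewrite fD addrC addr_eq0 => /eqP.
rewrite /cstate h1 h2 rmorphB rmorphM /= !conj_realC ic_conj rmorphN /=.
by ring.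
Qed.

Lemma cstate_ge0 x : 0 <= cstate (star x ** x).
Proof.
by rewrite cstate_sa ?starM ?starK // lecR; apply/f_ge0/pos_starM.
Qed.

(** The variance f((x - f x)^2) is nonnegative. *)
Lemma state_sqr x : star x = x -> f x ^+ 2 <= f (x ** x).
Proof.
move=> xs; pose y := x - (f x)%:C%C *: aone.
have : 0 <= f (y ** y).
  by apply: f_ge0; apply: pos_sqr; rewrite starB starZ conj_realC xs star1.
have -> : y ** y = x ** x + (- (f x + f x))%:C%C *: x + (f x * f x)%:C%C *: aone.
  by rewrite /y rmorphN rmorphD rmorphM /=; nc.
by rewrite !fD !fZ f1; lra.
Qed.

Lemma state_le x y : pos x -> pos (y - x) -> f x <= f y.
Proof. by move=> px /f_ge0; rewrite fD fN subr_ge0. Qed.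
End ComplexState.

Record semi_inner (R : realType) (V : lmodType R[i]) := SemiInner {
  si :> V -> V -> R[i];
  siDl : forall x y z, si (x + y) z = si x z + si y z;
  siZl : forall c x z, si (c *: x) z = c * si x z;
  siC : forall x y, si y x = (si x y)^*;
  si_ge0 : forall x, 0 <= si x x
}.

(** * Hilbert space completion of a semi-inner product *)

Section Completion.
Variables (R : realType) (V : lmodType R[i]) (s : semi_inner V).
Implicit Types (v w : V).

Definition sn v : R := Num.sqrt (sq s v).

Lemma siDr x y z : s z (x + y) = s z x + s z y.
Proof. exact: sip_Dr (@siDl _ _ s) (@siC _ _ s) _ _ _. Qed.
Lemma siZr c x z : s z (c *: x) = c^* * s z x.
Proof. exact: sip_Zr (@siZl _ _ s) (@siC _ _ s) _ _ _. Qed.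

Lemma sn_ge0 v : 0 <= sn v. Proof. exact: sqrtr_ge0. Qed.

Lemma sn_sq v : sn v ^+ 2 = sq s v.
Proof. by rewrite sqr_sqrtr // (sq_ge0 (@si_ge0 _ _ s)). Qed.

Lemma snE v : s v v = (sn v ^+ 2)%:C%C.
Proof. by rewrite sn_sq (sqE (@si_ge0 _ _ s)). Qed.

Lemma si_cauchy_schwarz v w : cabs (s v w) <= sn v * sn w.
Proof.
have := sip_cauchy_schwarz (@siDl _ _ s) (@siZl _ _ s) (@siC _ _ s)
  (@si_ge0 _ _ s) v w.
rewrite -!sn_sq -exprMn => h.
by rewrite -(ler_pXn2r (n := 2)) // nnegrE ?mulr_ge0 ?sn_ge0 ?cabs_ge0.
Qed.

Definition unit_ball := {w : V | sn w <= 1}.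

Lemma functional_bounded v :
  exists M : R[i], forall b : unit_ball, `|s v (sval b)| <= M.
Proof.
exists (sn v)%:C%C => -[w w1] /=; rewrite cabsE lecR.
by rewrite (le_trans (si_cauchy_schwarz _ _)) // -[leRHS]mulr1 ler_wpM2l ?sn_ge0.
Qed.

Definition functional v : linf R unit_ball :=
  @Linf R unit_ball (fun b => s v (sval b)) (functional_bounded v).

Lemma functional_linear : linear functional.
Proof. by move=> c v w; apply: linfP => x /=; rewrite siDl siZl. Qed.

Lemma nr_functional v : nr (functional v) = sn v.
Proof.
apply/eqP; rewrite eq_le; apply/andP; split.
  rewrite -lecR -nrE; apply: linf_norm_le => [|[w w1] /=].
    by rewrite lecR sn_ge0.
  rewrite cabsE lecR (le_trans (si_cauchy_schwarz _ _)) //.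
  by rewrite -[leRHS]mulr1 ler_wpM2l ?sn_ge0.
have [v0|v0] := eqVneq (sn v) 0; first by rewrite v0 nr_ge0.
have {}v0 : 0 < sn v by rewrite lt_neqAle eq_sym v0 sn_ge0.
have w1 : sn ((sn v)^-1%:C%C *: v) <= 1.
  rewrite -(ler_pXn2r (n := 2)) ?nnegrE ?sn_ge0 // expr1n -lecR -snE.
  rewrite siZl siZr conj_realC snE -!rmorphM lecR.
  rewrite (_ : _ * _ = 1) //; field; by rewrite gt_eqF.
have := linf_norm_ge (functional v) (exist (fun w => sn w <= 1) _ w1).
rewrite -[linf_norm _]/(`|functional v|) nrE /= siZr conj_realC snE -rmorphM.
rewrite cabsE lecR cabs_real expr2 mulKf ?gt_eqF // ger0_norm ?(ltW v0) //.
Qed.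

(* The completion of [V]: the closure of its image [v |-> s v _] in the bounded
   functions on the unit ball; no quotient by the null vectors is needed. *)
Record completion := Completion {
  compl_val :> linf R unit_ball;
  compl_valP : closure (range functional) compl_val
}.
Implicit Types x y z : completion.

Lemma compl_val_inj : injective compl_val.
Proof.
case=> x xP [y yP] /= xy; subst; congr Completion; exact: Prop_irrelevance.
Qed.

Lemma range_functional_linear (c : R[i]) f g : range functional f ->
  range functional g -> range functional (c *: f + g).
Proof. by move=> [v _ <-] [w _ <-]; exists (c *: v + w) => //; rewrite functional_linear. Qed.

Lemma compl_lin (c : R[i]) f g : closure (range functional) f ->
  closure (range functional) g -> closure (range functional) (c *: f + g).
Proof.
move=> /closure_tends[u uS uf] /closure_tends[v vS vg].
apply/closure_tends; exists (fun n => c *: u n + v n) => [n|].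
  exact: range_functional_linear.
by apply: tendsD => //; exact: tendsZ.
Qed.

Lemma compl_0 : closure (range functional) 0.
Proof.
apply: subset_closure; exists 0 => //.
by rewrite (linearB_fun functional_linear).1.1.
Qed.

Lemma compl_addP x y : closure (range functional) ((x : linf _ _) + y).
Proof. by rewrite -[x : linf _ _]scale1r; apply: compl_lin; exact: compl_valP. Qed.
Lemma compl_scaleP (c : R[i]) x : closure (range functional) (c *: (x : linf _ _)).
Proof.
by rewrite -[_ *: _]addr0; apply: compl_lin; [exact: compl_valP|exact: compl_0].
Qed.
Lemma compl_oppP x : closure (range functional) (- (x : linf _ _)).
Proof. by rewrite -scaleN1r; exact: compl_scaleP. Qed.

HB.instance Definition _ := gen_eqMixin completion.
HB.instance Definition _ := gen_choiceMixin completion.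

Definition compl0 := Completion compl_0.
Definition complN x := Completion (@compl_oppP x).
Definition complD x y := Completion (@compl_addP x y).
Definition complZ (c : R[i]) x := Completion (@compl_scaleP c x).

Fact complDA : associative complD.
Proof. by move=> x y z; apply: compl_val_inj; rewrite /= addrA. Qed.
Fact complDC : commutative complD.
Proof. by move=> x y; apply: compl_val_inj; rewrite /= addrC. Qed.
Fact compl0D : left_id compl0 complD.
Proof. by move=> x; apply: compl_val_inj; rewrite /= add0r. Qed.
Fact complND : left_inverse compl0 complN complD.
Proof. by move=> x; apply: compl_val_inj; rewrite /= addNr. Qed.
HB.instance Definition _ :=
  GRing.isZmodule.Build completion complDA complDC compl0D complND.

Fact complZA a b x : complZ a (complZ b x) = complZ (a * b) x.
Proof. by apply: compl_val_inj; rewrite /= scalerA. Qed.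
Fact complZ1 : left_id 1 complZ.
Proof. by move=> x; apply: compl_val_inj; rewrite /= scale1r. Qed.
Fact complZDr : right_distributive complZ +%R.
Proof. by move=> c x y; apply: compl_val_inj; rewrite /= scalerDr. Qed.
Fact complZDl x : {morph complZ^~ x : a b / a + b}.
Proof. by move=> c d; apply: compl_val_inj; rewrite /= scalerDl. Qed.
HB.instance Definition _ := GRing.Zmodule_isLmodule.Build R[i] completion
  complZA complZ1 complZDr complZDl.

Definition compl_norm x : R[i] := `|compl_val x|.
Fact compl_normD x y : compl_norm (x + y) <= compl_norm x + compl_norm y.
Proof. exact: ler_normD. Qed.
Fact compl_normZ (c : R[i]) x : compl_norm (c *: x) = `|c| * compl_norm x.
Proof. exact: normrZ. Qed.
Fact compl_norm0_eq0 x : compl_norm x = 0 -> x = 0.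
Proof. by move=> /normr0_eq0 x0; exact: compl_val_inj. Qed.
HB.instance Definition _ :=
  Lmodule_isNormed.Build R[i] completion compl_normD compl_normZ compl_norm0_eq0.

Lemma completion_complete (F : set_system completion) :
  ProperFilter F -> cauchy F -> cvg F.
Proof.
apply: seq_complete => u uc.
have [|l ul] := @tends_cauchy R _ (fun n => compl_val (u n)).
  by move=> e /uc[N uN]; exists N => n m nN mN; exact: uN.
have lP : closure (range functional) l.
  by apply: (seq_closed_closure _ ul) => n; exact: compl_valP.
exists (Completion lP) => e /ul[N uN]; exists N => n nN; exact: uN.
Qed.
HB.instance Definition _ :=
  Uniform_isComplete.Build completion completion_complete.

Definition iota v : completion :=
  Completion (subset_closure (imageT functional v)).

Lemma iota_linear : linear iota.
Proof. by move=> c v w; apply: compl_val_inj; rewrite /= functional_linear. Qed.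

Lemma nr_iota v : nr (iota v) = sn v.
Proof. exact: nr_functional. Qed.

Lemma iota_eq v w : (forall a, s v a = s w a) -> iota v = iota w.
Proof. by move=> vw; apply: compl_val_inj; apply: linfP => -[z z1] /=. Qed.

Lemma iota_seq x : exists v : nat -> V, tends (fun n => iota (v n)) x.
Proof.
have /closure_tends[u uS ux] := @compl_valP x.
have /choice[v vu] : forall n, exists v, functional v = u n.
  by move=> n; have [v _ <-] := uS n; exists v.
by exists v => e /ux[N uN]; exists N => n /uN; rewrite -vu.
Qed.

Lemma iota_dense : closure (range iota) = setT.
Proof.
apply/seteqP; split=> // x _; have [v vx] := iota_seq x.
by apply/closure_tends; exists (iota \o v) => // n; exists (v n).
Qed.

Definition sqn x : R[i] := (nr x ^+ 2)%:C%C.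

Lemma tends_sqn (u : nat -> completion) x : tends u x ->
  tends (fun n => sqn (u n) : R[i]^o) (sqn x).
Proof.
move=> ux; have [N [M uM]] := tends_bounded ux.
have h : null (fun n => (M%:R + nr x) * nr (u n - x)).
  by apply: nullZ => // n; exact: nr_ge0.
move=> e /h[K hK]; exists (maxn N K) => n; rewrite geq_max => /andP[/uM un /hK].
apply: le_lt_trans.
rewrite -[nr _]/(cabs _) -rmorphB cabs_real.
have -> : nr (u n) ^+ 2 - nr x ^+ 2 = (nr (u n) + nr x) * (nr (u n) - nr x) by ring.
have hx := nr_ge0 x; have hu := nr_ge0 (u n).
rewrite normrM (ger0_norm (addr_ge0 hu hx)) ler_pM ?addr_ge0 // ?lerD2r //.
rewrite ler_norml; have := nr_dist_le (u n) x; have := nr_dist_le x (u n).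
by rewrite (nrB x); lra.
Qed.

(** Polarization of the squared norm. It is continuous by construction, so the laws of an inner
    product pass from the dense image of [iota] to all of the completion. *)
Definition pinner x y : R[i] :=
  4^-1 * (sqn (x + y) - sqn (x - y) + ic * sqn (x + ic *: y) - ic * sqn (x - ic *: y)).

Lemma pinner_iota v w : pinner (iota v) (iota w) = s v w.
Proof.
have e c : sqn (iota v + c *: iota w) =
    s v v + c^* * s v w + c * s w v + c * c^* * s w w.
  rewrite addrC -iota_linear /sqn nr_iota -snE !(siDl, siDr, siZl, siZr); ring.
have -> : pinner (iota v) (iota w) = 4^-1 * (sqn (iota v + 1 *: iota w) -
    sqn (iota v + (- 1) *: iota w) + ic * sqn (iota v + ic *: iota w) -
    ic * sqn (iota v + (- ic) *: iota w)).
  by rewrite /pinner scale1r scaleN1r scaleNr.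
rewrite !e !rmorphN rmorph1 /= ic_conj.
move: (s v v) (s v w) (s w v) (s w w) => p q r t.
by field: (@icic R).
Qed.

Lemma tends_cmul (c : R[i]) (u : nat -> R[i]^o) l : tends u l ->
  tends (fun n => c * u n : R[i]^o) (c * l).
Proof. exact: tendsZ. Qed.

Lemma tends_pinner (u v : nat -> completion) x y : tends u x -> tends v y ->
  tends (fun n => pinner (u n) (v n) : R[i]^o) (pinner x y).
Proof.
move=> ux vy; have iv := tendsZ ic vy.
apply: tends_cmul; apply: (@tendsB R R[i]^o).
  apply: (@tendsD R R[i]^o); first apply: (@tendsB R R[i]^o).
  - by apply: tends_sqn; exact: tendsD.
  - by apply: tends_sqn; exact: tendsB.
  by apply: tends_cmul; apply: tends_sqn; exact: tendsD.
by apply: tends_cmul; apply: tends_sqn; exact: tendsB.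
Qed.

Fact pinnerDl x y z : pinner (x + y) z = pinner x z + pinner y z.
Proof.
have [u ux] := iota_seq x; have [v vy] := iota_seq y; have [w wz] := iota_seq z.
apply: (@tends_uniq R R[i]^o _ _ _ (tends_pinner (tendsD ux vy) wz)).
rewrite (_ : (fun n => _) = fun n => pinner (iota (u n)) (iota (w n)) +
    pinner (iota (v n)) (iota (w n)) : R[i]^o).
  by apply: (@tendsD R R[i]^o); exact: tends_pinner.
by apply/funext => n; rewrite -(linear_funE iota_linear).1 !pinner_iota siDl.
Qed.

Fact pinnerZl (c : R[i]) x z : pinner (c *: x) z = c * pinner x z.
Proof.
have [u ux] := iota_seq x; have [w wz] := iota_seq z.
apply: (@tends_uniq R R[i]^o _ _ _ (tends_pinner (tendsZ c ux) wz)).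
rewrite (_ : (fun n => _) = fun n => c *: (pinner (iota (u n)) (iota (w n)) : R[i]^o)).
  by apply: (@tendsZ R R[i]^o); exact: tends_pinner.
by apply/funext => n; rewrite -(linear_funE iota_linear).2 !pinner_iota siZl.
Qed.

Fact pinnerC x y : pinner y x = (pinner x y)^*.
Proof.
have [u ux] := iota_seq x; have [v vy] := iota_seq y.
apply: (@tends_uniq R R[i]^o _ _ _ (tends_pinner vy ux)).
move=> e /(tends_pinner ux vy)[N uN]; exists N => n /uN; apply: le_lt_trans.
rewrite !pinner_iota siC -rmorphB -[nr _]/(cabs _) -[nr _]/(cabs _).
by rewrite -lecR -!cabsE norm_conjC.
Qed.

Fact pinner_norm x : pinner x x = `|x| ^+ 2.
Proof.
have [u ux] := iota_seq x.
apply: (@tends_uniq R R[i]^o _ _ _ (tends_pinner ux ux)).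
have -> : `|x| ^+ 2 = sqn x by rewrite nrE -rmorphXn.
rewrite (_ : (fun n => _) = fun n => sqn (iota (u n)) : R[i]^o).
  exact: tends_sqn.
by apply/funext => n; rewrite pinner_iota snE /sqn nr_iota.
Qed.

HB.instance Definition _ := isHilbert.Build R completion
  pinnerDl pinnerZl pinnerC pinner_norm.

Lemma inner_iota v w : inner (iota v) (iota w) = s v w.
Proof. exact: pinner_iota. Qed.

Lemma bop_iota_ext (S T : bounded_operator completion) :
  (forall v, S (iota v) = T (iota v)) -> S = T.
Proof.
move=> ST; apply: bounded_operatorP.
apply: (@bl_ext _ _ _ _ _ (range iota)).
- exact: op_linear.
- exact: op_bounded.
- exact: op_linear.
- exact: op_bounded.
- apply/seteqP; split=> // x _; have [v vx] := iota_seq x.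
  by apply/closure_tends; exists (iota \o v) => // n; apply: lin_span_gen; exists (v n).
by move=> _ [v _ <-].
Qed.

(** The adjoint relation makes T linear modulo null vectors and transfers the bound to T'; both maps
    thus descend to the completion and remain adjoint there. *)
Lemma lift_op (T T' : V -> V) (M : R) : 0 <= M ->
  (forall v w, s (T v) w = s v (T' w)) -> (forall v, sn (T v) <= M * sn v) ->
  exists O : bounded_operator completion, forall v, O (iota v) = iota (T v).
Proof.
move=> M0 adj TM.
have adj' v w : s (T' v) w = s v (T w) by rewrite siC -adj -siC.
have T'M v : sn (T' v) <= M * sn v.
  have [v0|v0] := eqVneq (sn (T' v)) 0; first by rewrite v0 mulr_ge0 ?sn_ge0.
  have {}v0 : 0 < sn (T' v) by rewrite lt_neqAle eq_sym v0 sn_ge0.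
  rewrite -(ler_pM2r v0) -expr2.
  have -> : sn (T' v) ^+ 2 = cabs (s v (T (T' v))).
    by rewrite -adj' snE cabs_real ger0_norm ?sqr_ge0.
  apply: le_trans (si_cauchy_schwarz _ _) _.
  by rewrite mulrC mulrAC ler_wpM2r ?sn_ge0.
have lin (S S' : V -> V) : (forall v w, s (S v) w = s v (S' w)) ->
    forall c a b, exists d, iota d = c *: iota a + iota b /\
      iota (S d) = c *: iota (S a) + iota (S b).
  move=> SS c a b; exists (c *: a + b); rewrite -!iota_linear; split=> //.
  by apply: iota_eq => d; rewrite SS !siDl !siZl !SS.
have [|f [fl fb _ fi]] := @extend_linear R _ _ _ iota (iota \o T) M M0
  iota_dense (lin _ _ adj).
  by move=> v; rewrite !nr_iota; first [exact: TM | exact: T'M].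
have [|g [gl gb _ gi]] := @extend_linear R _ _ _ iota (iota \o T') M M0
  iota_dense (lin _ _ adj').
  by move=> v; rewrite !nr_iota; first [exact: TM | exact: T'M].
have fg x y : inner (f x) y = inner x (g y).
  have [u ux] := iota_seq x; have [v vy] := iota_seq y.
  apply: (@tends_uniq R R[i]^o _ _ _ (tends_inner (tends_lin fl fb ux) vy)).
  rewrite (_ : (fun n => _) = fun n => inner (iota (u n)) (g (iota (v n))) : R[i]^o).
    by apply: tends_inner => //; exact: tends_lin.
  by apply/funext => n; rewrite fi gi /= !inner_iota adj.
by exists (BoundedOperator fl gl fb gb fg).
Qed.
End Completion.

Lemma iota_adjoint (R : realType) (V : lmodType R[i]) (s : semi_inner V)
    (T T' : V -> V) (S S' : bounded_operator (completion s)) :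
  (forall v w, s (T v) w = s v (T' w)) ->
  (forall v, S (iota s v) = iota s (T v)) ->
  (forall v, S' (iota s v) = iota s (T' v)) -> star S = S'.
Proof.
move=> TT ST S'T; apply: bop_iota_ext => x; rewrite S'T; apply: inner_inj => y.
have [v vy] := iota_seq y.
apply: (@tends_uniq R R[i]^o _ _ _ (tends_inner vy (tends_cst _))).
rewrite (_ : (fun n => _) = fun n => inner (iota s (v n)) (iota s (T' x)) : R[i]^o).
  exact: tends_inner vy (tends_cst _).
by apply/funext => n; rewrite /= -op_adjE ST !inner_iota TT.
Qed.

Lemma closed_span_lin (R : realType) (V : normedModType R[i]) (S : set V)
    (c : R[i]) x y :
  closed_span S x -> closed_span S y -> closed_span S (c *: x + y).
Proof.
move=> /closure_tends[u uT uy] /closure_tends[v vT vz].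
apply/closure_tends; exists (fun n => c *: u n + v n) => [n|].
  exact: lin_spanP.
by apply: tendsD => //; exact: tendsZ.
Qed.

Lemma closure_sub_span (R : realType) (V : normedModType R[i]) (S T : set V) :
  closed_span S = setT -> S `<=` closed_span T -> closed_span T = setT.
Proof.
move=> ST sub; apply/seteqP; split=> // x _.
have : closed_span S x by rewrite ST.
apply: closed_span_min => //.
- exact: closed_span0.
- by move=> c y z; exact: closed_span_lin.
exact: seq_closed_closure.
Qed.

Section GNS.
Variables (R : realType) (B : cstarType R) (f : multiplier B -> R).
Local Notation M := (multiplier B).
Hypothesis fD : forall x y, f (x + y) = f x + f y.
Hypothesis fZ : forall (t : R) x, f (t%:C%C *: x) = t * f x.
Hypothesis f_ge0 : forall x, pos x -> 0 <= f x.
Hypothesis f1 : f aone = 1.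
Hypothesis fskew : forall x, star x = - x -> f x = 0.

(** The state lives on the multipliers but the vectors are elements of B: all of M(B) acts by left
    multiplication, while the action of B itself stays non-degenerate. *)
Definition gns_form (x y : B) : R[i] := cstate f (star (mult_emb B y) ** mult_emb B x).

Fact gns_formDl x y z : gns_form (x + y) z = gns_form x z + gns_form y z.
Proof.
by rewrite /gns_form homD amulDr (linear_funE (cstate_linear fD fZ)).1.
Qed.
Fact gns_formZl (c : R[i]) x z : gns_form (c *: x) z = c * gns_form x z.
Proof.
by rewrite /gns_form homZ amulZr (linear_funE (cstate_linear fD fZ)).2.
Qed.
Fact gns_formC x y : gns_form y x = (gns_form x y)^*.
Proof. by rewrite -cstate_star // starM starK. Qed.
Fact gns_form_ge0 x : 0 <= gns_form x x.
Proof. exact: cstate_ge0. Qed.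

Definition gns_inner := SemiInner gns_formDl gns_formZl gns_formC gns_form_ge0.
Local Notation H := (completion gns_inner).

Lemma gns_sn x : sn gns_inner x ^+ 2 = f (mult_emb B (star x ** x)).
Proof.
apply: realC_inj; rewrite -snE homM hom_star; apply: cstate_sa => //.
by rewrite starM starK.
Qed.

Lemma gns_adj (m : M) x y : gns_form (mleft m x) y = gns_form x (mleft (star m) y).
Proof. by rewrite /gns_form !emb_l starM starK amulA. Qed.

(** The state is nonnegative on x^* (|m|^2 - m^* m) x. *)
Lemma gns_bound (m : M) x : sn gns_inner (mleft m x) <= nr m * sn gns_inner x.
Proof.
rewrite -(ler_pXn2r (n := 2)) ?nnegrE ?mulr_ge0 ?sn_ge0 ?nr_ge0 //.
rewrite exprMn !gns_sn -fZ; apply: state_le => //.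
  by rewrite homM hom_star; exact: pos_starM.
have p : pos (rs M (nr m ^+ 2) - star m ** m).
  by apply: pos_sub; rewrite ?nr_cstar // starM starK.
rewrite (_ : _ - _ = star (mult_emb B x) ** (rs M (nr m ^+ 2) - star m ** m)
  ** mult_emb B x); first exact: pos_conj.
by rewrite !homM !hom_star emb_l starM /rs; nc.
Qed.

Let gns_ex (m : M) : {O : bounded_operator H |
  forall x, O (iota gns_inner x) = iota gns_inner (mleft m x)}.
Proof.
apply: cid; apply: (lift_op (T' := mleft (star m)) (nr_ge0 m)).
- exact: gns_adj.
- exact: gns_bound.
Qed.

Definition gns_op (m : M) : bounded_operator H := sval (gns_ex m).

Lemma gns_opE m x : gns_op m (iota gns_inner x) = iota gns_inner (mleft m x).
Proof. exact: (svalP (gns_ex m)). Qed.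

Fact gns_op_linear : linear gns_op.
Proof.
move=> c m n; apply: bop_iota_ext => x.
by rewrite /= !gns_opE -iota_linear.
Qed.
Fact gns_opM m n : gns_op (m ** n) = gns_op m ** gns_op n.
Proof. by apply: bop_iota_ext => x; rewrite /= !gns_opE. Qed.
Fact gns_op_star m : gns_op (star m) = star (gns_op m).
Proof.
apply/esym/(iota_adjoint (T := mleft m) (T' := mleft (star m))) => [x y|x|x].
- exact: gns_adj.
- exact: gns_opE.
exact: gns_opE.
Qed.

Definition gns_hom : starHom M (bounded_operator H) :=
  StarHom gns_op_linear gns_opM gns_op_star.

Lemma gns_hom1 : gns_hom aone = aone.
Proof. by apply: bop_iota_ext => x; rewrite gns_opE. Qed.

Lemma gns_nondegenerate : nondegenerate_rep (hom_comp gns_hom (mult_emb B)).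
Proof.
have iB : forall x, nr (iota gns_inner x) <= 1 * nr x.
  move=> x; rewrite mul1r nr_iota -(ler_pXn2r (n := 2)) ?nnegrE ?sn_ge0 ?nr_ge0 //.
  rewrite gns_sn -[leRHS]mulr1 -f1 -fZ; apply: state_le => //.
    by rewrite homM hom_star; exact: pos_starM.
  apply: pos_sub; first by rewrite -hom_star starM starK.
  by rewrite nr_emb nr_cstar.
apply/seteqP; split=> // h _; have [v vh] := iota_seq h.
apply: (seq_closed_closure _ vh) => n; move: (v n) => {v vh} x.
have : closed_span [set z : B | exists a b, z = a ** b] x by exact: mul_dense.
apply: (@closed_span_min _ _ _ [set x | closed_span _ (iota gns_inner x)]) => /=.
- by rewrite (linearB_fun (@iota_linear _ _ _)).1.1; exact: closed_span0.
- by move=> c y z; rewrite iota_linear; exact: closed_span_lin.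
- move=> u l uS ul; apply: (seq_closed_closure (u := fun n => iota gns_inner (u n))) => //.
  apply: tends_lin ul; first exact: iota_linear.
  by apply/bounded_opP; exists 1.
move=> _ [a [b ->]]; apply: closed_span_gen; exists a, (iota gns_inner b).
by rewrite /= gns_opE.
Qed.

End GNS.

Section Representations.
Variables (R : realType) (B : cstarType R).
Local Notation M := (multiplier B).

Record closed_ideal (I : set B) : Prop := ClosedIdeal {
  cidl_left :> left_ideal I;
  cidl_right : forall x y, I x -> I (x ** y);
  cidl_star : forall x, I x -> I (star x);
  cidl_closed : seq_closed I
}.

Lemma closed_ideal0 : closed_ideal [set 0].
Proof.
split=> [|x y ->|x ->|u l u0 ul]; rewrite ?amul0l ?star0 //.
  by split=> // [c x y -> ->|x y ->]; rewrite ?scaler0 ?addr0 // amul0r.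
suff -> : l = 0 by []; apply: (tends_uniq ul).
by rewrite (_ : u = fun=> 0); [exact: tends_cst|exact/funext].
Qed.

Lemma gns_exists (I : set B) (b : B) (l : R) : closed_ideal I -> 0 < l ->
  (forall t i, t < l -> I i -> star i = i ->
     ~ pos (rs M t - mult_emb B (b ** star b) + mult_emb B i)) ->
  exists (H : hilbertType R) (rho : starHom M (bounded_operator H)),
    [/\ rho aone = aone, nondegenerate_rep (hom_comp rho (mult_emb B)),
      forall i, I i -> rho (mult_emb B i) = 0
    & exists xi : H, nr xi != 0 /\ l * nr xi ^+ 2 <= nr (rho (mult_emb B b) xi) ^+ 2].
Proof.
move=> idI l0 hl.
have [||||f [fD fZ fp f1 [fl fI fskew]]] := @state_exists R B I (b ** star b) l _ _ _ _ hl.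
- exact: idl0 idI.
- by move=> c x y; exact: idl_lin idI c x y.
- exact: cidl_star idI.
- by rewrite starM starK.
pose s := gns_inner fD fZ fp fskew.
exists (completion s), (gns_hom fD fZ fp fskew); split.
- exact: gns_hom1.
- exact: gns_nondegenerate.
- move=> i Ii; apply: bop_iota_ext => x; rewrite gns_opE.
  apply: nr_eq0; apply/eqP; rewrite nr_iota -sqrf_eq0 gns_sn fI //.
  apply: (idl_mul (cidl_left idI)); exact: (cidl_right idI).
exists (iota s (star b)).
have h1 : sn s (star b) ^+ 2 = f (mult_emb B (b ** star b)) by rewrite gns_sn starK.
rewrite gns_opE !nr_iota h1; split.
  by rewrite -sqrf_eq0 h1 gt_eqF // (lt_le_trans l0).
rewrite gns_sn /= starM starK.
have := @state_sqr _ _ f fD fZ fp f1 (mult_emb B (b ** star b)).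
rewrite -hom_star starM starK -homM !amulA => /(_ erefl); apply: le_trans.
by rewrite expr2 ler_wpM2r // (le_trans (ltW l0)).
Qed.

(** The zero ideal is used with level l = |b|^2: a t < l with b b^* <= t would bound |b b^*| by
    t. *)
Lemma gns_norm (b : B) : b != 0 ->
  exists (H : hilbertType R) (rho : starHom M (bounded_operator H)),
    [/\ rho aone = aone, nondegenerate_rep (hom_comp rho (mult_emb B))
    & exists xi : H, nr xi != 0 /\ nr b * nr xi <= nr (rho (mult_emb B b) xi)].
Proof.
move=> b0.
have nb : 0 < nr b.
  by rewrite lt_neqAle nr_ge0 andbT eq_sym; apply: contra_neq b0 => /nr_eq0.
have [||H [rho [r1 rn _ [xi [x0 rx]]]]] := @gns_exists [set 0] b (nr b ^+ 2) closed_ideal0.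
- by rewrite exprn_gt0.
- move=> t i tl -> _; rewrite hom0 addr0 => p.
  have pb : pos (mult_emb B (b ** star b)).
    by rewrite homM hom_star -{1}[mult_emb B b]starK; exact: pos_starM.
  have t0 : 0 <= t.
    rewrite leNgt; apply/negP => t0.
    have /nr_eq0 bb : nr (mult_emb B (b ** star b)) = 0.
      apply/eqP; rewrite eq_le nr_ge0 andbT.
      have pt : pos (rs M 0 - mult_emb B (b ** star b)).
        rewrite (_ : _ - _ = (rs M t - mult_emb B (b ** star b)) + rs M (- t)).
          by apply: pos_add => //; apply: pos_rs; rewrite oppr_ge0 ltW.
        by rewrite /rs rmorphN; lmod.
      exact: pos_nr_le pt _.
    have : nr (b ** star b) = 0 by rewrite -nr_emb bb nr0.
    rewrite -{1}[b]starK nr_cstar nr_star => /eqP; rewrite sqrf_eq0 => /eqP h.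
    by rewrite h ltxx in nb.
  have := pos_nr_le pb p t0; rewrite nr_emb -{1}[b]starK nr_cstar nr_star => h.
  by move: (lt_le_trans tl h); rewrite ltxx.
exists H, rho; split=> //; exists xi; split=> //.
by rewrite -(ler_pXn2r (n := 2)) ?nnegrE ?mulr_ge0 ?nr_ge0 // exprMn.
Qed.

(** The level is the square of a positive lower bound d for the distance from b^* to I: by
    [ideal_dist], an inequality b b^* <= t + i with t < d^2 would bring b^* closer to I than d. *)
Lemma gns_ideal (I : set B) (b : B) : closed_ideal I -> ~ I b ->
  exists (H : hilbertType R) (rho : starHom M (bounded_operator H)),
    [/\ rho aone = aone, nondegenerate_rep (hom_comp rho (mult_emb B)),
      forall i, I i -> rho (mult_emb B i) = 0 & rho (mult_emb B b) <> 0].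
Proof.
move=> idI nIb.
have [d d0 dist] : exists2 d : R, 0 < d & forall x, I x -> d <= nr (star b - x).
  apply: contrapT => no; apply: nIb; rewrite -[b]starK; apply: (cidl_star idI).
  have /choice[u uP] : forall n : nat, exists x, I x /\ nr (star b - x) < n.+1%:R^-1.
    move=> n; apply: contrapT => no'; apply: no; exists (n.+1%:R^-1) => [|x Ix].
      by rewrite invr_gt0.
    by rewrite leNgt; apply/negP => h; apply: no'; exists x.
  apply: (cidl_closed idI (u := u)) => [n|]; first by have [] := uP n.
  by apply: null_le (@null_inv R) => n; rewrite nrB ltW //; have [] := uP n.
have [||H [rho [r1 rn rI [xi [x0 rx]]]]] := @gns_exists I b (d ^+ 2) idI.
- by rewrite exprn_gt0.
- move=> t i td Ii is_ p.
  (* [ideal_dist] takes a nonnegative level; raising t to 0 keeps it below d^2. *)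
  pose t' := Num.max t 0.
  have t'd : t' < d ^+ 2 by rewrite /t' gt_max td exprn_gt0.
  have p' : pos (rs M t' - mult_emb B (star (star b) ** star b) + mult_emb B i).
    rewrite starK (_ : _ + _ = (rs M t - mult_emb B (b ** star b) + mult_emb B i)
        + rs M (t' - t)).
      by apply: pos_add => //; apply: pos_rs; rewrite subr_ge0 le_max lexx.
    by rewrite /rs rmorphB; lmod.
  have t'0 : 0 <= t' by rewrite le_max lexx orbT.
  have e0 : 0 < (d ^+ 2 - t') / 2 by rewrite divr_gt0 // subr_gt0.
  have [x Ix xd] := ideal_dist (cidl_left idI) t'0 Ii is_ p' e0.
  have : d ^+ 2 <= nr (star b - x) ^+ 2.
    by rewrite lerXn2r ?nnegrE ?nr_ge0 ?(ltW d0) ?dist.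
  move: xd; lra.
exists H, rho; split=> // r0.
move: rx; rewrite r0 /= nr0 expr0n /= leNgt => /negP; apply.
by rewrite mulr_gt0 ?exprn_gt0 // lt_neqAle eq_sym x0 nr_ge0.
Qed.
End Representations.

(** * The universal property in C*-algebras *)

Section Nondegenerate.
Variables (R : realType).

Lemma nd_cancel (B : cstarType R) (H : hilbertType R)
    (r : starHom B (bounded_operator H)) (X Y : bounded_operator H) :
  nondegenerate_rep r -> (forall c, X ** r c = Y ** r c) -> X = Y.
Proof.
move=> rn XY; apply: bounded_operatorP.
apply: (@bl_ext _ _ _ _ _ [set x | exists a h, x = r a h]).
- exact: op_linear.
- exact: op_bounded.
- exact: op_linear.
- exact: op_bounded.
- exact: rn.
by move=> _ [a [h ->]]; have := congr1 (fun Z : bounded_operator H => Z h) (XY a).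
Qed.

Lemma ext_star (B : cstarType R) (H : hilbertType R)
    (r : starHom B (bounded_operator H)) m e :
  nondegenerate_rep r -> extends_at r m e -> extends_at r (star m) (star e).
Proof.
move=> rn re b; apply: star_inj; apply: (nd_cancel rn) => c.
rewrite starM starK -amulA re -!hom_star -!homM; congr (r _).
by rewrite /= starK mleft_right.
Qed.

Lemma closed_span_map (V W : normedModType R[i]) (f : V -> W) (S : set V)
    (T : set W) x : linear f -> bounded_op f ->
  (forall x, S x -> closed_span T (f x)) -> closed_span S x -> closed_span T (f x).
Proof.
move=> fl fb ST; apply: (@closed_span_min _ _ _ [set x | closed_span T (f x)]) => //=.
- by rewrite (linearB_fun fl).1.1; exact: closed_span0.
- by move=> c y z; rewrite fl; exact: closed_span_lin.
- move=> u l uS ul; apply: (seq_closed_closure (u := fun n => f (u n))) => //.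
  exact: tends_lin.
Qed.

Lemma op_apply_bounded (H : hilbertType R) (h : H) :
  bounded_op (fun S : bounded_operator H => S h).
Proof.
apply/bounded_opP; exists (nr h); first exact: nr_ge0.
by move=> S; rewrite mulrC; exact: bnr_ge.
Qed.

Lemma nr_rep (B : cstarType R) (H : hilbertType R)
    (r : starHom B (bounded_operator H)) b h : nr (r b h) <= nr b * nr h.
Proof.
rewrite (le_trans (bnr_ge _ _)) // ler_wpM2r ?nr_ge0 //.
exact: (@hom_contractive R B (bounded_operator H) r b).
Qed.

Lemma hom_apply_bounded (B : cstarType R) (H : hilbertType R)
    (r : starHom B (bounded_operator H)) (h : H) : bounded_op (fun b => r b h).
Proof.
exact: bounded_op_comp (op_apply_bounded h) (hom_bounded r).
Qed.

Lemma hom_apply_linear (B : cstarType R) (H : hilbertType R)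
    (r : starHom B (bounded_operator H)) (h : H) : linear (fun b => r b h).
Proof. by move=> c x y; rewrite (hom_linear r). Qed.

Lemma nondegenerate_rep_comp (A B : cstarType R) (H : hilbertType R)
    (r : starHom B (bounded_operator H)) (f : starHom A B) :
  nondegenerate_rep r -> nondegenerate_hom f -> nondegenerate_rep (hom_comp r f).
Proof.
move=> rn fn; apply: (closure_sub_span rn) => _ [b [h ->]].
have : closed_span [set x | exists a b, x = f a ** b] b by rewrite [closed_span _]fn.
apply: (closed_span_map (f := fun b => r b h)).
- exact: hom_apply_linear.
- exact: hom_apply_bounded.
move=> _ [a [c ->]]; apply: closed_span_gen; exists a, (r c h).
by rewrite homM.
Qed.
End Nondegenerate.

Section PisoCovariance.
Variables (R : realType) (S : nmodType) (A : cstarType R).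
Variable alpha : S -> starAut A.

(** Any homomorphism of unital *-algebras preserves the relations, which involve only products and
    adjoints. *)
Lemma piso_cov_map (E F : unitalStarAlgType R) (rho : starHom E F)
    (pi : starHom A E) (V : S -> E) :
  piso_covariant alpha pi V ->
  piso_covariant alpha (hom_comp rho pi) (fun s => rho (V s)).
Proof.
case=> -[V1 V2] V3 V4; split=> [|s a|s a] /=.
- by split=> [s|s t]; rewrite -?hom_star -!homM ?V1 ?V2.
- by rewrite V3 !homM hom_star.
by rewrite -!hom_star -!homM V4.
Qed.

(** Writing V as V V^* V, the initial projection V^* V moves past pi a. *)
Lemma piso_comm (E : unitalStarAlgType R) (pi : starHom A E) (V : S -> E) s a :
  piso_covariant alpha pi V -> V s ** pi a = pi (alpha s a) ** V s.
Proof.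
case=> -[V1 V2] V3 V4.
transitivity (V s ** star (V s) ** V s ** pi a); first by rewrite V1.
by rewrite V3 -!amulA -V4 -!amulA.
Qed.
End PisoCovariance.

Section PisoUniversal.
Variables (R : realType) (S : nmodType) (A P : cstarType R).
Variables (alpha : S -> starAut A) (iA : starHom A P) (iS : S -> multiplier P).
Hypothesis hP : is_piso_crossed_product alpha iA iS.

Lemma piso_gen_value (H : hilbertType R) (r : starHom P (bounded_operator H))
    (V : S -> bounded_operator H) s a t x :
  nondegenerate_rep r -> (forall s, extends_at r (iS s) (V s)) ->
  mult_emb P x = star (iS s) ** mult_emb P (iA a) ** iS t ->
  r x = star (V s) ** r (iA a) ** V t.
Proof.
move=> rn rV xE; apply: (nd_cancel rn) => b.
rewrite -amulA rV -amulA -!homM (ext_star rn (rV s)); congr (r _).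
by apply: emb_inj; rewrite homM xE emb_l homM emb_l !amulA.
Qed.

Section Target.
Variables (D : cstarType R) (pi0 : starHom A D) (VD : S -> multiplier D).
Hypothesis pi0n : nondegenerate_hom pi0.
Hypothesis VDc : piso_covariant alpha (hom_comp (mult_emb D) pi0) VD.

Let compatible (H : hilbertType R) (rho : starHom (multiplier D) (bounded_operator H))
    (r : starHom P (bounded_operator H)) :=
  [/\ rho aone = aone, nondegenerate_rep (hom_comp rho (mult_emb D)),
    nondegenerate_rep r, forall a, r (iA a) = rho (mult_emb D (pi0 a))
  & forall s, extends_at r (iS s) (rho (VD s))].

(* A matching [d] is unique and [nr d <= nr x], because a representation of
   [multiplier D] almost norming [d] is compatible with some representation of [P];
   so the matching extends from the generators to [P]. *)
Let matches (x : P) (d : D) := forall (H : hilbertType R)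
  (rho : starHom (multiplier D) (bounded_operator H)) (r : starHom P (bounded_operator H)),
  compatible rho r -> r x = rho (mult_emb D d).

Let compatible_ex (H : hilbertType R)
    (rho : starHom (multiplier D) (bounded_operator H)) :
  rho aone = aone -> nondegenerate_rep (hom_comp rho (mult_emb D)) ->
  exists r : starHom P (bounded_operator H), compatible rho r.
Proof.
move=> r1 rn.
have [] := piso_universal hP (pi := hom_comp (hom_comp rho (mult_emb D)) pi0)
  (V := fun s => rho (VD s)).
- exact: nondegenerate_rep_comp.
- exact: piso_cov_map VDc.
by move=> r [h1 h2 h3]; exists r.
Qed.

Let matches_le x d : matches x d -> nr d <= nr x.
Proof.
move=> xd; have [->|d0] := eqVneq d 0; first by rewrite nr0 nr_ge0.
have [H [rho [r1 rn [xi [xi0 le]]]]] := gns_norm d0.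
have [r rc] := compatible_ex r1 rn.
have x0 : 0 < nr xi by rewrite lt_neqAle eq_sym xi0 nr_ge0.
rewrite -(ler_pM2r x0) (le_trans le) // -(xd _ _ _ rc).
exact: nr_rep.
Qed.

Let matches_lin c x y d e : matches x d -> matches y e ->
  matches (c *: x + y) (c *: d + e).
Proof.
by move=> xd ye H rho r rc; rewrite !(homD, homZ) (xd _ _ _ rc) (ye _ _ _ rc).
Qed.

Let matches_uniq x d e : matches x d -> matches x e -> d = e.
Proof.
move=> xd xe; apply/eqP; rewrite -subr_eq0; apply/eqP/nr_le0.
have := matches_le (matches_lin (-1) xe xd).
by rewrite !scaleN1r addNr nr0 addrC.
Qed.

Let matches_gen s a t x :
  mult_emb P x = star (iS s) ** mult_emb P (iA a) ** iS t ->
  matches x (mleft (star (VD s)) (mright (VD t) (pi0 a))).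
Proof.
move=> xE H rho r [r1 rn rP ra rV].
by rewrite (piso_gen_value rP rV xE) emb_l emb_r !homM hom_star ra amulA.
Qed.

Let matches_total : exists f : P -> D, forall x, matches x (f x).
Proof.
pose I := {xd : P * D | matches xd.1 xd.2}.
pose i (a : I) := (sval a).1; pose i' (a : I) := (sval a).2.
have ilin c (a b : I) : exists z, i z = c *: i a + i b /\ i' z = c *: i' a + i' b.
  case: a b => [[x d] /= xd] [[y e] /= ye].
  by exists (exist (fun xd => matches xd.1 xd.2) (c *: x + y, c *: d + e)
       (matches_lin c xd ye)).
have idense : closure (range i) = setT.
  apply/seteqP; split=> // x _; have : closed_span [set x | exists s a t,
    mult_emb P x = star (iS s) ** mult_emb P (iA a) ** iS t] x.
    by rewrite (piso_span hP).
  apply: closure_subset; apply: lin_span_min.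
  - have m0 : matches 0 0 by move=> H rho r rc; rewrite !hom0.
    by exists (exist (fun xd => matches xd.1 xd.2) (0, 0) m0).
  - by move=> c _ _ [a _ <-] [b _ <-]; have [z [<- _]] := ilin c a b; exists z.
  move=> y [s [a [t yE]]].
  by exists (exist (fun xd => matches xd.1 xd.2) (y, _) (matches_gen yE)).
have [|f [fl fb _ fi]] := @extend_linear R I P D i i' 1 ler01 idense ilin.
  by move=> a; rewrite mul1r; apply: matches_le; exact: (svalP a).
exists f => x H rho r rc; apply: bounded_operatorP => h.
apply: (@bl_ext _ _ _ (fun x => r x h) (fun x => rho (mult_emb D (f x)) h)
  _ _ _ _ _ (piso_span hP)).
- exact: hom_apply_linear.
- exact: hom_apply_bounded.
- by move=> c y z; rewrite fl !(homD, homZ).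
- exact: bounded_op_comp (hom_apply_bounded (hom_comp rho (mult_emb D)) h) fb.
move=> y [s [a [t yE]]].
pose z : I := exist (fun xd => matches xd.1 xd.2) (y, _) (matches_gen yE).
by rewrite [f y](fi z) (matches_gen yE rc).
Qed.

(** Since matching elements are unique, each identity valid in all compatible representations
    becomes an identity in D; linearity, products, adjoints and both values of Psi are obtained in
    this way. *)
Lemma piso_universal_cstar : exists Psi : starHom P D,
  (forall a, Psi (iA a) = pi0 a) /\
  (forall s, extends_at (hom_comp (mult_emb D) Psi) (iS s) (VD s)).
Proof.
have [f fP] := matches_total.
have fU x d : matches x d -> f x = d by move=> xd; exact: matches_uniq (fP x) xd.
have fl : linear f by move=> c x y; apply: fU; exact: matches_lin.
have fM x y : f (x ** y) = f x ** f y.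
  apply: fU => H rho r rc.
  by rewrite !homM (fP x _ _ _ rc) (fP y _ _ _ rc).
have fs x : f (star x) = star (f x).
  by apply: fU => H rho r rc; rewrite !hom_star (fP x _ _ _ rc).
exists (StarHom fl fM fs); split=> [a|s b] /=.
  by apply: fU => H rho r [_ _ _ ra _].
rewrite -emb_l; congr (mult_emb D _); apply/esym/fU => H rho r rc.
have [_ _ _ _ rV] := rc.
by rewrite -rV (fP b _ _ _ rc) emb_l homM.
Qed.
End Target.
End PisoUniversal.

(** * Representations of the tensor product with the step functions *)

Section MultiplicationMaps.
Variables (R : realType) (D : cstarType R).
Implicit Types d x : D.

Lemma amull_linear d : linear (fun x => d ** x).
Proof. by move=> c x y; rewrite amulDr amulZr. Qed.
Lemma amulr_linear d : linear (fun x => x ** d).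
Proof. by move=> c x y; rewrite amulDl amulZl. Qed.
Lemma amull_bounded d : bounded_op (fun x => d ** x).
Proof. by apply/bounded_opP; exists (nr d) => [|x]; [exact: nr_ge0|exact: nr_amul]. Qed.
Lemma amulr_bounded d : bounded_op (fun x => x ** d).
Proof.
by apply/bounded_opP; exists (nr d) => [|x]; [exact: nr_ge0|rewrite mulrC nr_amul].
Qed.
End MultiplicationMaps.

(** * Estimates valid for every C*-norm on the tensor product *)

Section TensorNorm.
Variables (R : realType) (B A T : cstarType R) (tens : B -> A -> T).
Hypothesis hT : is_tensor_product tens.
Implicit Types (f g : B) (a b : A).

Lemma tensZl c f a : tens (c *: f) a = c *: tens f a.
Proof. exact: (linear_funE (tens_linear_l hT a)).2. Qed.
Lemma tensBl f g a : tens (f - g) a = tens f a - tens g a.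
Proof. exact: (linearB_fun (tens_linear_l hT a)).2. Qed.
Lemma tensDr f a b : tens f (a + b) = tens f a + tens f b.
Proof. exact: (linear_funE (tens_linear_r hT f)).1. Qed.
Lemma tensZr c f a : tens f (c *: a) = c *: tens f a.
Proof. exact: (linear_funE (tens_linear_r hT f)).2. Qed.
Lemma tensBr f a b : tens f (a - b) = tens f a - tens f b.
Proof. exact: (linearB_fun (tens_linear_r hT f)).2. Qed.
Lemma tens0l a : tens 0 a = 0.
Proof. by rewrite (linearB_fun (tens_linear_l hT a)).1.1. Qed.
Lemma tens0r f : tens f 0 = 0.
Proof. by rewrite (linearB_fun (tens_linear_r hT f)).1.1. Qed.

(** The element g - k g is sqrt(1 - x^* x) g, expressed without a unit. *)
Lemma sqr_defect (D : cstarType R) (x g : D) : nr x <= 1 -> exists k : D,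
  star (g - k ** g) ** (g - k ** g) = star g ** g - star (x ** g) ** (x ** g).
Proof.
move=> x1; have [|k [_ kE ks _]] := @quasi_sqrt R D (star x ** x).
  by rewrite nr_cstar expr2 mulr_ile1 ?nr_ge0.
have {}ks : star k = k by apply: ks; rewrite starM starK.
exists k; rewrite starD starN !starM ks.
have -> : star g ** star x ** (x ** g) = star g ** (k + k - k ** k) ** g.
  by rewrite kE !amulA.
by nc.
Qed.

Lemma nr_star_split (t t' z : T) : star z ** z = star t ** t - star t' ** t' ->
  nr t' <= nr t.
Proof.
move=> zE; rewrite -(ler_pXn2r (n := 2)) ?nnegrE ?nr_ge0 //.
rewrite -!nr_cstar -!(nr_emb (_ ** _)).
have -> : star t ** t = star t' ** t' + star z ** z by rewrite zE addrC subrK.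
by rewrite homD; apply: nr_mono; rewrite homM hom_star; exact: pos_starM.
Qed.

(** After scaling to |f| <= 1, the difference of the two squares t^* t is itself some z^* z by
    [sqr_defect], and the norm is monotone on positive elements. *)
Lemma nr_tens_mull f g a : nr (tens (f ** g) a) <= nr f * nr (tens g a).
Proof.
have key x : nr x <= 1 -> nr (tens (x ** g) a) <= nr (tens g a).
  move=> /(sqr_defect g)[k kE]; apply: (@nr_star_split _ _ (tens (g - k ** g) a)).
  by rewrite !(tens_star hT) !(tens_mul hT) kE tensBl.
have [f0|f0] := eqVneq (nr f) 0.
  by rewrite (nr_eq0 f0) amul0l tens0l !nr0 mul0r.
have {}f0 : 0 < nr f by rewrite lt_neqAle eq_sym f0 nr_ge0.
have := key ((nr f)^-1%:C%C *: f).
rewrite nrZ ger0_norm ?invr_ge0 ?nr_ge0 // mulVf ?gt_eqF // => /(_ (lexx _)).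
rewrite amulZl tensZl nrZ ger0_norm ?invr_ge0 ?nr_ge0 //.
by rewrite ler_pdivrMl.
Qed.

Lemma nr_tens_mulr f a b : nr (tens f (a ** b)) <= nr a * nr (tens f b).
Proof.
have key x : nr x <= 1 -> nr (tens f (x ** b)) <= nr (tens f b).
  move=> /(sqr_defect b)[k kE]; apply: (@nr_star_split _ _ (tens f (b - k ** b))).
  by rewrite !(tens_star hT) !(tens_mul hT) kE tensBr.
have [a0|a0] := eqVneq (nr a) 0.
  by rewrite (nr_eq0 a0) amul0l tens0r !nr0 mul0r.
have {}a0 : 0 < nr a by rewrite lt_neqAle eq_sym a0 nr_ge0.
have := key ((nr a)^-1%:C%C *: a).
rewrite nrZ ger0_norm ?invr_ge0 ?nr_ge0 // mulVf ?gt_eqF // => /(_ (lexx _)).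
rewrite amulZl tensZr nrZ ger0_norm ?invr_ge0 ?nr_ge0 //.
by rewrite ler_pdivrMl.
Qed.

(** For F = f^* f, C = a^* a and t their elementary tensor, the two one-sided estimates give |t|^2 =
    |t^* t| <= |F| |C| |t|. *)
Lemma nr_tens f a : nr (tens f a) <= nr f * nr a.
Proof.
rewrite -(ler_pXn2r (n := 2)) ?nnegrE ?mulr_ge0 ?nr_ge0 // exprMn -!nr_cstar.
rewrite (tens_star hT) (tens_mul hT).
set F := star f ** f; set C := star a ** a; set t := tens F C.
have ts : star t = t by rewrite /t (tens_star hT) !starM !starK.
have h : nr t ^+ 2 <= nr F * nr C * nr t.
  rewrite -nr_cstar ts /t (tens_mul hT) (le_trans (nr_tens_mull _ _ _)) // -mulrA.
  by rewrite ler_wpM2l ?nr_ge0 // nr_tens_mulr.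
have [t0|t0] := eqVneq (nr t) 0; first by rewrite t0 mulr_ge0 ?nr_ge0.
by move: h; rewrite expr2 ler_pM2r // lt_neqAle eq_sym t0 nr_ge0.
Qed.

Lemma tens_bounded_l a : bounded_op (tens^~ a).
Proof.
apply/bounded_opP; exists (nr a); first exact: nr_ge0.
by move=> f; rewrite mulrC nr_tens.
Qed.

Lemma tens_bounded_r f : bounded_op (tens f).
Proof.
apply/bounded_opP; exists (nr f); first exact: nr_ge0.
by move=> a; rewrite nr_tens.
Qed.

Section Slice.
Variable q : B.
Hypotheses (qs : star q = q) (qq : q ** q = q) (q0 : q != 0).

Fact slice_linear : linear (tens q).
Proof. exact: tens_linear_r. Qed.
Fact sliceM a b : tens q (a ** b) = tens q a ** tens q b.
Proof. by rewrite (tens_mul hT) qq. Qed.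
Fact slice_star a : tens q (star a) = star (tens q a).
Proof. by rewrite (tens_star hT) qs. Qed.

(** A nonzero projection q makes this slice an injective homomorphism, and injective homomorphisms
    are isometric. *)
Lemma nr_slice a : nr (tens q a) = nr a.
Proof.
apply: (@injective_hom_isometric _ _ _ (StarHom slice_linear sliceM slice_star)).
move=> b c /= bc; apply/eqP; rewrite -subr_eq0; apply/eqP.
apply: (@tens_inj _ _ _ _ _ hT 1 (fun=> q) (fun=> b - c)) => //; last exact: ord0.
  move=> k; rewrite big_ord1 => /eqP; rewrite scaler_eq0 (negbTE q0) orbF.
  by move=> /eqP k0 i; rewrite (ord1 i).
by rewrite big_ord1 tensBr bc subrr.
Qed.
End Slice.
End TensorNorm.

Section StepFunctions.
Variables (R : realType) (G : ordGroupType).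
Implicit Types x y : G.

Lemma one_atM x y :
  one_at x ** one_at y = one_at (if x <= y then y else x) :> B_Gamma R G.
Proof. by apply: sub_val_inj; rewrite /= stepM. Qed.

Lemma one_at_star x : star (one_at x : B_Gamma R G) = one_at x.
Proof. by apply: sub_val_inj; rewrite /= step_star. Qed.

Lemma one_at_comm x y :
  one_at x ** one_at y = one_at y ** one_at x :> B_Gamma R G.
Proof. by apply: sub_val_inj; apply: linfP => z /=; rewrite mulrC. Qed.

Lemma one_at_dense : closed_span (range (@one_at R G)) = setT.
Proof.
apply/seteqP; split=> // f _.
have /closure_tends[u uS uf] : closed_span (range (@step R G)) (sub_val f).
  exact: (sub_valP f).
have /choice[v vP] : forall n, exists g : B_Gamma R G,
    lin_span (range (@one_at R G)) g /\ sub_val g = u n.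
  move=> n; move: (u n) (uS n); apply: lin_span_min.
  - by exists 0; split=> //; exact: lin_span0.
  - move=> c _ _ [g [gS <-]] [h [hS <-]]; exists (c *: g + h).
    by split=> //; exact: lin_spanP.
  by move=> _ [x _ <-]; exists (one_at x); split=> //; apply: lin_span_gen; exists x.
apply/closure_tends; exists v => [n|]; first by have [] := vP n.
move=> e /uf[N uN]; exists N => n /uN; apply: le_lt_trans.
by rewrite -(vP n).2.
Qed.

Lemma one_at_le x y : x <= y ->
  (one_at x ** one_at y = one_at y :> B_Gamma R G) *
  (one_at y ** one_at x = one_at y :> B_Gamma R G).
Proof. by move=> xy; rewrite (one_at_comm y) one_atM xy. Qed.

Lemma lt_total x y : ~~ (x <= y) -> y < x.
Proof.
move=> xy; rewrite lt_neqAle; have := le_totalG x y; rewrite (negbTE xy) /= => ->.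
by rewrite andbT; apply: contraNneq xy => ->.
Qed.

(* [y] is isolated from the finitely many larger points by some [z > y]. *)
Lemma separating_step (s : seq G) y : exists q : B_Gamma R G,
  [/\ star q = q, q ** q = q, q != 0
    & forall x, x \in s -> q ** one_at x = if x <= y then q else 0].
Proof.
(* Here z is the least listed point above y, and [None] stands for infinity when no listed point
   lies above y. *)
have [z yz zP] : exists2 z : option G, (if z is Some z then y < z else true)
    & forall x, x \in s -> (x <= y) || (if z is Some z then z <= x else false).
  elim: s => [|x s [z yz zP]]; first by exists None.
  have [xy|/lt_total yx] := boolP (x <= y).
    by exists z => // w; rewrite inE => /orP[/eqP->|/zP//]; rewrite xy.
  case: z yz zP => [z|] yz zP; last first.
    exists (Some x) => // w; rewrite inE => /orP[/eqP->|/zP]; first by rewrite lexx orbT.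
    by rewrite orbF => ->.
  have [zx|/lt_total/ltW xz] := boolP (z <= x).
    by exists (Some z) => // w; rewrite inE => /orP[/eqP->|/zP//]; rewrite zx orbT.
  exists (Some x) => // w; rewrite inE => /orP[/eqP->|/zP]; first by rewrite lexx orbT.
  by case/orP => [->//|zw]; rewrite (le_trans xz zw) orbT.
case: z yz zP => [z|] yz zP.
  exists (one_at y - one_at z); have yz' := ltW yz; split.
  - by rewrite starD starN !one_at_star.
  - nc_expand; rewrite !(one_at_le yz') !(one_at_le (lexx _)); lmod.
  - apply/eqP => /(congr1 (fun f : B_Gamma R G => (sub_val f : linf R G) y)) /eqP /=.
    by rewrite lexx lt_geF // subr0 oner_eq0.
  move=> x /zP; have [xy _|_ /= zx] := ifPn.
    by rewrite amulDl amulNl (one_at_le xy) (one_at_le (le_trans xy yz')).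
  by rewrite amulDl amulNl (one_at_le zx) (one_at_le (le_trans yz' zx)) subrr.
exists (one_at y); split; rewrite ?one_at_star ?(one_at_le (lexx _)) //.
  apply/eqP => /(congr1 (fun f : B_Gamma R G => (sub_val f : linf R G) y)) /eqP /=.
  by rewrite lexx oner_eq0.
by move=> x /zP; rewrite orbF => xy; rewrite xy (one_at_le xy).
Qed.
End StepFunctions.

Section TensorRepresentation.
Variables (R : realType) (G : ordGroupType) (A T : cstarType R).
Variable tens : B_Gamma R G -> A -> T.
Hypothesis hT : is_tensor_product tens.
Implicit Types (l : seq (G * A)) (x y : G) (a : A).

Definition tsum l : T := \sum_(u <- l) tens (one_at u.1) u.2.
(** The value at y of the A-valued step function represented by [tsum l]. *)
Definition psum l y : A := \sum_(u <- l | u.1 <= y) u.2.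

Lemma step_tens_dense :
  closed_span [set t | exists x a, t = tens (one_at x) a] = setT.
Proof.
apply: (closure_sub_span (tens_dense hT)) => _ [f [a ->]].
have : closed_span (range (@one_at R G)) f by rewrite one_at_dense.
apply: (closed_span_map (f := tens^~ a)).
- exact: tens_linear_l.
- exact: tens_bounded_l.
by move=> _ [x _ <-]; apply: closed_span_gen; exists x, a.
Qed.

(** A projection q from [separating_step] reduces [tsum l] to the slice of q over b = [psum l y];
    multiplying by the slice of b^* gives |b|^2 <= |b| |tsum l|. *)
Lemma nr_psum l y : nr (psum l y) <= nr (tsum l).
Proof.
have [q [qs qq q0 qP]] := separating_step R [seq u.1 | u <- l] y.
set b := psum l y.
have qt c : tens q c ** tsum l = tens q (c ** b).
  suff gen l' : {subset [seq u.1 | u <- l'] <= [seq u.1 | u <- l]} ->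
      tens q c ** tsum l' = tens q (c ** psum l' y) by exact: gen.
  elim: l' => [_|u l' IH sub].
    by rewrite /tsum /psum !big_nil !amul0r (tens0r hT).
  have {}IH := IH (fun x xl => sub x (mem_behead (s := _ :: _) xl)).
  rewrite /tsum /psum !big_cons amulDr -/(tsum l') -/(psum l' y) IH (tens_mul hT).
  rewrite qP ?sub ?mem_head //.
  by case: ifP => _; rewrite ?amulDr ?(tensDr hT) // (tens0l hT) add0r.
have [->|b0] := eqVneq b 0; first by rewrite nr0 nr_ge0.
have {}b0 : 0 < nr b.
  by rewrite lt_neqAle nr_ge0 andbT eq_sym; apply: contra_neq b0 => /nr_eq0.
rewrite -(ler_pM2l b0) -expr2 -nr_cstar -(nr_slice hT qs qq q0) -qt.
by rewrite (le_trans (nr_amul _ _)) // (nr_slice hT qs qq q0) nr_star.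
Qed.

Variables (E : unitalCstarType R) (pe : G -> E) (ph : starHom A E).
Hypothesis pe_star : forall x, star (pe x) = pe x.
Hypothesis peM : forall x y, x <= y -> pe x ** pe y = pe y.
Hypothesis pe_ph : forall x a, pe x ** ph a = ph a ** pe x.

Definition esum l : E := \sum_(u <- l) pe u.1 ** ph u.2.

Let peMr x y : x <= y -> pe y ** pe x = pe y.
Proof. by move=> xy; apply: star_inj; rewrite starM !pe_star peM. Qed.

Let ph_pos M c : nr c <= M -> pos (rs E (M ^+ 2) - ph (star c ** c)).
Proof.
move=> cM; apply: pos_sub; first by rewrite -hom_star starM starK.
rewrite (le_trans (hom_contractive _ _)) // nr_cstar.
by rewrite lerXn2r ?nnegrE ?nr_ge0 // (le_trans (nr_ge0 c)).
Qed.

Lemma star_sum_orth (x y : E) : star x ** y = 0 -> star y ** x = 0 ->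
  star (x + y) ** (x + y) = star x ** x + star y ** y.
Proof. by move=> xy yx; rewrite starD amulDl !amulDr xy yx addr0 add0r. Qed.

Let block (M : R) q c : star q = q -> q ** q = q ->
  (forall a, q ** ph a = ph a ** q) -> nr c <= M ->
  pos ((M ^+ 2)%:C%C *: q - star (q ** ph c) ** (q ** ph c)).
Proof.
move=> qs qq qc cM; have := pos_conj q (ph_pos cM); rewrite qs.
rewrite (_ : q ** _ ** q = (M ^+ 2)%:C%C *: q - q ** ph (star c ** c) ** q); last first.
  by rewrite /rs; nc_expand; rewrite qq; lmod.
rewrite (_ : q ** ph _ ** q = star (q ** ph c) ** (q ** ph c)) //.
have qc' : q ** star (ph c) = star (ph c) ** q by rewrite -hom_star qc.
by rewrite starM qs homM hom_star amulA qc' -!amulA -qc.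
Qed.

(* Abel summation along increasing points: on [pe x_i - pe x_(i+1)] the operator
   acts as the partial sum up to [x_i]. *)
Lemma esum_bound l x0 c (M : R) :
  path (fun u v : G * A => u.1 <= v.1) (x0, 0) l ->
  (forall y, x0 <= y -> nr (c + psum l y) <= M) ->
  pe x0 ** (pe x0 ** ph c + esum l) = pe x0 ** ph c + esum l /\
  pos ((M ^+ 2)%:C%C *: pe x0 -
    star (pe x0 ** ph c + esum l) ** (pe x0 ** ph c + esum l)).
Proof.
elim: l x0 c => [|[x1 a1] l IH] x0 c.
  move=> _ /(_ x0 (lexx _)); rewrite /psum /esum !big_nil !addr0 => cM.
  split; first by rewrite amulA peM.
  by apply: block; rewrite ?pe_star ?peM.
move=> /= /andP[x01 pl] hM.
have {}pl : path (fun u v : G * A => u.1 <= v.1) (x1, 0) l by case: (l) pl.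
have tr : transitive (fun u v : G * A => u.1 <= v.1).
  by move=> u v w; exact: le_trans.
have /allP lx := order_path_min tr pl.
have [||O1 O2] := IH x1 (c + a1) => //.
  move=> y x1y; have := hM y (le_trans x01 x1y).
  by rewrite /psum big_cons /= x1y addrA.
set O' := pe x1 ** ph (c + a1) + esum l in O1 O2.
pose q := pe x0 - pe x1.
have -> : pe x0 ** ph c + esum ((x1, a1) :: l) = q ** ph c + O'.
  by rewrite /O' /q /esum big_cons /= homD; nc.
have e00 := peM (lexx x0); have e11 := peM (lexx x1).
have e01 := peM x01; have e10 := peMr x01.
have qs : star q = q by rewrite /q starB !pe_star.
have qq : q ** q = q by rewrite /q; nc_expand; rewrite e00 e01 e10 e11; lmod.
have qc a : q ** ph a = ph a ** q by rewrite /q; nc_expand; rewrite !pe_ph.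
have e0O : pe x0 ** O' = O' by rewrite -O1 amulA e01.
have qO : q ** O' = 0 by rewrite /q amulDl amulNl O1 e0O subrr.
have Oq : star O' ** q = 0 by apply: star_inj; rewrite starM qs starK qO star0.
split.
  by rewrite amulDr e0O amulA {1}/q amulDr amulNr e00 e01.
have -> : star (q ** ph c + O') ** (q ** ph c + O') =
    star (q ** ph c) ** (q ** ph c) + star O' ** O'.
  have c1 : star (q ** ph c) ** O' = 0 by rewrite starM qs -amulA qO amul0r.
  have c2 : star O' ** (q ** ph c) = 0 by rewrite amulA Oq amul0l.
  exact: star_sum_orth.
rewrite (_ : _ - _ = ((M ^+ 2)%:C%C *: q - star (q ** ph c) ** (q ** ph c)) +
   ((M ^+ 2)%:C%C *: pe x1 - star O' ** O')); last by rewrite /q; lmod.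
apply: pos_add => //.
(* When the two points coincide, c alone is not a partial sum, but the block q vanishes. Otherwise
   every later point exceeds x0, and the partial sum at x0 is c. *)
have [x0x1|x0x1] := eqVneq x0 x1.
  have -> : q = 0 by rewrite /q x0x1 subrr.
  by rewrite scaler0 amul0l star0 amul0l subr0; exact: pos0.
apply: block => //.
have := hM x0 (lexx _); rewrite /psum big1_seq ?addr0 // => u /andP[ux ul].
have x1u : x1 <= u.1 by move: ul; rewrite inE => /orP[/eqP->//|/lx].
by move: x0x1; rewrite eq_le x01 /= (le_trans x1u ux).
Qed.

Lemma nr_esum l : nr (esum l) <= nr (tsum l).
Proof.
pose leT (u v : G * A) := u.1 <= v.1.
have leT_total : total leT by move=> u v; exact: le_totalG.
have -> : esum l = esum (sort leT l).
  by apply: perm_big; rewrite perm_sym perm_sort.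
have -> : tsum l = tsum (sort leT l).
  by apply: perm_big; rewrite perm_sym perm_sort.
have := sort_sorted leT_total l.
case: (sort leT l) => [|[x a] l'] /= pl; first by rewrite /esum big_nil nr0 nr_ge0.
have {}pl : path leT (x, 0) l' by case: (l') pl.
set t := tsum _.
have [|O1 O2] := @esum_bound l' x a (nr t) pl.
  move=> y xy; have := nr_psum ((x, a) :: l') y.
  by rewrite /psum big_cons /= xy.
have Ol : esum ((x, a) :: l') = pe x ** ph a + esum l' by rewrite /esum big_cons.
rewrite -Ol in O2.
rewrite -(ler_pXn2r (n := 2)) ?nnegrE ?nr_ge0 // -nr_cstar.
apply: pos_nr_le; [exact: pos_starM| |exact: sqr_ge0].
(* The operator vanishes on the range of 1 - pe x, and |t|^2 (1 - pe x) completes the bound to the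
   identity. *)
rewrite (_ : _ - _ = ((nr t ^+ 2)%:C%C *: pe x - star (esum ((x, a) :: l')) **
  esum ((x, a) :: l')) + (nr t ^+ 2)%:C%C *: (aone - pe x)); last first.
  by rewrite /rs; lmod.
apply: pos_add => //; apply: pos_scale; first exact: sqr_ge0.
exists (aone - pe x); split; first by rewrite starB star1 pe_star.
by nc_expand; rewrite (peM (lexx x)); lmod.
Qed.

(** By [nr_esum] the assignment on finite sums of steps is contractive for whichever C*-norm T
    carries; this plays the part of the nuclearity of the commutative factor. *)
Lemma tensor_rep : exists theta : starHom T E,
  forall x a, theta (tens (one_at x) a) = pe x ** ph a.
Proof.
have ilin c (l l' : seq (G * A)) : exists l0, tsum l0 = c *: tsum l + tsum l' /\
    esum l0 = c *: esum l + esum l'.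
  exists ([seq (u.1, c *: u.2) | u <- l] ++ l').
  rewrite /tsum /esum !big_cat !big_map !scaler_sumr /=.
  by split; congr (_ + _); apply: eq_bigr => u _; rewrite ?(tensZr hT) ?homZ ?amulZr.
have tgen x a : tsum [:: (x, a)] = tens (one_at x) a by rewrite /tsum big_seq1.
have idense : closure (range tsum) = setT.
  apply/seteqP; split=> // t _.
  have : closed_span [set t | exists x a, t = tens (one_at x) a] t.
    by rewrite step_tens_dense.
  apply: closure_subset; apply: lin_span_min.
  - by exists [::] => //; rewrite /tsum big_nil.
  - by move=> c _ _ [l _ <-] [l' _ <-]; have [l0 [<- _]] := ilin c l l'; exists l0.
  by move=> _ [x [a ->]]; exists [:: (x, a)].
have [|f [fl fb _ fi]] := @extend_linear R _ T E tsum esum 1 ler01 idense ilin.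
  by move=> l; rewrite mul1r; exact: nr_esum.
have fg x a : f (tens (one_at x) a) = pe x ** ph a.
  by rewrite -tgen fi /esum big_seq1.
have fM1 x a t : f (tens (one_at x) a ** t) = f (tens (one_at x) a) ** f t.
  apply: (bl_ext (f := fun t => f (tens (one_at x) a ** t))
    (g := fun t => f (tens (one_at x) a) ** f t) _ _ _ _ step_tens_dense _ t).
  - exact: linear_fun_comp fl (amull_linear _).
  - exact: bounded_op_comp fb (amull_bounded _).
  - exact: linear_fun_comp (amull_linear _) fl.
  - exact: bounded_op_comp (amull_bounded _) fb.
  move=> _ [y [b ->]]; rewrite (tens_mul hT) one_atM !fg homM.
  have -> : pe x ** ph a ** (pe y ** ph b) = pe x ** pe y ** (ph a ** ph b).
    by rewrite -!amulA [ph a ** (pe y ** _)]amulA -pe_ph -!amulA.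
  case: ifPn => [xy|/lt_total/ltW yx]; first by rewrite peM.
  by rewrite peMr.
have fM s t : f (s ** t) = f s ** f t.
  apply: (bl_ext (f := fun s => f (s ** t)) (g := fun s => f s ** f t)
    _ _ _ _ step_tens_dense _ s).
  - exact: linear_fun_comp fl (amulr_linear _).
  - exact: bounded_op_comp fb (amulr_bounded _).
  - exact: linear_fun_comp (amulr_linear _) fl.
  - exact: bounded_op_comp (amulr_bounded _) fb.
  by move=> _ [x [a ->]]; exact: fM1.
have fs t : star (f (star t)) = f t.
  apply: (bl_ext (f := fun t => star (f (star t))) _ _ fl fb step_tens_dense _ t).
  - by move=> c x y; rewrite !starD !starZ fl starD starZ conjCK.
  - have /bounded_opP[M M0 fM'] := fb; apply/bounded_opP; exists M => // x.
    by rewrite nr_star -(nr_star x).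
  move=> _ [x [a ->]]; rewrite (tens_star hT) one_at_star !fg.
  by rewrite starM -hom_star starK pe_star pe_ph.
have fstar t : f (star t) = star (f t) by rewrite -fs starK.
by exists (StarHom fl fM fstar).
Qed.
End TensorRepresentation.

(** * Dilation of a semigroup of coisometries *)

Section OrderedGroup.
Variable G : ordGroupType.
Implicit Types (x y z : G) (t : pcone G).

Lemma leG_add2r z x y : x <= y -> x + z <= y + z.
Proof. by rewrite ![_ + z]addrC; exact: lerD_shift. Qed.

Lemma subG_ge0 x y : x <= y -> 0 <= y - x.
Proof. by move=> /(leG_add2r (- x)); rewrite subrr. Qed.

Lemma leG_subLR x y z : x - y <= z -> x <= z + y.
Proof. by move=> /(leG_add2r y); rewrite subrK. Qed.

Lemma leG_addr x t : x <= x + val t.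
Proof. by have := lerD_shift x _ _ (pcone_valP t); rewrite addr0. Qed.

Lemma pcone_diff x y : x <= y -> exists t, y = x + val t.
Proof. by move=> xy; exists (PCone _ (subG_ge0 xy)); rewrite /= addrC subrK. Qed.

Lemma pcone_of x : 0 <= x -> exists t : pcone G, x = val t.
Proof. by move=> x0; exists (PCone _ x0). Qed.

Definition gmax x y := if x <= y then y else x.

Lemma gmax_le x y z : gmax x y <= z -> x <= z /\ y <= z.
Proof.
rewrite /gmax; case: ifPn => [xy|/lt_total/ltW yx] h.
  by split=> //; exact: le_trans h.
by split=> //; exact: le_trans h.
Qed.

Definition ev (P : G -> Prop) := exists x0, forall x, x0 <= x -> P x.

Lemma evI (P Q : G -> Prop) : ev P -> ev Q -> ev (fun x => P x /\ Q x).
Proof.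
move=> [x Px] [y Qy]; exists (gmax x y) => z /gmax_le[xz yz].
by split; [exact: Px|exact: Qy].
Qed.

Lemma ev_ge x : ev (fun y => x <= y). Proof. by exists x. Qed.

Lemma evS (P Q : G -> Prop) : (forall x, P x -> Q x) -> ev P -> ev Q.
Proof. by move=> PQ [x Px]; exists x => y /Px/PQ. Qed.

Lemma ev_cst (P : Prop) : ev (fun=> P) -> P.
Proof. by case=> x /(_ x (lexx _)). Qed.

Lemma ev_shift (P : G -> Prop) y : ev P -> ev (fun x => P (x + y)).
Proof. by move=> [x Px]; exists (x - y) => z /leG_subLR/Px. Qed.
End OrderedGroup.

Section ActionInverse.
Variables (R : realType) (G : ordGroupType) (A : cstarType R).
Variable alpha : pcone G -> starAut A.
Hypothesis halpha : is_action alpha.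
Implicit Types (s t : pcone G) (a : A).

Lemma alphaD s t a : alpha (s + t) a = alpha s (alpha t a).
Proof. exact: halpha.2. Qed.

Lemma alpha_inv_add s t a : alpha s (aut_inv (alpha (t + s)) a) = aut_inv (alpha t) a.
Proof.
apply: (can_inj (autK (alpha t))); rewrite -alphaD.
by rewrite (autK (aut_inv (alpha (t + s)))) (autK (aut_inv (alpha t))).
Qed.

Lemma alpha_inv0 a : aut_inv (alpha 0) a = a.
Proof. by rewrite -[RHS](autK (alpha 0)) halpha.1. Qed.

(** The extended action is defined by cases on the sign of g; a translation into the cone reduces
    computations with it to addition there. *)
Lemma alpha_inv_ext s t (g : G) a : val s + g = val t ->
  aut_inv (alpha s) (aut_inv (extend_action alpha g) a) = aut_inv (alpha t) a.
Proof.
move=> st; apply: (can_inj (autK (alpha s))).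
rewrite (autK (aut_inv (alpha s))) /extend_action; case: insubP => [r _ rg|g0].
  have -> : t = s + r by apply: val_inj; rewrite -st -rg.
  by rewrite addrC alpha_inv_add.
have g0' : 0 <= - g.
  by have := subG_ge0 (ltW (lt_total g0)); rewrite sub0r.
set r := insubd _ _; have rg : val r = - g by rewrite insubdK.
have -> : s = r + t by apply: val_inj; rewrite /= rg -st addrCA addNr addr0.
rewrite alphaD (autK (aut_inv (alpha t))).
by [].
Qed.
End ActionInverse.

Record isometry_family (R : realType) (G : ordGroupType) (H : hilbertType R) :=
  IsometryFamily {
    isom_fun :> pcone G -> H -> H;
    isom_linear : forall t, linear (isom_fun t);
    isom_inner : forall t h k, inner (isom_fun t h) (isom_fun t k) = inner h k
  }.

(** * Germs at infinity of coherent functions *)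

Section CoherentFunctions.
Variables (R : realType) (G : ordGroupType) (H : hilbertType R).
Variable W : isometry_family G H.

(* No bound on a coherent function is required outside the range of large [x]:
   only the values there contribute to the inner product. *)
Record coherent := Coherent {
  coh_fun :> G -> H;
  cohP : ev (fun x => forall t, coh_fun (x + val t) = W t (coh_fun x))
}.
Implicit Types E F : coherent.

Lemma coh_inj E F : E =1 F -> E = F.
Proof.
case: E => e eP; case: F => f fP /= /funext ef; subst.
by congr Coherent; exact: Prop_irrelevance.
Qed.

HB.instance Definition _ := gen_eqMixin coherent.
HB.instance Definition _ := gen_choiceMixin coherent.

Fact coh0P : ev (fun x : G => forall t, (0 : H) = W t 0).
Proof. by exists 0 => x _ t; rewrite (linearB_fun (isom_linear W t)).1.1. Qed.
Fact cohNP E : ev (fun x => forall t, - E (x + val t) = W t (- E x)).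
Proof.
by apply: evS (cohP E) => x Ex t; rewrite (linearB_fun (isom_linear W t)).1.2 Ex.
Qed.
Fact cohDP E F :
  ev (fun x => forall t, E (x + val t) + F (x + val t) = W t (E x + F x)).
Proof.
by apply: evS (evI (cohP E) (cohP F)) => x [Ex Fx] t;
  rewrite (linear_funE (isom_linear W t)).1 Ex Fx.
Qed.
Fact cohZP (c : R[i]) E :
  ev (fun x => forall t, c *: E (x + val t) = W t (c *: E x)).
Proof.
by apply: evS (cohP E) => x Ex t; rewrite (linear_funE (isom_linear W t)).2 Ex.
Qed.

Definition coh0 : coherent := @Coherent (fun=> 0) coh0P.
Definition cohN E : coherent := @Coherent (fun x => - E x) (cohNP E).
Definition cohD E F : coherent := @Coherent (fun x => E x + F x) (cohDP E F).
Definition cohZ (c : R[i]) E : coherent := @Coherent (fun x => c *: E x) (cohZP c E).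

Fact cohDA : associative cohD.
Proof. by move=> x y z; apply: coh_inj => g; rewrite /= addrA. Qed.
Fact cohDC : commutative cohD.
Proof. by move=> x y; apply: coh_inj => g; rewrite /= addrC. Qed.
Fact coh0D : left_id coh0 cohD.
Proof. by move=> x; apply: coh_inj => g; rewrite /= add0r. Qed.
Fact cohND : left_inverse coh0 cohN cohD.
Proof. by move=> x; apply: coh_inj => g; rewrite /= addNr. Qed.
HB.instance Definition _ := GRing.isZmodule.Build coherent cohDA cohDC coh0D cohND.

Fact cohZA a b E : cohZ a (cohZ b E) = cohZ (a * b) E.
Proof. by apply: coh_inj => g; rewrite /= scalerA. Qed.
Fact cohZ1 : left_id 1 cohZ.
Proof. by move=> E; apply: coh_inj => g; rewrite /= scale1r. Qed.
Fact cohZDr : right_distributive cohZ +%R.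
Proof. by move=> c E F; apply: coh_inj => g; rewrite /= scalerDr. Qed.
Fact cohZDl E : {morph cohZ^~ E : a b / a + b}.
Proof. by move=> c d; apply: coh_inj => g; rewrite /= scalerDl. Qed.
HB.instance Definition _ := GRing.Zmodule_isLmodule.Build R[i] coherent
  cohZA cohZ1 cohZDr cohZDl.

(** The eventually constant value of the pointwise inner product; by [coh_innerP] the default 0 is
    not a separate case. *)
Definition coh_inner E F : R[i] :=
  xget 0 [set c | ev (fun x => inner (E x) (F x) = c)].

Lemma coh_innerP E F : ev (fun x => inner (E x) (F x) = coh_inner E F).
Proof.
rewrite /coh_inner; case: xgetP => // no; exfalso.
have [x0 x0P] := evI (cohP E) (cohP F).
apply: (no (inner (E x0) (F x0))); exists x0 => x /pcone_diff[t ->].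
by have [Ex Fx] := x0P _ (lexx _); rewrite Ex Fx isom_inner.
Qed.

Lemma coh_innerE E F c : ev (fun x => inner (E x) (F x) = c) -> coh_inner E F = c.
Proof.
move=> h; apply: (@ev_cst G).
by apply: evS (evI (coh_innerP E F) h) => x [<- <-].
Qed.

Fact coh_innerDl E F K : coh_inner (E + F) K = coh_inner E K + coh_inner F K.
Proof.
apply: coh_innerE; apply: evS (evI (coh_innerP E K) (coh_innerP F K)) => x [<- <-].
exact: innerDl.
Qed.
Fact coh_innerZl (c : R[i]) E K : coh_inner (c *: E) K = c * coh_inner E K.
Proof.
by apply: coh_innerE; apply: evS (coh_innerP E K) => x <-; exact: innerZl.
Qed.
Fact coh_innerC E F : coh_inner F E = (coh_inner E F)^*.
Proof.
by apply: coh_innerE; apply: evS (coh_innerP E F) => x <-; exact: innerC.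
Qed.
Fact coh_inner_ge0 E : 0 <= coh_inner E E.
Proof.
apply: (@ev_cst G); apply: evS (coh_innerP E E) => x <-; exact: inner_ge0.
Qed.

Definition coh_form := SemiInner coh_innerDl coh_innerZl coh_innerC coh_inner_ge0.

Lemma coh_eq E F : ev (fun x => E x = F x) -> iota coh_form E = iota coh_form F.
Proof.
move=> EF; apply: iota_eq => K; apply: coh_innerE.
by apply: evS (evI EF (coh_innerP F K)) => x [-> h]; exact: h.
Qed.

Lemma coh_sn_le E F (M : R) : 0 <= M -> ev (fun x => nr (E x) <= M * nr (F x)) ->
  sn coh_form E <= M * sn coh_form F.
Proof.
move=> M0 EF.
apply: (@ev_cst G); apply: evS (evI EF (evI (coh_innerP E E) (coh_innerP F F))).
move=> x [le [hE hF]].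
have snI (K : coherent) : inner (K x) (K x) = coh_inner K K -> sn coh_form K = nr (K x).
  move=> hK; apply/eqP; rewrite -(eqrXn2 (n := 2)) ?sn_ge0 ?nr_ge0 //; apply/eqP.
  by apply: realC_inj; rewrite -snE -inner_nr hK.
by rewrite !snI.
Qed.

Lemma coh_sn F (a : R) : ev (fun x => nr (F x) = a) -> sn coh_form F = a.
Proof.
move=> Fa; have a0 : 0 <= a.
  by apply: (@ev_cst G); apply: evS Fa => x <-; exact: nr_ge0.
apply/eqP; rewrite -(eqrXn2 (n := 2)) ?sn_ge0 //; apply/eqP/realC_inj.
by rewrite -snE; apply: coh_innerE; apply: evS Fa => x <-; rewrite inner_nr.
Qed.
End CoherentFunctions.

Section PositivePart.
Variable G : ordGroupType.
Implicit Types (x : G) (t : pcone G).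

(** The default 0 off the cone is harmless: only the values of coherent functions at large x
    count. *)
Definition pcone_part x : pcone G := insubd (0 : pcone G) x.

Lemma pcone_partE x : 0 <= x -> val (pcone_part x) = x.
Proof. by move=> x0; rewrite insubdK. Qed.

Lemma pcone_partD x t : 0 <= x -> pcone_part (x + val t) = pcone_part x + t.
Proof.
move=> x0; apply: val_inj; rewrite /= !pcone_partE //.
exact: le_trans x0 (leG_addr _ _).
Qed.

Lemma pcone_part_val t : pcone_part (val t) = t.
Proof. exact: valKd. Qed.
End PositivePart.

Section DilationSpace.
Variables (R : realType) (G : ordGroupType) (A : cstarType R).
Variables (alpha : pcone G -> starAut A) (H : hilbertType R).
Variables (pi : starHom A (bounded_operator H)) (V : pcone G -> bounded_operator H).
Hypotheses (halpha : is_action alpha) (pin : nondegenerate_rep pi).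
Hypothesis hV : piso_covariant alpha pi V.
Implicit Types (s t r : pcone G) (a b : A) (x y z : G) (h k : H).

(** Every element of A is some alpha_t c because alpha_t is onto, and V V^* fixes pi (alpha_t c) = V
    pi(c) V^*; non-degeneracy of pi concludes. *)
Lemma V_coisometry t : V t ** star (V t) = aone.
Proof.
have [[V1 _] V2 _] := hV; apply: (nd_cancel pin) => c.
rewrite amul1l -(autK (aut_inv (alpha t)) c).
by rewrite V2 !amulA V1.
Qed.

Lemma V0 : V 0 = aone.
Proof.
have [[_ VD] _ _] := hV; have /(congr1 (amul^~ (star (V 0)))) := VD 0 0.
by rewrite -amulA V_coisometry amul1r addr0 V_coisometry.
Qed.

Lemma VD s t h : V (s + t) h = V s (V t h).
Proof. by have [[_ <-] _ _] := hV. Qed.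

Definition Vs t h : H := star (V t) h.

Lemma VVs t h : V t (Vs t h) = h.
Proof. by have := congr1 (fun O : bounded_operator H => O h) (V_coisometry t). Qed.

Lemma VsD s t h : Vs (s + t) h = Vs s (Vs t h).
Proof.
have [[_ E] _ _] := hV.
by rewrite /Vs addrC -E starM.
Qed.

Fact Vs_linear t : linear (Vs t).
Proof. exact: op_linear. Qed.

Fact Vs_inner t h k : inner (Vs t h) (Vs t k) = inner h k.
Proof. by rewrite op_adjE -[op_adj _]/(V t : H -> H) VVs. Qed.

Definition Vs_family : isometry_family G H := IsometryFamily Vs_linear Vs_inner.

Lemma nr_Vs t h : nr (Vs t h) = nr h.
Proof.
apply/eqP; rewrite -(eqrXn2 (n := 2)) ?nr_ge0 //; apply/eqP/realC_inj.
by rewrite -!inner_nr Vs_inner.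
Qed.

Lemma nr_V t h : nr (V t h) <= nr h.
Proof.
have [v0|v0] := eqVneq (nr (V t h)) 0; first by rewrite v0 nr_ge0.
have {}v0 : 0 < nr (V t h) by rewrite lt_neqAle eq_sym v0 nr_ge0.
rewrite -(ler_pM2r v0) -{3}(nr_Vs t) -expr2.
have -> : nr (V t h) ^+ 2 = cabs (inner h (Vs t (V t h))).
  have <- : inner (V t h) (V t h) = inner h (Vs t (V t h)) by rewrite op_adjE.
  by rewrite inner_nr cabs_real ger0_norm ?sqr_ge0.
exact: cauchy_schwarz.
Qed.

Lemma V_pi t a h : V t (pi a h) = pi (alpha t a) (V t h).
Proof.
by have := congr1 (fun O : bounded_operator H => O h) (piso_comm t a hV).
Qed.

Lemma pi_Vs t a h : pi a (Vs t h) = Vs t (pi (alpha t a) h).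
Proof.
have /(congr1 star) := piso_comm t (star a) hV.
rewrite !starM -!hom_star starK => E.
by have := congr1 (fun O : bounded_operator H => O h) E.
Qed.

Local Notation F := (coherent Vs_family).
Local Notation pp := (@pcone_part G).
Implicit Types f g : F.

Fact dil_vecP h : ev (fun x => forall t, Vs (pp (x + val t)) h = Vs t (Vs (pp x) h)).
Proof. by apply: evS (ev_ge 0) => x x0 t; rewrite pcone_partD // addrC VsD. Qed.
Definition dil_vec h : F := @Coherent _ _ _ Vs_family (fun x => Vs (pp x) h) (dil_vecP h).

Fact dil_shiftP y f : ev (fun x => forall t, f (x + val t + y) = Vs t (f (x + y))).
Proof. by apply: evS (ev_shift y (cohP f)) => x fx t; rewrite addrAC fx. Qed.
Definition dil_shift y f : F :=
  @Coherent _ _ _ Vs_family (fun x => f (x + y)) (dil_shiftP y f).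

Fact dil_projP y f : ev (fun x => forall t,
  Vs (pp (x + val t + y)) (V (pp (x + val t + y)) (f (x + val t))) =
  Vs t (Vs (pp (x + y)) (V (pp (x + y)) (f x)))).
Proof.
apply: evS (evI (cohP f) (ev_shift y (ev_ge 0))) => x [fx x0] t.
by rewrite addrAC pcone_partD // fx /= VD VVs [_ + t]addrC VsD.
Qed.
Definition dil_proj y f : F := @Coherent _ _ _ Vs_family
  (fun x => Vs (pp (x + y)) (V (pp (x + y)) (f x))) (dil_projP y f).

Fact dil_piP a f : ev (fun x => forall t,
  pi (aut_inv (alpha (pp (x + val t))) a) (f (x + val t)) =
  Vs t (pi (aut_inv (alpha (pp x)) a) (f x))).
Proof.
apply: evS (evI (cohP f) (ev_ge 0)) => x [fx x0] t.
by rewrite pcone_partD // fx pi_Vs alpha_inv_add.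
Qed.
Definition dil_pi a f : F := @Coherent _ _ _ Vs_family
  (fun x => pi (aut_inv (alpha (pp x)) a) (f x)) (dil_piP a f).

Local Notation form := (coh_form Vs_family).
Local Notation K := (completion form).
Local Notation i := (iota form).

Lemma dil_shift_adj y f g : form (dil_shift y f) g = form f (dil_shift (- y) g).
Proof.
apply: coh_innerE.
apply: evS (ev_shift y (coh_innerP f (dil_shift (- y) g))) => x h.
by apply: etrans h; rewrite /= addrK.
Qed.
Lemma dil_shift_bound y f : sn form (dil_shift y f) <= 1 * sn form f.
Proof.
rewrite mul1r -(ler_pXn2r (n := 2)) ?nnegrE ?sn_ge0 // -lecR -!snE.
rewrite dil_shift_adj le_eqVlt; apply/orP; left; apply/eqP; apply: coh_innerE.
by apply: evS (coh_innerP f f) => x h; apply: etrans h; rewrite /= subrK.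
Qed.
Lemma dil_proj_adj y f g : form (dil_proj y f) g = form f (dil_proj y g).
Proof.
apply: coh_innerE; apply: evS (coh_innerP f (dil_proj y g)) => x h.
apply: etrans h => /=.
by rewrite op_adjE -[op_adj _]/(V _ : H -> H) op_adjE.
Qed.
Lemma dil_proj_bound y f : sn form (dil_proj y f) <= 1 * sn form f.
Proof.
apply: coh_sn_le => //; exists 0 => x _ /=.
by rewrite mul1r nr_Vs nr_V.
Qed.
Lemma dil_pi_adj a f g : form (dil_pi a f) g = form f (dil_pi (star a) g).
Proof.
apply: coh_innerE; apply: evS (coh_innerP f (dil_pi (star a) g)) => x h.
apply: etrans h => /=.
by rewrite op_adjE !hom_star.
Qed.
Lemma dil_pi_bound a f : sn form (dil_pi a f) <= nr a * sn form f.
Proof.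
apply: coh_sn_le; first exact: nr_ge0.
exists 0 => x _ /=; rewrite (le_trans (nr_rep _ _ _)) // ler_wpM2r ?nr_ge0 //.
exact: hom_contractive.
Qed.

Let U_ex y : {O : bounded_operator K | forall f, O (i f) = i (dil_shift y f)}.
Proof.
by apply: cid; exact: lift_op ler01 (dil_shift_adj y) (dil_shift_bound y).
Qed.
Let E_ex y : {O : bounded_operator K | forall f, O (i f) = i (dil_proj y f)}.
Proof.
by apply: cid; exact: lift_op ler01 (dil_proj_adj y) (dil_proj_bound y).
Qed.
Let P_ex a : {O : bounded_operator K | forall f, O (i f) = i (dil_pi a f)}.
Proof.
by apply: cid; exact: lift_op (nr_ge0 a) (dil_pi_adj a) (dil_pi_bound a).
Qed.
Definition U_op y := sval (U_ex y).
Definition E_op y := sval (E_ex y).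
Definition P_op a := sval (P_ex a).
Lemma U_opE y f : U_op y (i f) = i (dil_shift y f). Proof. exact: (svalP (U_ex y)). Qed.
Lemma E_opE y f : E_op y (i f) = i (dil_proj y f). Proof. exact: (svalP (E_ex y)). Qed.
Lemma P_opE a f : P_op a (i f) = i (dil_pi a f). Proof. exact: (svalP (P_ex a)). Qed.

Lemma E_op_star y : star (E_op y) = E_op y.
Proof.
by apply: (iota_adjoint (dil_proj_adj y)) => f; exact: E_opE.
Qed.

Lemma E_opM x y : x <= y -> E_op x ** E_op y = E_op y.
Proof.
move=> xy; apply: bop_iota_ext => f; rewrite /= !E_opE; apply: coh_eq.
apply: evS (ev_shift x (ev_ge 0)) => z z0 /=; have [t ->] := pcone_diff xy.
by rewrite addrA pcone_partD // VsD VVs.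
Qed.

Fact P_op_linear : linear P_op.
Proof.
move=> c a b; apply: bop_iota_ext => f.
rewrite /= !P_opE -iota_linear; apply: coh_eq; exists 0 => x _ /=.
by rewrite homD homZ homD homZ.
Qed.
Fact P_opM a b : P_op (a ** b) = P_op a ** P_op b.
Proof.
apply: bop_iota_ext => f; rewrite /= !P_opE; apply: coh_eq; exists 0 => x _ /=.
by rewrite !homM.
Qed.
Fact P_op_star a : P_op (star a) = star (P_op a).
Proof.
by apply/esym/(iota_adjoint (dil_pi_adj a)) => f; exact: P_opE.
Qed.
Definition P_hom : starHom A (bounded_operator K) := StarHom P_op_linear P_opM P_op_star.

Lemma E_op_comm y a : E_op y ** P_hom a = P_hom a ** E_op y.
Proof.
have [_ _ V3] := hV.
apply: bop_iota_ext => f; rewrite /= !(E_opE, P_opE); apply: coh_eq; exists 0 => x _ /=.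
by have := congr1 (fun O : bounded_operator H => O (f x))
  (V3 (pp (x + y)) (aut_inv (alpha (pp x)) a)).
Qed.

Lemma U_op_star y : star (U_op y) = U_op (- y).
Proof.
by apply: (iota_adjoint (dil_shift_adj y)) => f; exact: U_opE.
Qed.

Lemma U_opM x y : U_op x ** U_op y = U_op (x + y).
Proof.
apply: bop_iota_ext => f; rewrite /= !U_opE; apply: coh_eq; exists 0 => z _ /=.
by rewrite -addrA.
Qed.

Lemma U_op0 : U_op 0 = aone.
Proof.
apply: bop_iota_ext => f; rewrite /= !U_opE; apply: coh_eq; exists 0 => z _ /=.
by rewrite addr0.
Qed.

Lemma U_op_unitary : is_unitary_rep U_op.
Proof.
by split=> *; rewrite ?U_op_star U_opM ?addNr ?subrr ?U_op0.
Qed.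

Definition J h : K := i (dil_vec h).

Lemma J_linear : linear J.
Proof.
move=> c h k; rewrite /J -iota_linear; apply: coh_eq; exists 0 => x _ /=.
exact: Vs_linear.
Qed.

Lemma nr_J h : nr (J h) = nr h.
Proof.
by rewrite nr_iota; apply: coh_sn; exists 0 => x _ /=; rewrite nr_Vs.
Qed.

Lemma U_J t h : U_op (val t) (J h) = J (Vs t h).
Proof.
rewrite U_opE; apply: coh_eq; apply: evS (ev_ge 0) => x x0 /=.
by rewrite pcone_partD // VsD.
Qed.

(** At x = t + r the translated vector is W_r h. The operator of a turns it into W_r pi(alpha_t^-1
    a) h, and V_(t+r) W_r = V_t, so the projection yields W_(t+r) V_t pi(alpha_t^-1 a) h = W_x pi(a)
    V_t h. *)
Lemma E_P_J a t h : (E_op 0 ** P_hom a) (U_op (- val t) (J h)) = J (pi a (V t h)).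
Proof.
rewrite /= U_opE P_opE E_opE; apply: coh_eq.
apply: evS (ev_ge (val t)) => x /pcone_diff[r ->] /=.
rewrite addr0 addrAC subrr add0r -[val t + val r]/(val (t + r)) !pcone_part_val.
have e : alpha r (aut_inv (alpha (t + r)) a) = aut_inv (alpha t) a.
  exact: alpha_inv_add.
rewrite pi_Vs [alpha r _]e VD VVs V_pi.
by rewrite (autK (aut_inv (alpha t))).
Qed.
End DilationSpace.

Section Dilation.
Variables (R : realType) (G : ordGroupType) (A : cstarType R).
Variables (alpha : pcone G -> starAut A) (halpha : is_action alpha).
Variables (T : cstarType R) (tens : B_Gamma R G -> A -> T).
Hypothesis hT : is_tensor_product tens.
Variable gamma : G -> starAut T.
Hypothesis hgammaE : forall (s : G) (f : B_Gamma R G) (a : A),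
  gamma s (tens f a) = tens (tau s f) (aut_inv (extend_action alpha s) a).
Variables (C : cstarType R) (j : starHom T C) (u : G -> multiplier C).
Hypothesis hC : is_crossed_product gamma j u.
Variables (H : hilbertType R) (pi : starHom A (bounded_operator H))
  (V : pcone G -> bounded_operator H).
Hypotheses (pin : nondegenerate_rep pi) (hV : piso_covariant alpha pi V).

Local Notation K := (completion (coh_form (Vs_family pin hV))).
Local Notation U := (U_op pin hV).
Local Notation E := (E_op pin hV).
Local Notation Pi := (P_hom halpha pin hV).

Lemma dilated_tensor_rep : exists theta : starHom T (bounded_operator K),
  [/\ forall x a, theta (tens (one_at x) a) = E x ** Pi a,
    forall s t, theta (gamma s t) = U s ** theta t ** star (U s)
  & nondegenerate_rep theta].
Proof.
have [|||theta thetaE] := @tensor_rep R G A T tens hT _ E Pi.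
- exact: E_op_star.
- exact: E_opM.
- exact: E_op_comm.
have [Us sU UM] := U_op_unitary pin hV.
have cov s t : theta (gamma s t) = U s ** theta t ** star (U s).
  apply: (@bl_ext _ _ _ (fun t => theta (gamma s t))
    (fun t => U s ** theta t ** star (U s)) _ _ _ _ _ (step_tens_dense hT)).
  - by move=> c x y; rewrite !(homD, homZ).
  - exact: bounded_op_comp (hom_bounded _) (hom_bounded _).
  - by move=> c x y; rewrite !(homD, homZ) amulDr amulDl amulZr amulZl.
  - exact: bounded_op_comp (amulr_bounded (star (U s)))
      (bounded_op_comp (amull_bounded (U s)) (hom_bounded _)).
  move=> _ [x [a ->]]; rewrite hgammaE tau_one_at !thetaE U_op_star.
  apply: bop_iota_ext => f; rewrite /= !(U_opE, P_opE, E_opE).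
  apply: coh_eq; apply: evS (evI (ev_ge 0) (ev_shift s (ev_ge 0))) => z [z0 zs0] /=.
  rewrite addrK (addrA z) (addrAC z); congr (Vs V _ (V _ (pi _ _))).
  by apply: (alpha_inv_ext halpha); rewrite !pcone_partE.
exists theta; split=> //; apply/seteqP; split=> // v _.
have [f fv] := iota_seq v.
apply: (seq_closed_closure _ fv) => n; move: (f n) => {v f fv} f.
have [x0 fx0] := cohP f.
pose x := gmax x0 0; have [xx0 x00] := gmax_le (lexx x).
have fx t : f (x + val t) = Vs V t (f x).
  have [r ->] := pcone_diff xx0; rewrite -addrA -[val r + _]/(val (r + t)) !(fx0 _ (lexx _)).
  by rewrite addrC /= (VsD hV).
(* Beyond its threshold of coherence a function is determined by one value, so its germ is a
   translate of a vector of H. Non-degeneracy of theta is thereby reduced to that of pi. *)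
have -> : iota _ f = U (- x) (J pin hV (f x)).
  rewrite U_opE; apply: coh_eq; apply: evS (ev_ge x) => z /pcone_diff[t ->] /=.
  by rewrite addrAC subrr add0r pcone_part_val fx.
have : closed_span [set k | exists a h, k = pi a h] (f x) by rewrite [closed_span _]pin.
apply: (closed_span_map (f := fun h => U (- x) (J pin hV h))).
- by move=> c h k; rewrite J_linear op_linear.
- apply: bounded_op_comp (op_bounded _) _; apply/bounded_opP; exists 1 => // h.
  by rewrite mul1r nr_J.
move=> _ [a [h ->]]; apply: closed_span_gen.
exists (gamma (- x) (tens (one_at 0) a)), (U (- x) (J pin hV h)).
(* This is [E_P_J] at t = 0; covariance then moves theta in front of the translation. *)
have -> : J pin hV (pi a h) = theta (tens (one_at 0) a) (J pin hV h).
  have := E_P_J halpha pin hV a 0 h.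
  by rewrite oppr0 U_op0 thetaE (V0 pin hV) => <-.
have := congr1 (fun O : bounded_operator K => O (U (- x) (J pin hV h)))
  (cov (- x) (tens (one_at 0) a)) => /= ->.
congr (U _ (theta _ _)).
by have := congr1 (fun O : bounded_operator K => O (J pin hV h)) (Us (- x)).
Qed.

(** The two sides of the last identity are the values of corresponding spanning elements: u_s j(1_0
    tensor a) u_t^* in C, and the generator of P with the same data. *)
Lemma dilation : exists (L : hilbertType R) (Phi : starHom C (bounded_operator L))
    (W : G -> bounded_operator L) (f : H -> L),
  [/\ linear f, forall h, nr (f h) = nr h,
      nondegenerate_rep Phi, forall s, extends_at Phi (u s) (W s)
    & forall s a t h, W (val s) (Phi (j (tens (one_at 0) a)) (star (W (val t)) (f h)))
        = f (star (V s) (pi a (V t h)))].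
Proof.
have [theta [thetaE cov thetan]] := dilated_tensor_rep.
have [|Phi [Phin Phij PhiU]] := cp_universal hC (pi := theta) (V := U) thetan.
  by split; [exact: U_op_unitary|exact: cov].
exists K, Phi, U, (J pin hV); split=> //.
- exact: J_linear.
- exact: nr_J.
move=> s a t h; rewrite Phij thetaE U_op_star.
by rewrite (E_P_J halpha pin hV) U_J.
Qed.
End Dilation.

(** * Corners *)

Section ClosedSubspace.
Variables (R : realType) (V : normedModType R[i]).

Record closed_subspace (P : set V) : Prop := ClosedSubspace {
  csub0 : P 0;
  csub_lin : forall (c : R[i]) x y, P x -> P y -> P (c *: x + y);
  csub_closed : seq_closed P
}.

Lemma closed_span_subspace (S : set V) : closed_subspace (closed_span S).
Proof.
split; first exact: closed_span0; first by move=> c x y; exact: closed_span_lin.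
exact: seq_closed_closure.
Qed.
End ClosedSubspace.

Lemma subspace_preimage (R : realType) (V W : normedModType R[i]) (f : V -> W)
    (P : set W) : linear f -> bounded_op f -> closed_subspace P ->
  closed_subspace [set x | P (f x)].
Proof.
move=> fl fb [P0 Pl Pc]; split=> /=.
- by rewrite (linearB_fun fl).1.1.
- by move=> c y z Py Pz; rewrite fl; exact: Pl.
by move=> u l uS ul; apply: Pc (tends_lin fl fb ul).
Qed.

Lemma subspace_span (R : realType) (V W : normedModType R[i]) (f : V -> W)
    (P : set W) (S : set V) x : linear f -> bounded_op f -> closed_subspace P ->
  closed_span S x -> (forall x, S x -> P (f x)) -> P (f x).
Proof.
move=> fl fb cP Sx SP; have [P0 Pl Pc] := subspace_preimage fl fb cP.
exact: (closed_span_min P0 Pl Pc SP Sx).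
Qed.

Lemma closed_span_star (R : realType) (B : cstarType R) (S S' : set B) x :
  (forall x, S x -> closed_span S' (star x)) -> closed_span S x -> closed_span S' (star x).
Proof.
move=> SS; apply: (@closed_span_min _ _ S [set x | closed_span S' (star x)]) => //=.
- by rewrite star0; exact: closed_span0.
- by move=> c y z; rewrite starD starZ; exact: closed_span_lin.
- by move=> v l vS vl; apply: (seq_closed_closure (u := fun n => star (v n))) (tends_star vl).
Qed.

Section NondegenerateHom.
Variables (R : realType) (A C : cstarType R) (f : starHom A C).
Hypothesis fn : nondegenerate_hom f.
Local Notation e := (mult_emb C).

Lemma nd_hom_cancel (X Y : multiplier C) :
  (forall a, X ** e (f a) = Y ** e (f a)) -> X = Y.
Proof.
move=> XY; apply: multiplier_ext.
apply: (@bl_ext _ _ _ _ _ [set x | exists a b, x = f a ** b]) => //.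
- exact: mleft_linear.
- exact: mleft_bounded.
- exact: mleft_linear.
- exact: mleft_bounded.
move=> _ [a [b ->]]; rewrite !mleftM; congr (_ ** _).
by apply: emb_inj; rewrite !emb_l.
Qed.

Lemma ext_star_hom (m : multiplier A) (X : multiplier C) :
  extends_at (hom_comp e f) m X -> extends_at (hom_comp e f) (star m) (star X).
Proof.
move=> mX a; rewrite -[LHS]/(star X ** e (f a)) -[RHS]/(e (f (mleft (star m) a))).
apply: star_inj; apply: nd_hom_cancel => b.
have h : X ** e (f b) = e (f (mleft m b)) := mX b.
rewrite starM starK -amulA h -!hom_star -!homM; congr (e (f _)).
by rewrite /= starK mleft_right.
Qed.

Lemma ext_left (m : multiplier A) (X : multiplier C) a :
  extends_at (hom_comp e f) m X -> e (f (mleft m a)) = X ** e (f a).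
Proof. by move=> /(_ a). Qed.
End NondegenerateHom.

Section Corner.
Variables (R : realType) (C : cstarType R) (p : multiplier C).
Hypotheses (ps : star p = p) (pp : p ** p = p).
Local Notation e := (mult_emb C).
Implicit Types (m n : multiplier C) (x y : C).

Definition compress x : C := mleft p (mright p x).

Lemma emb_compress x : e (compress x) = p ** e x ** p.
Proof. by rewrite emb_l emb_r amulA. Qed.

Lemma compress_linear : linear compress.
Proof. exact: linear_fun_comp (@mleft_linear _ _ p) (@mright_linear _ _ p). Qed.

Lemma compress_bounded : bounded_op compress.
Proof. exact: bounded_op_comp (@mleft_bounded _ _ p) (@mright_bounded _ _ p). Qed.

Lemma compress_id x : p ** e x = e x -> e x ** p = e x -> compress x = x.
Proof. by move=> h1 h2; apply: emb_inj; rewrite emb_compress h1 h2. Qed.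

(** Describing the corner by fixed points of the bounded map x -> p x p makes it closed by
    continuity. *)
Fact corner_subP : is_cstar_sub [set x | compress x = x].
Proof.
have ce x : compress x = x -> p ** e x = e x /\ e x ** p = e x.
  move=> xE; have h := emb_compress x; rewrite xE in h.
  by split; rewrite h; [rewrite !amulA pp|rewrite -!amulA pp].
split=> /=.
- exact: (linearB_fun compress_linear).1.1.
- by move=> c x y xE yE; rewrite compress_linear xE yE.
- move=> x y /ce[x1 x2] /ce[y1 y2]; apply: compress_id; rewrite homM.
    by rewrite amulA x1.
  by rewrite -amulA y2.
- move=> x /ce[x1 x2]; apply: compress_id; rewrite hom_star; apply: star_inj.
    by rewrite starM starK ps.
  by rewrite starM starK ps.
apply/closed_seq => u l ul /= ul'.
have := tends_lin compress_linear compress_bounded ul'.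
rewrite (_ : (fun k => _) = u); first by move=> /tends_uniq; apply.
exact/funext.
Qed.

Definition corner_alg := sub_alg (CStarSub corner_subP).
HB.instance Definition _ := CStarAlgebra.on corner_alg.
Local Notation D := corner_alg.
Implicit Types d : D.

Lemma corner_l d : p ** e (sub_val d) = e (sub_val d).
Proof. by rewrite -[in LHS](sub_valP d) emb_compress !amulA pp -emb_compress (sub_valP d). Qed.
Lemma corner_r d : e (sub_val d) ** p = e (sub_val d).
Proof. by rewrite -[in LHS](sub_valP d) emb_compress -!amulA pp amulA -emb_compress (sub_valP d). Qed.

Fact compress_cornerP x : compress (compress x) = compress x.
Proof. by apply: emb_inj; rewrite !emb_compress !amulA pp -!amulA pp. Qed.

Definition to_corner x : D := @SubAlg R C (CStarSub corner_subP) _ (compress_cornerP x).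

Lemma to_corner_linear : linear to_corner.
Proof. by move=> c x y; apply: sub_val_inj; exact: compress_linear. Qed.
Lemma to_corner_bounded : bounded_op to_corner.
Proof. by have [M M0 hM] := compress_bounded; exists M. Qed.

Fact corner_incl_linear : linear (fun d => sub_val d : C). Proof. by []. Qed.
Fact corner_inclM d d' : sub_val (d ** d') = sub_val d ** sub_val d'. Proof. by []. Qed.
Fact corner_incl_star d : sub_val (star d) = star (sub_val d). Proof. by []. Qed.
Definition corner_incl : starHom D C :=
  StarHom corner_incl_linear corner_inclM corner_incl_star.

Lemma emb_to_corner x : e (sub_val (to_corner x)) = p ** e x ** p.
Proof. exact: emb_compress. Qed.

Section Restriction.
Variable m : multiplier C.
Let l d : D := to_corner (mleft m (sub_val d)).
Let r d : D := to_corner (mright m (sub_val d)).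

Let lE d : e (sub_val (l d)) = p ** m ** e (sub_val d).
Proof. by rewrite emb_to_corner emb_l -!amulA corner_r. Qed.
Let rE d : e (sub_val (r d)) = e (sub_val d) ** m ** p.
Proof. by rewrite emb_to_corner emb_r !amulA corner_l. Qed.

Let l_linear : linear l.
Proof. by move=> c d d'; rewrite /l /= mleft_linear to_corner_linear. Qed.
Let r_linear : linear r.
Proof. by move=> c d d'; rewrite /r /= mright_linear to_corner_linear. Qed.
Let l_bounded : bounded_op l.
Proof.
apply: bounded_op_comp to_corner_bounded _.
by have [M M0 hM] := @mleft_bounded _ _ m; exists M => // d; exact: hM.
Qed.
Let r_bounded : bounded_op r.
Proof.
apply: bounded_op_comp to_corner_bounded _.
by have [M M0 hM] := @mright_bounded _ _ m; exists M => // d; exact: hM.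
Qed.
Let l_mul d d' : l (d ** d') = l d ** d'.
Proof.
by apply: sub_val_inj; apply: emb_inj; rewrite lE !corner_inclM !homM lE !amulA.
Qed.
Let r_mul d d' : r (d ** d') = d ** r d'.
Proof.
by apply: sub_val_inj; apply: emb_inj; rewrite rE !corner_inclM !homM rE !amulA.
Qed.
Let l_r d d' : d ** l d' = r d ** d'.
Proof.
apply: sub_val_inj; apply: emb_inj; rewrite !corner_inclM !homM lE rE.
by rewrite !amulA corner_r -!amulA corner_l.
Qed.

(** The compression p m p acting on the corner; m is not supposed to preserve the corner. *)
Definition restr : multiplier D :=
  Multiplier l_linear r_linear l_bounded r_bounded l_mul r_mul l_r.

Lemma restrE d : e (sub_val (mleft restr d)) = p ** m ** e (sub_val d).
Proof. exact: lE. Qed.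
Lemma restr_rE d : e (sub_val (mright restr d)) = e (sub_val d) ** m ** p.
Proof. exact: rE. Qed.
End Restriction.

Lemma restr_ext m n : p ** m ** p = p ** n ** p -> restr m = restr n.
Proof.
move=> mn; apply: multiplier_ext => d; apply: sub_val_inj; apply: emb_inj.
by rewrite !restrE -(corner_l d) !amulA mn.
Qed.

Lemma restrM m n : restr m ** restr n = restr (m ** p ** n).
Proof.
apply: multiplier_ext => d; apply: sub_val_inj; apply: emb_inj.
by rewrite -[mleft (_ ** _) d]/(mleft _ (mleft _ d)) !restrE !amulA.
Qed.

Lemma restr_star m : restr (star m) = star (restr m).
Proof.
apply: multiplier_ext => d; apply: sub_val_inj; apply: emb_inj.
by rewrite restrE corner_incl_star hom_star restr_rE !starM ps -hom_star starK amulA.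
Qed.

Lemma restr_emb d : restr (e (sub_val d)) = mult_emb D d.
Proof.
apply: multiplier_ext => d'; apply: sub_val_inj; apply: emb_inj.
by rewrite restrE corner_inclM homM corner_l.
Qed.

Lemma restr_emb_inj m d d' : mult_emb D d = restr m ** mult_emb D d' ->
  e (sub_val d) = p ** m ** e (sub_val d').
Proof. by rewrite -emb_l => /emb_inj ->; rewrite restrE. Qed.
End Corner.

(** * The isomorphism onto the corner *)

Section StepCrossedProduct.
Variables (R : realType) (G : ordGroupType) (A : cstarType R).
Variables (alpha : pcone G -> starAut A) (halpha : is_action alpha).
Variables (T : cstarType R) (tens : B_Gamma R G -> A -> T).
Hypothesis hT : is_tensor_product tens.
Variable gamma : G -> starAut T.
Hypothesis hgammaE : forall (s : G) (f : B_Gamma R G) (a : A),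
  gamma s (tens f a) = tens (tau s f) (aut_inv (extend_action alpha s) a).
Variables (C : cstarType R) (j : starHom T C) (u : G -> multiplier C).
Hypothesis hC : is_crossed_product gamma j u.
Variable unit0 : multiplier T.
Hypothesis he : forall (f : B_Gamma R G) (a : A),
  mleft unit0 (tens f a) = tens (one_at 0 ** f) a.
Variable p : multiplier C.
Hypothesis hp : extends_at (hom_comp (mult_emb C) j) unit0 p.
Local Notation e := (mult_emb C).
Local Notation step x a := (j (tens (one_at x) a)).
Local Notation ai s := (aut_inv (extend_action alpha s)).
Implicit Types (x y z : G) (s t r : pcone G) (a b : A) (X Y : multiplier C).

Lemma ext_inv_neg s a : ai (- val s) a = alpha s a.
Proof.
apply: (can_inj (autK (aut_inv (alpha s)))); rewrite [RHS](autK (alpha s)).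
rewrite (alpha_inv_ext halpha (t := 0)) ?alpha_inv0 //.
by rewrite subrr.
Qed.

Lemma pcone_split x : exists s t, val s + x = val t.
Proof.
have /orP[/pcone_of[t ->]|x0] := le_totalG 0 x; first by exists 0, t; rewrite add0r.
have /pcone_of[s sE] : 0 <= - x by have := subG_ge0 x0; rewrite sub0r.
by exists s, 0; rewrite -sE addNr.
Qed.

Lemma ext_invK x a : ai x (ai (- x) a) = a.
Proof.
have [s [t st]] := pcone_split x.
apply: (can_inj (autK (aut_inv (alpha s)))).
rewrite (alpha_inv_ext halpha _ st); apply: (alpha_inv_ext halpha).
by rewrite -st addrK.
Qed.

Lemma uD x y : u x ** u y = u (x + y).
Proof. by have [[_ _ ->] _] := cp_cov hC. Qed.

Lemma u0 : u 0 = aone.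
Proof.
have [[uu _ uD'] _] := cp_cov hC.
by rewrite -(amul1l (u 0)) -(uu 0) -amulA uD' addr0.
Qed.

Lemma u_star x : star (u x) = u (- x).
Proof.
have [[uu _ _] _] := cp_cov hC.
by rewrite -[LHS]amul1r -u0 -(subrr x) -uD amulA uu amul1l.
Qed.

Lemma u_j x (t : T) : u x ** e (j t) = e (j (gamma x t)) ** u x.
Proof.
have [[uu _ _] cov] := cp_cov hC.
by have -> : e (j (gamma x t)) = _ := cov x t; rewrite -!amulA uu amul1r.
Qed.

Lemma u_step x y a : u x ** e (step y a) = e (step (y + x) (ai x a)) ** u x.
Proof. by rewrite u_j hgammaE tau_one_at. Qed.

Lemma p_tens f a : p ** e (j (tens f a)) = e (j (tens (one_at 0 ** f) a)).
Proof. by have := hp (tens f a); rewrite /= he. Qed.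

Lemma p_step_ge x a : 0 <= x -> p ** e (step x a) = e (step x a).
Proof. by move=> x0; rewrite p_tens one_at_le. Qed.

Lemma step_span (V : normedModType R[i]) (P : set V) (f : C -> V) (t : T) :
  linear f -> bounded_op f -> closed_subspace P ->
  (forall x a, P (f (step x a))) -> P (f (j t)).
Proof.
move=> fl fb cP h.
have : closed_span [set t | exists x a, t = tens (one_at x) a] t.
  by rewrite step_tens_dense.
move=> ht; apply: (subspace_span (f := f \o j) _ _ cP ht).
- exact: linear_fun_comp fl (hom_linear j).
- exact: bounded_op_comp fb (hom_bounded j).
by move=> _ [x [a ->]]; exact: h.
Qed.

Lemma closed_subspace0 : closed_subspace [set 0 : C].
Proof.
split=> // [c x y -> ->|v l v0 vl]; first by rewrite scaler0 addr0.
apply: (tends_uniq vl).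
by rewrite (_ : v = fun=> 0); [exact: tends_cst|exact/funext].
Qed.

Lemma step_cancel X Y : (forall x a, X ** e (step x a) = Y ** e (step x a)) -> X = Y.
Proof.
move=> XY; apply: (nd_hom_cancel (cp_nondegenerate hC)) => t.
rewrite -!emb_l; congr (e _); apply/eqP; rewrite -subr_eq0; apply/eqP.
apply: (step_span (P := [set 0]) (f := fun c => mleft X c - mleft Y c)).
- exact: @mleft_linear _ _ (X - Y).
- exact: @mleft_bounded _ _ (X - Y).
- exact: closed_subspace0.
move=> x a /=; apply: emb_inj.
by rewrite hom0 homB !emb_l XY subrr.
Qed.

(** The extension property describes p only as a left factor of elements of the range of j; steps
    placed on both sides bring in p^* as well. *)
Lemma p_star : star p = p.
Proof.
apply: step_cancel => x a; apply: star_inj; apply: step_cancel => y b.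
rewrite !starM starK -amulA p_tens -starM p_tens -!hom_star -!homM.
by rewrite !(tens_star hT) !(tens_mul hT) starM !one_at_star amulA.
Qed.

Lemma p_idem : p ** p = p.
Proof.
apply: step_cancel => x a.
by rewrite -amulA !p_tens amulA (one_at_le _ (lexx 0)).
Qed.

(** The image of 1_x tensor 1 in the multipliers of C, obtained by translating p. *)
Definition E x : multiplier C := u x ** p ** u (- x).

Lemma E_step x y a : E x ** e (step y a) = e (j (tens (one_at x ** one_at y) a)).
Proof.
rewrite /E -amulA u_step amulA -[u x ** p ** _]amulA p_tens u_j -amulA uD subrr u0.
by rewrite amul1r hgammaE homM !tau_one_at add0r subrK ext_invK.
Qed.

Lemma E_star x : star (E x) = E x.
Proof. by rewrite /E !starM p_star !u_star opprK amulA. Qed.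

Lemma step_E x y a : e (step y a) ** E x = e (j (tens (one_at x ** one_at y) a)).
Proof.
apply: star_inj; rewrite starM E_star -!hom_star !(tens_star hT) starM !one_at_star.
by rewrite E_step (one_at_comm _ y).
Qed.

Lemma E0 : E 0 = p.
Proof. by rewrite /E oppr0 u0 amul1l amul1r. Qed.

Lemma E_le x y : x <= y -> E x ** E y = E y.
Proof.
move=> xy; apply: step_cancel => z a.
by rewrite -amulA !E_step one_atM E_step -one_atM amulA (one_at_le _ xy).
Qed.

(** One has u_s p = E_s u_s, and E_s lies below p = E_0 because s >= 0. *)
Lemma p_u_p s : p ** u (val s) ** p = u (val s) ** p.
Proof.
have h : E (val s) ** u (val s) = u (val s) ** p.
  by rewrite /E -amulA uD addNr u0 amul1r.
by rewrite -amulA -h amulA -E0 E_le // pcone_valP.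
Qed.

Lemma p_uN_p s : p ** u (- val s) ** p = p ** u (- val s).
Proof.
by apply: star_inj; rewrite !starM p_star u_star opprK amulA p_u_p.
Qed.

Lemma step_comm_p x a : e (step x a) ** p = p ** e (step x a).
Proof. by rewrite -E0 step_E E_step. Qed.

(** A step at x absorbs E_x = u_x p u_(-x) on the right, which exhibits it as a product through
    p. *)
Lemma corner_full : full_corner p.
Proof.
split; first by split; [exact: p_star|exact: p_idem].
apply: (closure_sub_span (cp_nondegenerate hC)) => _ [t [d ->]].
apply: (step_span (f := fun c => c ** d)).
- exact: amulr_linear.
- exact: amulr_bounded.
- exact: closed_span_subspace.
move=> x a; apply: closed_span_gen.
exists (mright (u x) (step x a)), (mleft (u (- x)) d).
rewrite homM emb_r emb_l.
have h : e (step x a) = e (step x a) ** E x.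
  by rewrite step_E (one_at_le _ (lexx x)).
by rewrite [in LHS]h /E !amulA.
Qed.

(** * The ideal generated by differences of steps *)

Section Ideal.
Local Notation Binf := (@B_Gamma_infty R G).
Local Notation IT := (closed_span [set x : T | exists2 f : B_Gamma R G,
  B_Gamma_infty f & exists a : A, x = tens f a]).
Local Notation IC := (ideal_crossed_product j u IT).
Implicit Types (f : B_Gamma R G) (w v : T) (c d : C).

Lemma binf_gen x y : x <= y -> Binf (one_at x - one_at y).
Proof.
have [->|xy] := eqVneq x y; first by rewrite subrr => _; exact: closed_span0.
by move=> xy'; apply: closed_span_gen; exists x, y; rewrite lt_neqAle xy xy'.
Qed.

Lemma binf_mul f z : Binf f -> Binf (f ** one_at z).
Proof.
apply: (closed_span_map (f := fun f => f ** one_at z)).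
- exact: amulr_linear.
- exact: amulr_bounded.
move=> _ [x [y [/ltW xy ->]]]; rewrite amulDl amulNl !one_atM; apply: binf_gen.
case: ifPn => [xz|/lt_total/ltW zx].
  by case: ifPn => // /lt_total/ltW.
by case: ifPn => // yz; exact: le_trans xy yz.
Qed.

Lemma binf_star f : Binf f -> Binf (star f).
Proof.
apply: closed_span_star => _ [x [y [/ltW xy ->]]].
by rewrite starD starN !one_at_star; exact: binf_gen.
Qed.

Lemma binf_tau z f : Binf f -> Binf (tau z f).
Proof.
apply: (@closed_span_map R (B_Gamma R G) (B_Gamma R G) (tau z) _ _ f
  (hom_linear (tau z)) (hom_bounded (tau z))).
move=> _ [x [y [/ltW xy ->]]]; rewrite homB !tau_one_at; apply: binf_gen.
exact: leG_add2r.
Qed.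

Lemma IT_mulr w v : IT w -> IT (w ** v).
Proof.
apply: (closed_span_map (f := fun w => w ** v) (amulr_linear _) (amulr_bounded _)).
move=> _ [f fB [a ->]].
have : closed_span [set t | exists x a, t = tens (one_at x) a] v.
  by rewrite step_tens_dense.
apply: (closed_span_map (f := fun v => tens f a ** v) (amull_linear _) (amull_bounded _)).
move=> _ [x [b ->]]; rewrite (tens_mul hT); apply: closed_span_gen.
by exists (f ** one_at x); [exact: binf_mul|exists (a ** b)].
Qed.

Lemma IT_star w : IT w -> IT (star w).
Proof.
apply: closed_span_star => _ [f fB [a ->]]; rewrite (tens_star hT).
by apply: closed_span_gen; exists (star f); [exact: binf_star|exists (star a)].
Qed.

Lemma IT_gamma z w : IT w -> IT (gamma z w).
Proof.
apply: (closed_span_map (hom_linear (gamma z)) (hom_bounded (gamma z))).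
move=> _ [f fB [a ->]]; rewrite hgammaE.
by apply: closed_span_gen; exists (tau z f); [exact: binf_tau|exists (ai z a)].
Qed.

Lemma IC_j_mul w c : IT w -> IC (j w ** c).
Proof.
move=> wI; have : closed_span [set x | exists w z, e x = e (j w) ** u z] c.
  by rewrite (cp_span hC).
apply: (closed_span_map (f := fun c => j w ** c) (amull_linear _) (amull_bounded _)).
move=> x [v [s xE]]; apply: closed_span_gen; exists (w ** v); first exact: IT_mulr.
by exists s; rewrite !homM xE amulA.
Qed.

Lemma IC_mulr c d : IC c -> IC (c ** d).
Proof.
apply: (closed_span_map (f := fun c => c ** d) (amulr_linear _) (amulr_bounded _)).
move=> x [w wI [s xE]].
have -> : x ** d = j w ** mleft (u s) d.
  by apply: emb_inj; rewrite !homM xE emb_l amulA.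
exact: IC_j_mul.
Qed.

Lemma IC_star c : IC c -> IC (star c).
Proof.
apply: closed_span_star => x [w wI [s xE]]; apply: closed_span_gen.
exists (gamma (- s) (star w)); first by apply: IT_gamma; exact: IT_star.
by exists (- s); rewrite hom_star xE starM u_star -!hom_star u_j.
Qed.

Lemma IC_mull c d : IC d -> IC (c ** d).
Proof.
by move=> /IC_star/(@IC_mulr _ (star c))/IC_star; rewrite -starM starK.
Qed.

Lemma IC_step x y a c : x <= y -> IC (j (tens (one_at x - one_at y) a) ** c).
Proof.
move=> xy; apply: IC_j_mul; apply: closed_span_gen.
by exists (one_at x - one_at y); [exact: binf_gen|exists a].
Qed.

Lemma IC_span (V : normedModType R[i]) (P : set V) (f : C -> V) c :
  linear f -> bounded_op f -> closed_subspace P ->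
  (forall x y a z, x <= y -> P (f (mright (u z) (step x a - step y a)))) ->
  IC c -> P (f c).
Proof.
move=> fl fb cP h cI; apply: (subspace_span fl fb cP cI) => d [w wI [s dE]].
have -> : d = mright (u s) (j w) by apply: emb_inj; rewrite emb_r.
have gl := linear_fun_comp fl (@mright_linear _ _ (u s)).
have gb := bounded_op_comp fb (@mright_bounded _ _ (u s)).
apply: (subspace_span (f := (f \o mright (u s)) \o j) _ _ cP wI).
- exact: linear_fun_comp gl (hom_linear j).
- exact: bounded_op_comp gb (hom_bounded j).
move=> _ [k kI [a ->]].
have jl := linear_fun_comp (hom_linear j) (tens_linear_l hT a).
have jb := bounded_op_comp (hom_bounded j) (tens_bounded_l hT a).
apply: (subspace_span (f := (f \o mright (u s)) \o (j \o tens^~ a)) _ _ cP kI).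
- exact: linear_fun_comp gl jl.
- exact: bounded_op_comp gb jb.
by move=> _ [x [y [/ltW xy ->]]]; rewrite /= (tensBl hT) homB; exact: h.
Qed.
End Ideal.

(** * The covariant pair in the corner *)

Section CornerRepresentation.
Local Notation D := (corner_alg p_star p_idem).
Local Notation rst := (restr p_star p_idem).
Local Notation val_D := (@sub_val _ _ _ : D -> C).

Lemma compress_step0 a : compress p (step 0 a) = step 0 a.
Proof. by apply: compress_id; rewrite ?step_comm_p p_step_ge. Qed.

Definition corner_step a : D := to_corner p_star p_idem (step 0 a).

Lemma corner_stepE a : val_D (corner_step a) = step 0 a.
Proof. exact: compress_step0. Qed.

Fact corner_step_linear : linear corner_step.
Proof.
move=> c a b; apply: sub_val_inj; rewrite corner_stepE.
rewrite -[RHS]/(c *: val_D (corner_step a) + val_D (corner_step b)) !corner_stepE.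
by rewrite (tens_linear_r hT) (hom_linear j).
Qed.
Fact corner_stepM a b : corner_step (a ** b) = corner_step a ** corner_step b.
Proof.
apply: sub_val_inj; rewrite corner_inclM !corner_stepE -homM (tens_mul hT).
by rewrite one_at_le.
Qed.
Fact corner_step_star a : corner_step (star a) = star (corner_step a).
Proof.
apply: sub_val_inj; rewrite corner_incl_star !corner_stepE -hom_star (tens_star hT).
by rewrite one_at_star.
Qed.
Definition corner_rep : starHom A D :=
  StarHom corner_step_linear corner_stepM corner_step_star.

Lemma corner_repE a : val_D (corner_rep a) = step 0 a.
Proof. exact: corner_stepE. Qed.

(** Elements of A are limits of sums of products b b'. In a compressed step with coefficient b b',
    the factor b can be pulled out as a step at 0, which stays in the corner. *)
Lemma corner_rep_nondegenerate : nondegenerate_hom corner_rep.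
Proof.
apply/seteqP; split=> // d _.
set S := [set x | exists a d, x = corner_rep a ** d].
pose f := to_corner p_star p_idem.
have fl : linear f := to_corner_linear p_star p_idem.
have fb : bounded_op f := to_corner_bounded p_star p_idem.
have -> : d = f (val_D d) by apply: sub_val_inj; apply/esym; exact: (sub_valP d).
have : closed_span [set x | exists w c, x = j w ** c] (val_D d).
  by rewrite [closed_span _](cp_nondegenerate hC).
apply: (closed_span_map fl fb) => _ [t [c ->]].
apply: (@step_span _ (closed_span S) (f \o amul^~ c) t).
- exact: linear_fun_comp fl (amulr_linear c).
- exact: bounded_op_comp fb (amulr_bounded c).
- exact: closed_span_subspace.
move=> x a /=.
(* Multiplication by 1_0 replaces x by the larger of x and 0. *)
have [y y0 yE] : exists2 y, 0 <= y & forall a, p ** e (step x a) = e (step y a).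
  exists (if 0 <= x then x else 0) => [|b]; first by case: ifP.
  by rewrite p_tens one_atM.
have : closed_span [set z | exists a b, z = a ** b] a by exact: mul_dense.
have sl := linear_fun_comp (hom_linear j) (tens_linear_r hT (one_at x)).
have sb := bounded_op_comp (hom_bounded j) (tens_bounded_r hT (one_at x)).
have cl := linear_fun_comp fl (amulr_linear c).
have cb := bounded_op_comp fb (amulr_bounded c).
apply: (closed_span_map (f := (f \o amul^~ c) \o (j \o tens (one_at x)))).
- exact: linear_fun_comp cl sl.
- exact: bounded_op_comp cb sb.
move=> _ [b [b' ->]]; apply: closed_span_gen; exists b, (f (step y b' ** c)).
apply: sub_val_inj; rewrite corner_inclM corner_repE; apply: emb_inj.
rewrite homM !emb_to_corner !homM !amulA yE step_comm_p p_step_ge //.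
by rewrite -!homM (tens_mul hT) one_at_le.
Qed.

(** The sign is negative because [gamma] acts on A through alpha^-1. *)
Definition corner_V s : multiplier D := rst (u (- val s)).

Lemma corner_V_star s : star (corner_V s) = rst (u (val s)).
Proof. by rewrite -restr_star u_star opprK. Qed.

Lemma restr_p_l X : rst (p ** X) = rst X.
Proof. by apply: restr_ext; rewrite !amulA p_idem. Qed.

Lemma corner_VD s t : corner_V s ** corner_V t = corner_V (s + t).
Proof.
rewrite restrM -restr_p_l !amulA p_uN_p -amulA restr_p_l uD.
by rewrite -opprD.
Qed.

Lemma corner_V_proj s : star (corner_V s) ** corner_V s = rst (E (val s)).
Proof. by rewrite corner_V_star restrM. Qed.

(** Conjugation by u_(-s) moves 1_0 tensor a to 1_(-s) tensor alpha_s(a), and p cuts 1_(-s) back to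
    1_0. The initial projection of V_s is the compression of E_s, which commutes with all steps. *)
Lemma corner_covariant :
  piso_covariant alpha (hom_comp (mult_emb D) corner_rep) corner_V.
Proof.
have pE a : hom_comp (mult_emb D) corner_rep a = rst (e (step 0 a)).
  by rewrite -corner_repE restr_emb.
split; first split=> [s|s t].
- rewrite -amulA corner_V_proj restrM.
  have -> : u (- val s) ** p ** E (val s) = u (- val s) ** E (val s).
    by rewrite -amulA -E0 E_le // pcone_valP.
  by rewrite /E !amulA uD addNr u0 amul1l restr_p_l.
- exact: corner_VD.
- move=> s a; rewrite !pE corner_V_star !restrM.
  rewrite -[u (- val s) ** p ** _]amulA p_step_ge //.
  rewrite -[u (- val s) ** _ ** p]amulA step_comm_p p_step_ge //.
  rewrite u_step -amulA uD addNr u0 amul1r -[RHS]restr_p_l p_tens add0r ext_inv_neg.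
  have s0 : - val s <= 0 by rewrite -[leRHS](addNr (val s)) leG_addr.
  by rewrite (one_at_le _ s0).
move=> s a; rewrite !pE corner_V_proj !restrM.
rewrite -[E _ ** p ** _]amulA step_comm_p !p_step_ge //.
by rewrite E_step step_E.
Qed.

Section Isomorphism.
Variables (P : cstarType R) (iA : starHom A P) (iG : pcone G -> multiplier P).
Hypothesis hP : is_piso_crossed_product alpha iA iG.
Variable Psi0 : starHom P D.
Hypothesis Psi0A : forall a, Psi0 (iA a) = corner_rep a.
Hypothesis Psi0V : forall s, extends_at (hom_comp (mult_emb D) Psi0) (iG s) (corner_V s).
Implicit Types (k l : P).

Definition Psi : starHom P C := hom_comp (corner_incl p_star p_idem) Psi0.

Lemma Psi_iA a : Psi (iA a) = step 0 a.
Proof. by rewrite /= Psi0A corner_repE. Qed.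

Lemma Psi0_nondegenerate : nondegenerate_hom Psi0.
Proof.
apply: (closure_sub_span corner_rep_nondegenerate) => _ [a [d ->]].
by apply: closed_span_gen; exists (iA a), d; rewrite Psi0A.
Qed.

Lemma p_Psi k : p ** e (Psi k) = e (Psi k).
Proof. exact: corner_l. Qed.
Lemma Psi_p k : e (Psi k) ** p = e (Psi k).
Proof. exact: corner_r. Qed.

Lemma Psi_l s k : e (Psi (mleft (iG s) k)) = p ** u (- val s) ** e (Psi k).
Proof.
by apply: restr_emb_inj; apply/esym; exact: (Psi0V s k).
Qed.

(** No p remains in front, in contrast to [Psi_l]: u_s with s >= 0 preserves the range of p, by
    [p_u_p]. *)
Lemma Psi_l_star s k : e (Psi (mleft (star (iG s)) k)) = u (val s) ** e (Psi k).
Proof.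
have h : e (Psi (mleft (star (iG s)) k)) = p ** u (val s) ** e (Psi k).
  apply: restr_emb_inj; rewrite -corner_V_star; apply/esym.
  exact: (ext_star_hom Psi0_nondegenerate (Psi0V s) k).
by rewrite h -p_Psi amulA p_u_p -amulA p_Psi.
Qed.

Lemma Psi_r s k : e (Psi (mright (iG s) k)) = e (Psi k) ** u (- val s).
Proof.
have -> : mright (iG s) k = star (mleft (star (iG s)) (star k)) by rewrite /= !starK.
by rewrite (hom_star Psi) (hom_star e) Psi_l_star (hom_star Psi) (hom_star e) starM starK u_star.
Qed.

Lemma Psi_r_star s k : e (Psi (mright (star (iG s)) k)) = e (Psi k) ** u (val s) ** p.
Proof.
have -> : mright (star (iG s)) k = star (mleft (iG s) (star k)) by [].
by rewrite !hom_star Psi_l !hom_star !starM starK u_star opprK p_star amulA.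
Qed.

Lemma Psi_gen s t a k : mult_emb P k = star (iG s) ** mult_emb P (iA a) ** iG t ->
  e (Psi k) = u (val s) ** e (step 0 a) ** u (- val t).
Proof.
move=> kE; have -> : k = mleft (star (iG s)) (mright (iG t) (iA a)).
  by apply: emb_inj; rewrite emb_l emb_r kE amulA.
by rewrite Psi_l_star Psi_r Psi_iA amulA.
Qed.

(* A representation of [P] on [H] is the compression to [H] of a representation
   of [C] on the dilation space. *)
Lemma Psi_eq0 k : Psi k = 0 -> k = 0.
Proof.
move=> k0; have [//|kn0] := eqVneq k 0.
have [H [rho [r1 rn [xi [xi0 le]]]]] := gns_norm kn0.
pose V s := rho (iG s); pose r := hom_comp rho (mult_emb P).
have pin : nondegenerate_rep (hom_comp r iA).
  by apply: nondegenerate_rep_comp rn (piso_nondegenerate hP).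
have hV : piso_covariant alpha (hom_comp r iA) V := piso_cov_map rho (piso_cov hP).
have [L [Phi [W [f [fl fi Phin PhiW WPhi]]]]] :=
  dilation halpha hT hgammaE hC pin hV.
have rV s : extends_at r (iG s) (V s) by move=> b; rewrite -[RHS]/(rho (mult_emb P _)) emb_l homM.
have key : forall l, Phi (Psi l) (f xi) = f (r l xi).
  apply: (@bl_ext _ _ _ _ _ _ _ _ _ _ (piso_span hP)).
  - exact: (hom_apply_linear (hom_comp Phi Psi)).
  - exact: (hom_apply_bounded (hom_comp Phi Psi)).
  - exact: linear_fun_comp fl (hom_apply_linear r xi).
  - apply: bounded_op_comp (hom_apply_bounded r xi).
    by apply/bounded_opP; exists 1 => // h; rewrite fi mul1r.
  move=> l [s [a [t lE]]].
  rewrite (piso_gen_value rn rV lE) /= -WPhi.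
  have -> : Phi (Psi l) = W (val s) ** Phi (step 0 a) ** star (W (val t)).
    apply: (nd_cancel Phin) => c.
    rewrite -amulA (ext_star Phin (PhiW (val t))) -amulA -!homM PhiW; congr (Phi _).
    by apply: emb_inj; rewrite homM (Psi_gen lE) emb_l homM emb_l u_star !amulA.
  by [].
move: le; rewrite -[rho _]/(r k) -(fi (r k xi)) -key k0 hom0 nr0 => le.
apply: nr_le0; rewrite -(ler_pM2r (_ : 0 < nr xi)) ?mul0r //.
by rewrite lt_neqAle eq_sym xi0 nr_ge0.
Qed.

Lemma Psi_inj : injective Psi.
Proof.
move=> k l kl; apply/eqP; rewrite -subr_eq0; apply/eqP/Psi_eq0.
by rewrite homB kl subrr.
Qed.

Lemma Psi_image_subspace (S : set P) :
  closed_subspace S -> closed_subspace (Psi @` S).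
Proof.
move=> [S0 Sl Sc]; split.
- by exists 0 => //; exact: hom0.
- move=> c _ _ [k Sk <-] [l Sl' <-]; exists (c *: k + l); first exact: Sl.
  by rewrite homD homZ.
exact: isometry_closed_image (injective_hom_isometric Psi_inj) Sc.
Qed.

(** The element k is independent of x, which enters only through the projection V_m^* V_m with m the
    larger of x and 0. This uniformity is what later puts differences of steps in the kernel of
    [phi]. *)
Lemma corner_generator z a : exists k, forall x, exists m,
  Psi (mleft (star (iG m)) (mleft (iG m) k)) = compress p (mright (u z) (step x a)).
Proof.
(* The unitary u_z comes from V_z^* if z >= 0 and from V_(-z) otherwise. *)
have [k kE] : exists k, e (Psi k) = e (step 0 a) ** u z ** p.
  have /orP[/pcone_of[t ->]|z0] := le_totalG 0 z.
    by exists (mright (star (iG t)) (iA a)); rewrite Psi_r_star Psi_iA.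
  have /pcone_of[t tE] : 0 <= - z by have := subG_ge0 z0; rewrite sub0r.
  exists (mright (iG t) (iA a)).
  by rewrite -[LHS]Psi_p Psi_r Psi_iA -tE opprK.
exists k => x.
have m0 : 0 <= if 0 <= x then x else 0 by case: ifP.
exists (PCone _ m0); apply: emb_inj.
rewrite Psi_l_star Psi_l kE !amulA -/(E _) emb_compress emb_r !amulA p_tens one_atM.
by rewrite /= E_step (one_at_le _ m0).
Qed.

Lemma Psi_range : range Psi = corner p [set: C].
Proof.
apply/seteqP; split=> [_ [k _ <-]|y [c _ yE]].
  by exists (Psi k) => //; rewrite p_Psi Psi_p.
have -> : y = compress p c by apply: emb_inj; rewrite yE emb_compress.
have cP : closed_subspace (range Psi).
  by apply: Psi_image_subspace; split.
have : closed_span [set x | exists w z, e x = e (j w) ** u z] c.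
  by rewrite (cp_span hC).
move=> hc; apply: (subspace_span (@compress_linear _ _ p) (@compress_bounded _ _ p) cP hc).
move=> d [w [z dE]]; have -> : d = mright (u z) (j w) by apply: emb_inj; rewrite emb_r.
apply: (@step_span _ (range Psi) (compress p \o mright (u z)) w) => //.
- exact: linear_fun_comp (@compress_linear _ _ p) (@mright_linear _ _ (u z)).
- exact: bounded_op_comp (@compress_bounded _ _ p) (@mright_bounded _ _ (u z)).
move=> x a; have [k kP] := corner_generator z a; have [m mE] := kP x.
rewrite /= -mE; by exists (mleft (star (iG m)) (mleft (iG m) k)).
Qed.

(** * The kernel of the natural surjection *)

Section Kernel.
Variables (Q : cstarType R) (kA : starHom A Q) (kG : pcone G -> multiplier Q).
Hypothesis hQ : is_iso_crossed_product alpha kA kG.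
Variable phi : starHom P Q.
Hypothesis hphi : natural_map iA iG kA kG phi.
Local Notation IC := (ideal_crossed_product j u
            (closed_span [set x : T | exists2 f : B_Gamma R G,
               B_Gamma_infty f & exists a : A, x = tens f a])).

Lemma phi_nondegenerate : nondegenerate_hom phi.
Proof.
apply: (closure_sub_span (iso_nondegenerate hQ)) => _ [a [q ->]].
by apply: closed_span_gen; exists (iA a), q; rewrite hphi.1.
Qed.

Lemma phi_proj m k : phi (mleft (star (iG m)) (mleft (iG m) k)) = phi k.
Proof.
have [[uu _] _] := iso_cov hQ; apply: emb_inj.
rewrite (ext_left _ (ext_star_hom phi_nondegenerate (hphi.2 m))).
by rewrite (ext_left _ (hphi.2 m)) amulA uu amul1l.
Qed.

Lemma ideal_sub_Psi_ker (y : C) : corner p IC y -> (Psi @` hom_ker phi) y.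
Proof.
case=> c cI yE; have -> : y = compress p c by apply: emb_inj; rewrite yE emb_compress.
apply: (IC_span (f := compress p)) cI.
- exact: compress_linear.
- exact: compress_bounded.
- apply: Psi_image_subspace; split=> /= [|d k l|v l].
  + exact: hom0.
  + by rewrite /hom_ker /= homD homZ => -> ->; rewrite scaler0 addr0.
  move=> v0 vl; apply: (tends_uniq (tends_hom phi vl)).
  by rewrite (_ : (fun n => _) = fun=> 0); [exact: tends_cst|exact/funext].
(* The lifts of the two steps come from the same k, multiplied by projections that [phi] turns into
   the identity; their difference is in the kernel. *)
move=> x x' a z _; have [k kP] := corner_generator z a.
have [m mE] := kP x; have [m' m'E] := kP x'.
exists (mleft (star (iG m)) (mleft (iG m) k) - mleft (star (iG m')) (mleft (iG m') k)).
  by rewrite /hom_ker /= homB !phi_proj subrr.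
rewrite homB mE m'E.
have l1 := linearB_fun (@compress_linear _ _ p).
have l2 := linearB_fun (@mright_linear _ _ (u z)).
by rewrite l2.2 l1.2.
Qed.

Definition corner_ideal : set D := [set d | IC (val_D d)].

Lemma corner_ideal_closed : closed_ideal corner_ideal.
Proof.
split; first split.
- exact: closed_span0.
- by move=> c x y Ix Iy; exact: closed_span_lin.
- by move=> x y Iy; exact: IC_mull.
- by move=> x y Ix; exact: IC_mulr.
- by move=> x Ix; exact: IC_star.
move=> v l vI vl; exact: (@seq_closed_closure _ _ _ (fun n => val_D (v n)) _ vI vl).
Qed.

Lemma corner_V_isometry_mod s d :
  corner_ideal (d - mleft (star (corner_V s) ** corner_V s) d).
Proof.
pose F (d : D) := d - mleft (star (corner_V s) ** corner_V s) d.
rewrite -/(F d).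
have : closed_span [set x | exists a d, x = corner_rep a ** d] d.
  by rewrite [closed_span _]corner_rep_nondegenerate.
move=> hd; apply: (@subspace_span _ _ _ F corner_ideal _ _ _ _ _ hd).
- exact: @mleft_linear _ _ (aone - star (corner_V s) ** corner_V s).
- exact: @mleft_bounded _ _ (aone - star (corner_V s) ** corner_V s).
- by have [[i0 il _] _ _ ic] := corner_ideal_closed; split.
move=> _ [a [d' ->]].
(* On a vector of this form V_s^* V_s acts as E_s, which replaces 1_0 by 1_s because s >= 0. *)
have hE : val_D (F (corner_rep a ** d')) = j (tens (one_at 0 - one_at (val s)) a) ** val_D d';
  last first.
  rewrite -[corner_ideal _]/(IC (val_D (F (corner_rep a ** d')))) hE.
  by apply: IC_step; exact: pcone_valP.
apply: emb_inj.
have -> : val_D (F (corner_rep a ** d')) = step 0 a ** val_D d' -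
   val_D (mleft (rst (E (val s))) (corner_rep a ** d')).
  by rewrite /F corner_V_proj -corner_repE.
rewrite homB restrE corner_inclM corner_repE (tensBl hT) !homM !homB amulDl amulNl.
by rewrite amulA -[p ** E _ ** _]amulA E_step p_tens !(one_at_le _ (pcone_valP s)).
Qed.

(* Modulo [corner_ideal] the pair [(corner_rep, corner_V)] is isometric, so a
   representation of [D] killing this ideal factors through [phi] on [P]. *)
Lemma Psi_ker_sub_ideal k : phi k = 0 -> IC (Psi k).
Proof.
move=> k0; apply: contrapT => nI.
have [H [rho [r1 rn rI rk]]] := @gns_ideal R D _ (Psi0 k) corner_ideal_closed nI.
pose r := hom_comp rho (mult_emb D).
pose W s := rho (corner_V s).
have pin : nondegenerate_rep (hom_comp r corner_rep).
  by apply: nondegenerate_rep_comp rn corner_rep_nondegenerate.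
have [[_ VD] V2 _] := piso_cov_map rho corner_covariant.
have [|rq [rqn rqA rqW]] := iso_universal hQ (V := W) pin.
  split; last exact: V2.
  split=> [s|]; last exact: VD.
  apply: (nd_cancel rn) => d; rewrite amul1l -hom_star -homM.
  have h := rI _ (@corner_V_isometry_mod s d); rewrite !homB emb_l homM in h.
  by move/eqP: h; rewrite subr_eq0 => /eqP/esym.
have r2V s : extends_at (hom_comp r Psi0) (iG s) (W s).
  move=> b; rewrite /= -homM; congr (rho _); exact: (Psi0V s b).
have r1V s : extends_at (hom_comp rq phi) (iG s) (W s).
  move=> b; rewrite /= rqW; congr (rq _); apply: emb_inj.
  by rewrite emb_l; exact: (hphi.2 s b).
have n1 : nondegenerate_rep (hom_comp rq phi).
  exact: nondegenerate_rep_comp rqn phi_nondegenerate.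
have n2 : nondegenerate_rep (hom_comp r Psi0).
  exact: nondegenerate_rep_comp rn Psi0_nondegenerate.
apply: rk.
have : forall l, hom_comp rq phi l = hom_comp r Psi0 l.
  apply: (hom_ext (piso_span hP)) => l [s [a [t lE]]].
  rewrite (piso_gen_value n1 r1V lE) (piso_gen_value n2 r2V lE); congr (_ ** _ ** _).
  by rewrite /= hphi.1 rqA Psi0A.
by move=> /(_ k) /= <-; rewrite k0 hom0.
Qed.

Lemma Psi_ker : Psi @` hom_ker phi = corner p IC.
Proof.
apply/seteqP; split=> [_ [k k0 <-]|]; last exact: ideal_sub_Psi_ker.
by exists (Psi k); [exact: Psi_ker_sub_ideal|rewrite p_Psi Psi_p].
Qed.
End Kernel.
End Isomorphism.
End CornerRepresentation.
End StepCrossedProduct.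

Theorem corollary5p3 (R : realType) (G : ordGroupType) (A : cstarType R)
  (alpha : pcone G -> starAut A) (halpha : is_action alpha)
  (* the C*-algebra T = B_Gamma (x) A and gamma_infty = tau (x) alpha^-1 *)
  (T : cstarType R) (tens : B_Gamma R G -> A -> T)
  (hT : is_tensor_product tens)
  (gamma : G -> starAut T) (hgamma : is_action gamma)
  (hgammaE : forall (s : G) (f : B_Gamma R G) (a : A),
     gamma s (tens f a) = tens (tau s f) (aut_inv (extend_action alpha s) a))
  (* P, Q and phi : P -> Q *)
  (P : cstarType R) (iA : starHom A P) (iG : pcone G -> multiplier P)
  (hP : is_piso_crossed_product alpha iA iG)
  (Q : cstarType R) (kA : starHom A Q) (kG : pcone G -> multiplier Q)
  (hQ : is_iso_crossed_product alpha kA kG)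
  (phi : starHom P Q) (hphi : natural_map iA iG kA kG phi)
  (* the group crossed product C of T by G *)
  (C : cstarType R) (j : starHom T C) (u : G -> multiplier C)
  (hC : is_crossed_product gamma j u)
  (* e = 1_0 (x) 1 in M(T) and its image p in M(C) *)
  (e : multiplier T)
  (he : forall (f : B_Gamma R G) (a : A),
     mleft e (tens f a) = tens (one_at 0 ** f) a)
  (p : multiplier C) (hp : extends_at (hom_comp (mult_emb C) j) e p) :
  full_corner p /\
  exists Psi : starHom P C,
    [/\ injective Psi,
        range Psi = corner p [set: C]
      & Psi @` hom_ker phi =
          corner p (ideal_crossed_product j u
            (closed_span [set x : T | exists2 f : B_Gamma R G,
               B_Gamma_infty f & exists a : A, x = tens f a]))].
Proof.
split; first exact: (corner_full halpha hT hgammaE hC he hp).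
have [|Psi0 [Psi0A Psi0V]] := piso_universal_cstar hP
  (pi0 := corner_rep halpha hT hgammaE hC he hp) _
  (corner_covariant halpha hT hgammaE hC he hp).
  exact: corner_rep_nondegenerate.
exists (Psi Psi0); split.
- exact: Psi_inj hP Psi0 Psi0A Psi0V.
- exact: Psi_range hP Psi0 Psi0A Psi0V.
exact: (Psi_ker hP Psi0A Psi0V hQ hphi).
Qed.
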